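(* Let $N,m,n\ge 1$ be integers. Finite $\mathcal{G}$-determinacy holds in general in $M_{mn}(\mathcal{O}_N)$; that is, all germs $F\in M_{mn}(\mathcal{O}_N)$ outside some proalgebraic set of infinite codimension are finitely $\mathcal{G}$-determined.
   Context: $M_{mn}\cong\mathbb{C}^{mn}$ is the space of complex $m\times n$ matrices. $\mathcal{O}_N$ is the ring of germs at $0$ of analytic functions on $\mathbb{C}^N$. $M_{mn}(\mathcal{O}_N)\cong\mathcal{O}_N^{mn}$ is the set of holomorphic map germs $F:(\mathbb{C}^N,0)\to M_{mn}$ (the value $F(0)$ is not required to be $0$). The group $\mathcal{G}$: let $\mathcal{R}$ be the group of germs of analytic diffeomorphisms of $(\mathbb{C}^N,0)$, $\mathcal{H}=GL_n(\mathcal{O}_N)\times GL_m(\mathcal{O}_N)$ and $\mathcal{G}=\mathcal{R}\ltimes\mathcal{H}$. Two germs $F_1,F_2\in M_{mn}(\mathcal{O}_N)$ are $\mathcal{G}$-equivalent if there exist $h\in\mathcal{R}$, $R\in GL_n(\mathcal{O}_N)$, $L\in GL_m(\mathcal{O}_N)$ with $F_1=L^{-1}(h^*F_2)R$, where $h^*F_2=F_2\circ h$. A germ $F\in M_{mn}(\mathcal{O}_N)$ is $r$-$\mathcal{G}$-determined if every $G\in M_{mn}(\mathcal{O}_N)$ with $j^rG(0)=j^rF(0)$ ($r$-jets at $0$) is $\mathcal{G}$-equivalent to $F$; $F$ is finitely $\mathcal{G}$-determined if such an $r$ exists. Properties holding in general: let $J^r$ denote the finite-dimensional complex vector space of $r$-jets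 at $0$ of germs in $M_{mn}(\mathcal{O}_N)$, and $\pi:J^{r+1}\to J^r$ the canonical projection. If $A_r\subset J^r$ are algebraic sets with $A_{r+1}\subset\pi^{-1}(A_r)$ for all $r$, then the set $A$ of germs $F\in M_{mn}(\mathcal{O}_N)$ with $j^rF(0)\in A_r$ for all $r$ is called proalgebraic. The codimension of $A_r$ in $J^r$ is non-decreasing in $r$, and one writes $\operatorname{codim}A=\lim_{r\to\infty}\operatorname{codim}A_r$. A property of germs in $M_{mn}(\mathcal{O}_N)$ holds in general if it holds for all germs except those in a proalgebraic set of infinite codimension. *)

(* Defs.v *)
From HB Require Import structures.
From mathcomp Require Import all_boot all_order all_algebra.
From mathcomp Require Import all_classical all_reals all_analysis.
From mathcomp Require Import complex.
(* The notations of mpoly clash with those of mathcomp-analysis. *)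
From mathcomp Require Import -(notations) mpoly.

Set Implicit Arguments.
Unset Strict Implicit.
Unset Printing Implicit Defensive.

Import Order.TTheory GRing.Theory Num.Theory.
Import numFieldNormedType.Exports.

Local Open Scope classical_set_scope.
Local Open Scope ring_scope.

(* Declaring R[i] at type numFieldType gives it, and matrices over it, the
   topology of numFieldNormedType. *)
Definition Cplx (R : realType) : numFieldType := R[i].

(* Germs at 0 are represented by total functions on C^N, of which only the
   values near 0 matter: germs are equal when their representatives agree near
   0, and all the notions below are invariant under this relation. *)
Section Germs.
Variables (R : realType) (N : nat).
Local Notation C := (Cplx R).
Implicit Types f : 'rV[C]_N -> C.

(* [mmap1 (z ord0) a] is the monomial z^a, and [bmultinom N d] is the finite
   type of the multi-indices of total degree < d. *)
Definition monomial_term (c : multinom N -> C) (z : 'rV[C]_N)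
    (a : multinom N) : C :=
  c a * mmap1 (z ord0) a.

Definition absolutely_converges (c : multinom N -> C) (z : 'rV[C]_N) : Prop :=
  exists M : C, forall d : nat,
    \sum_(a : bmultinom N d) `|monomial_term c z (bmnm a)| <= M.

Definition power_series_at0 (c : multinom N -> C) f : Prop :=
  \forall z \near (0 : 'rV[C]_N),
    absolutely_converges c z /\
    (\sum_(a : bmultinom N d) monomial_term c z (bmnm a)) @[d --> \oo] --> f z.

Definition analytic_at0 f : Prop := exists c, power_series_at0 c f.

(* The power series of an analytic germ is unique; the value for a function
   which is not analytic at 0 is junk. *)
Definition taylor_coef f : multinom N -> C :=
  xget (fun=> 0) [set c | power_series_at0 c f].

Definition analytic_mx m n (F : 'rV[C]_N -> 'M[C]_(m, n)) : Prop :=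
  forall i j, analytic_at0 (fun z => F z i j).

(* Representatives of the elements of GL_k(O_N), the group of units of the
   ring of k x k matrices over O_N. *)
Definition GL_germ k (L : 'rV[C]_N -> 'M[C]_k) : Prop :=
  analytic_mx L /\
  exists L' : 'rV[C]_N -> 'M[C]_k,
    [/\ analytic_mx L',
        \forall z \near (0 : 'rV[C]_N), L z *m L' z = 1%:M &
        \forall z \near (0 : 'rV[C]_N), L' z *m L z = 1%:M].

Definition diffeo_germ (h : 'rV[C]_N -> 'rV[C]_N) : Prop :=
  [/\ analytic_mx h, h 0 = 0 &
      exists k : 'rV[C]_N -> 'rV[C]_N,
        [/\ analytic_mx k, k 0 = 0,
            \forall z \near (0 : 'rV[C]_N), k (h z) = z &
            \forall z \near (0 : 'rV[C]_N), h (k z) = z]].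

End Germs.

Section AffineSpace.
Variables (R : realType) (I : finType).
Local Notation C := (Cplx R).
Implicit Types V : set {ffun I -> C}.

Definition peval (p : mpoly #|I| C) (x : {ffun I -> C}) : C :=
  meval (fun k => x (enum_val k)) p.

Definition algebraic_set V : Prop :=
  exists S : set (mpoly #|I| C),
    V = [set x | forall p, S p -> peval p x = 0].

Definition irreducible_set V : Prop :=
  [/\ algebraic_set V, V !=set0 &
      forall V1 V2, algebraic_set V1 -> algebraic_set V2 ->
        V = V1 `|` V2 -> V = V1 \/ V = V2].

Definition irreducible_chain V (d : nat) : Prop :=
  exists Z : nat -> set {ffun I -> C},
    (forall i, (i <= d)%N -> irreducible_set (Z i) /\ Z i `<=` V) /\
    (forall i, (i < d)%N -> Z i `<` Z i.+1).

(* Krull dimension; the dimension of set0 is -oo, so its codimension is +oo. *)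
Definition dim_alg V : \bar R :=
  ereal_sup [set (d%:R)%:E | d in [set d | irreducible_chain V d]].

Definition codim_alg V : \bar R := ((#|I|%:R)%:E - dim_alg V)%E.

End AffineSpace.

Section Jets.
Variables (R : realType) (N m n : nat).
Local Notation C := (Cplx R).

Definition jet_index (r : nat) : finType :=
  ('I_m * 'I_n * bmultinom N r.+1)%type.

(* An r-jet is given by the coefficients of degree <= r of the Taylor series of
   the entries. *)
Definition jet_space (r : nat) := {ffun jet_index r -> C}.

Definition jet (r : nat) (F : 'rV[C]_N -> 'M[C]_(m, n)) : jet_space r :=
  [ffun k : jet_index r =>
     taylor_coef (fun z => F z k.1.1 k.1.2) (bmnm k.2)].

Definition widen_bmultinom (r : nat) (a : bmultinom N r.+1) :
    bmultinom N r.+2 :=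
  BMultinom (leqW (bmdeg a)).

Definition jet_proj (r : nat) (x : jet_space r.+1) : jet_space r :=
  [ffun k : jet_index r => x (k.1, widen_bmultinom k.2)].

Definition proalgebraic (A : forall r, set (jet_space r)) : Prop :=
  (forall r, algebraic_set (A r)) /\
  (forall r, A r.+1 `<=` @jet_proj r @^-1` A r).

Definition proalgebraic_set (A : forall r, set (jet_space r)) :
    set ('rV[C]_N -> 'M[C]_(m, n)) :=
  [set F | analytic_mx F /\ forall r, A r (jet r F)].

Definition infinite_codim (A : forall r, set (jet_space r)) : Prop :=
  codim_alg (A r) @[r --> \oo] --> +oo%E.

Definition holds_in_general
    (P : ('rV[C]_N -> 'M[C]_(m, n)) -> Prop) : Prop :=
  exists A : forall r, set (jet_space r),
    [/\ proalgebraic A, infinite_codim A &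
        forall F, analytic_mx F -> ~ proalgebraic_set A F -> P F].

Definition G_equivalent (F1 F2 : 'rV[C]_N -> 'M[C]_(m, n)) : Prop :=
  exists (h : 'rV[C]_N -> 'rV[C]_N) (Q : 'rV[C]_N -> 'M[C]_n)
         (L : 'rV[C]_N -> 'M[C]_m),
    [/\ diffeo_germ h, GL_germ Q, GL_germ L &
        \forall z \near (0 : 'rV[C]_N),
          F1 z = invmx (L z) *m F2 (h z) *m Q z].

Definition G_determined (r : nat) (F : 'rV[C]_N -> 'M[C]_(m, n)) : Prop :=
  forall G : 'rV[C]_N -> 'M[C]_(m, n),
    analytic_mx G -> jet r G = jet r F -> G_equivalent G F.

Definition finitely_G_determined (F : 'rV[C]_N -> 'M[C]_(m, n)) : Prop :=
  exists r, G_determined r F.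

End Jets.

(* Main.v *)
Require Import Defs.
From mathcomp Require Import all_boot all_order all_algebra.
From mathcomp Require Import all_classical all_reals all_analysis.
From mathcomp Require Import perm cyclic separable cyclotomic.
From mathcomp Require Import complex.
From mathcomp Require Import -(notations) mpoly.
From mathcomp Require Import zify ring lra.

(** The exceptional set is the most economical one: [A r] is the Zariski closure of
    the set of [r]-jets of analytic germs that are not finitely determined.  Germs
    outside of it are finitely determined by construction, and everything rests
    on the claim that for each [k] the chains of irreducible subsets of [A r] have
    length at most [dim J^r - k] once [r] is large.

    Determinacy is reduced to algebra on jets.  If the tangent space of [F] to its
    orbit, spanned by the partial derivatives of [F] and the products [E F] and
    [F E], contains all monomial vectors of some degree [K] modulo higher degree,
    then [F] is [2 K]-determined ([determinacy_criterion]): the equation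
    [F (x + xi) (1 + B) = (1 - A) G x] is solved for [xi], [A] and [B] by
    Tougeron's implicit function theorem ([tougeron]).  Analytic germs are handled
    as uniform limits of polynomials on polydiscs ([approx], [agerm]), Cauchy
    estimates over roots of unity ([cauchy_estimate]) linking them to power
    series.

    Next, given an exponent [e] and polynomial coefficients [Gam], a square matrix
    [macaulay], linear in the jet, expresses monomial vectors of degree less than
    [M] having an exponent at least [e].  If it is invertible, all monomial vectors
    reduce to the boundedly many with exponents less than [e], and counting degrees
    gives the condition of the criterion for some [K < M] ([macaulay_criterion]).
    Hence the determinant of [macaulay], a polynomial in the jet, vanishes on [A r]
    for all choices of [e] and [Gam], as soon as [r >= M] and [M] is large.

    These choices are adapted to the matrices [\sum_i X_i ^ d Lam_i], [d = 1, ...,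
    k], where the constant matrices [Lam_i] are generic.  A count of parameters
    shows that for generic [Lam_i] the tangent space of such a matrix is everything
    at all points but the origin ([transversal_exists], [fermat_submersive]).  The
    Nullstellensatz then yields [e] and [Gam] for which its matrix [macaulay] is the
    identity, while those of the matrices with larger [d] are strictly triangular
    for the grading, all generators being homogeneous ([fermat_macaulay]).

    It follows that on [A r] the coordinates along these [k] jets satisfy, one after
    the other, monic equations over the remaining coordinates.  A count of
    monomials shows that more than [dim J^r - k] functions on [A r] are then
    algebraically dependent ([algebraic_dependence]), whereas a chain of [d + 1]
    irreducible sets yields [d] algebraically independent ones
    ([chain_algebraic_independence]); this is [chain_length_bound]. *)

Set Implicit Arguments.
Unset Strict Implicit.
Unset Printing Implicit Defensive.

Import Order.TTheory GRing.Theory Num.Theory.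
Import numFieldNormedType.Exports.

Local Open Scope classical_set_scope.
Local Open Scope ring_scope.

(** * Algebraic dependence from rewriting rules *)

Section DegreeBound.
Variables (K : fieldType) (n : nat).
Implicit Types (p q : mpoly n K) (m : multinom n).

Definition mdeg_le (t : nat) p := forall m, m \in msupp p -> (mdeg m <= t)%N.

Lemma mdeg_le0 t : mdeg_le t 0.
Proof. by move=> m; rewrite msupp0. Qed.

Lemma mdeg_leD t p q : mdeg_le t p -> mdeg_le t q -> mdeg_le t (p + q).
Proof.
by move=> hp hq m /msuppD_le; rewrite mem_cat => /orP[/hp|/hq].
Qed.

Lemma mdeg_leZ t c p : mdeg_le t p -> mdeg_le t (c *: p).
Proof. by move=> hp m /msuppZ_le /hp. Qed.

Lemma mdeg_leM s t p q : mdeg_le s p -> mdeg_le t q -> mdeg_le (s + t) (p * q).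
Proof.
move=> hp hq m /msuppM_le /allpairsP[[m1 m2] /= [/hp h1 /hq h2 ->]].
by rewrite mdegD leq_add.
Qed.

Lemma mdeg_le_mono s t p : (s <= t)%N -> mdeg_le s p -> mdeg_le t p.
Proof. by move=> st h m /h /leq_trans; apply. Qed.

Lemma mdeg_le1 t : mdeg_le t 1.
Proof. by move=> m; rewrite msupp1 inE => /eqP ->; rewrite mdeg0. Qed.

Lemma mdeg_leX m t : (mdeg m <= t)%N -> mdeg_le t (mpolyX K m).
Proof. by move=> h m'; rewrite msuppX inE => /eqP ->. Qed.

Lemma mdeg_le_exp t p k : mdeg_le t p -> mdeg_le (k * t) (p ^+ k).
Proof.
move=> h; elim: k => [|k IH]; first by rewrite expr0; exact: mdeg_le1.
by rewrite exprS mulSn; apply: mdeg_leM.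
Qed.

Lemma mdeg_le_prod t (I : finType) (F : I -> mpoly n K) :
  (forall i, mdeg_le t (F i)) -> mdeg_le (#|I| * t) (\prod_i F i).
Proof.
move=> h; rewrite -sum1_card big_distrl /=.
elim/big_ind2: _ => [|x1 x2 y1 y2|i _]; first exact: mdeg_le1.
  by apply: mdeg_leM.
by rewrite mul1n.
Qed.

Lemma mdeg_le_ex (J : finType) (f : J -> mpoly n K) :
  exists t, forall j, mdeg_le t (f j).
Proof.
exists (\max_j msize (f j))%N => j m /msize_mdeg_lt h.
by apply: (leq_trans (ltnW h)); apply: (leq_bigmax j).
Qed.

End DegreeBound.

Section Reduction.
Variables (K : fieldType) (n : nat) (V : ('I_n -> K) -> Prop).
Implicit Types (p q r : mpoly n K) (m : multinom n).

Definition vanishes_on p := forall v, V v -> meval v p = 0.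

Lemma vanishes_on0 : vanishes_on 0.
Proof. by move=> v _; rewrite meval0. Qed.

Lemma vanishes_onD p q : vanishes_on p -> vanishes_on q -> vanishes_on (p + q).
Proof. by move=> hp hq v Vv; rewrite mevalD hp // hq // addr0. Qed.

Lemma vanishes_onMl p q : vanishes_on q -> vanishes_on (p * q).
Proof. by move=> hq v Vv; rewrite mevalM hq // mulr0. Qed.

Lemma vanishes_onZ c q : vanishes_on q -> vanishes_on (c *: q).
Proof. by move=> hq v Vv; rewrite mevalZ hq // mulr0. Qed.

Variables (piv : {pred 'I_n}) (a : nat) (w : 'I_n -> nat).

Definition mweight_of m := (\sum_i m i * w i)%N.

(** For each pivot variable, a homogeneous relation on [V] trades a power of that
    variable for monomials of larger weight. *)
Definition has_rewriting := forall i, i \in piv ->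
  exists (q : mpoly n K) (b : nat),
    [/\ (b <= a)%N, vanishes_on q, mcoeff (mnm_muln (mnm1 i) b) q = 1 &
     forall m, m \in msupp q -> m != mnm_muln (mnm1 i) b ->
        mdeg m = b /\ (b * w i < mweight_of m)%N].

Definition reduced m := forall i, i \in piv -> (m i < a)%N.

Definition reducible_to (t : nat) q := exists r,
  [/\ forall m, m \in msupp r -> reduced m, mdeg_le t r & vanishes_on (q - r)].

Lemma reducible_to0 t : reducible_to t 0.
Proof.
exists 0; split; [by move=> m; rewrite msupp0|exact: mdeg_le0|].
by rewrite subr0; exact: vanishes_on0.
Qed.

Lemma reducible_toD t p q :
  reducible_to t p -> reducible_to t q -> reducible_to t (p + q).
Proof.
move=> [r [h1 h2 h3]] [s [h4 h5 h6]]; exists (r + s); split.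
- by move=> m /msuppD_le; rewrite mem_cat => /orP[/h1|/h4].
- exact: mdeg_leD.
- by rewrite opprD addrACA; apply: vanishes_onD.
Qed.

Lemma reducible_toZ t c q : reducible_to t q -> reducible_to t (c *: q).
Proof.
move=> [r [h1 h2 h3]]; exists (c *: r); split.
- by move=> m /msuppZ_le /h1.
- exact: mdeg_leZ.
- by rewrite -scalerBr; apply: vanishes_onZ.
Qed.

Lemma reducible_to_sum t (I : eqType) (s : seq I) (F : I -> mpoly n K) :
  (forall i, i \in s -> reducible_to t (F i)) ->
  reducible_to t (\sum_(i <- s) F i).
Proof.
elim: s => [|x s IH] h; first by rewrite big_nil; exact: reducible_to0.
rewrite big_cons; apply: reducible_toD; first by apply: h; rewrite mem_head.
by apply: IH => i is_; apply: h; rewrite in_cons is_ orbT.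
Qed.

Lemma reducible_to_equiv t p q :
  vanishes_on (p - q) -> reducible_to t q -> reducible_to t p.
Proof.
move=> h [r [h1 h2 h3]]; exists r; split=> //.
by rewrite -(subrKA q); apply: vanishes_onD.
Qed.

Lemma mweight_ofD m1 m2 :
  mweight_of (mnm_add m1 m2) = (mweight_of m1 + mweight_of m2)%N.
Proof.
by rewrite /mweight_of -big_split; apply: eq_bigr => i _; rewrite mnmDE mulnDl.
Qed.

Lemma mweight_of_le m : (mweight_of m <= mdeg m * \max_i w i)%N.
Proof.
rewrite mdegE big_distrl /=; apply: leq_sum => i _.
by rewrite leq_mul2l (leq_bigmax i) orbT.
Qed.

Lemma mweight_ofU i b : mweight_of (mnm_muln (mnm1 i) b) = (b * w i)%N.
Proof.
rewrite /mweight_of (bigD1 i) //= big1 ?addn0; first last.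
  by move=> j ji; rewrite mulmnE mnm1E eq_sym (negbTE ji).
by rewrite mulmnE mnm1E eqxx mul1n.
Qed.

Hypothesis rewriting : has_rewriting.

(** The weight of a monomial of fixed degree is bounded, so that rewriting,
    which increases it, terminates. *)
Lemma monomial_reducible m t : (mdeg m <= t)%N -> reducible_to t (mpolyX K m).
Proof.
have [k] := ubnP (mdeg m * \max_i w i - mweight_of m)%N.
elim: k m => // k IH m hk mt.
have [red|/existsNP[i /not_implyP[ip /negP]]] := pselect (reduced m).
  exists (mpolyX K m); split.
  - by move=> m'; rewrite msuppX inE => /eqP ->.
  - exact: mdeg_leX.
  - by rewrite subrr; exact: vanishes_on0.
rewrite -leqNgt => am.
have [q [b [ba hq q1 hm]]] := rewriting ip.
set u := mnm_muln (mnm1 i) b in q1 hm.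
have um : lem u m.
  apply/mnm_lepP => j; rewrite mulmnE mnm1E; case: eqP => [<-|//].
  by rewrite mul1n (leq_trans ba).
set m' := mnm_sub m u.
have mE : m = mnm_add m' u by rewrite submK.
have uq : u \in msupp q by rewrite mcoeff_msupp q1 oner_neq0.
(* [m = m' + u] for the pure power [u]: subtracting ['X_[m'] * q] rewrites [m]. *)
apply: (@reducible_to_equiv _ _ (- \sum_(v <- rem u (msupp q))
    mcoeff v q *: mpolyX K (mnm_add m' v))).
  rewrite opprK.
  have -> : mpolyX K m + \sum_(v <- rem u (msupp q))
      mcoeff v q *: mpolyX K (mnm_add m' v) = mpolyX K m' * q.
    rewrite [in RHS](mpolyE q) (big_rem u uq) /= q1 scale1r mulrDr mulr_sumr.
    rewrite -mpolyXD -mE; congr (_ + _); apply: eq_bigr => v _.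
    by rewrite -scalerAr mpolyXD.
  exact: vanishes_onMl.
rewrite -scaleN1r; apply: reducible_toZ.
apply: reducible_to_sum => v.
rewrite (rem_filter _ (msupp_uniq q)) mem_filter => /andP[/= vu vq].
have [dv wv] := hm _ vq vu.
have du : mdeg u = b by rewrite mdegMn mdeg1 mul1n.
have dE : mdeg (mnm_add m' v) = mdeg m by rewrite mE !mdegD dv du.
apply: reducible_toZ; apply: IH; last by rewrite dE.
have := mweight_of_le (mnm_add m' v); rewrite dE.
have := mweight_of_le m.
move: hk; rewrite [in mweight_of m]mE !mweight_ofD mweight_ofU => hk h1 h2.
move: (mdeg m * _)%N (mweight_of m') (mweight_of v) hk h1 h2 wv => A B C; lia.
Qed.

Lemma mdeg_le_reducible t q : mdeg_le t q -> reducible_to t q.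
Proof.
move=> h; rewrite (mpolyE q); apply: reducible_to_sum => m /h mt.
by apply: reducible_toZ; apply: monomial_reducible.
Qed.

Definition reduced_exponents (t : nat) : {set {ffun 'I_n -> 'I_(maxn a t.+1)}} :=
  [set e in family (fun i => [pred e : 'I_(maxn a t.+1) |
                     if i \in piv then (e < a)%N else (e < t.+1)%N])]%SET.

Lemma card_ltn_ord b c : (b <= c)%N -> #|[pred e : 'I_c | (e < b)%N]| = b.
Proof.
move=> bc; have inj : injective (widen_ord bc) by move=> x y /(congr1 val) /= /val_inj.
rewrite -[RHS]card_ord -(card_imset predT inj).
apply: eq_card => e; rewrite inE /=.
apply/idP/idP => [eb|/imsetP[x _ ->]]; last exact: (ltn_ord x).
by apply/imsetP; exists (Ordinal eb) => //; apply: val_inj.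
Qed.

Lemma card_reduced_exponents t :
  #|reduced_exponents t| = (a ^ #|piv| * t.+1 ^ (n - #|piv|))%N.
Proof.
rewrite cardsE card_family.
transitivity (\prod_(i < n) (if i \in piv then a else t.+1))%N.
  rewrite foldrE big_image /=; apply: eq_bigr => i _.
  case: ifP => ip; rewrite -[RHS](@card_ltn_ord _ (maxn a t.+1)) ?leq_maxl ?leq_maxr //;
  by apply: eq_card => e; rewrite !inE ip.
rewrite (bigID (mem piv)) /=; congr (_ * _)%N.
  under eq_bigr => i -> do [].
  by rewrite prod_nat_const.
under eq_bigr => i /negbTE -> do [].
rewrite prod_nat_const; congr (_ ^ _)%N.
have := cardC piv; rewrite card_ord => /(canRL (addKn _)).
by move=> <-; apply: eq_card => i; rewrite !inE.
Qed.

(** Reduction takes these polynomials to combinations of fewer monomials. *)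
Lemma linear_dependence t D (f : 'I_D -> mpoly n K) :
  (forall i, mdeg_le t (f i)) ->
  (a ^ #|piv| * t.+1 ^ (n - #|piv|) < D)%N ->
  exists2 c : 'I_D -> K, (exists i, c i != 0) &
    vanishes_on (\sum_i c i *: f i).
Proof.
move=> ft; rewrite -card_reduced_exponents => ltD.
have /choice [r hr] : forall i, exists r,
    [/\ forall m, m \in msupp r -> reduced m, mdeg_le t r &
      vanishes_on (f i - r)].
  by move=> i; apply: mdeg_le_reducible.
pose mon (e : {ffun 'I_n -> 'I_(maxn a t.+1)}) : multinom n :=
  Multinom [tuple (e i : nat) | i < n].
have monE e i : mon e i = e i by rewrite /mon mnmE.
pose A := \matrix_(i < D, k < #|reduced_exponents t|)
  mcoeff (mon (enum_val k)) (r i).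
have : \rank (kermx A) != 0%N.
  rewrite mxrank_ker subn_eq0 -ltnNge.
  exact: leq_ltn_trans (rank_leq_col A) ltD.
rewrite mxrank_eq0 => /rowV0Pn[c /sub_kermxP cA c0].
exists (fun i => c 0 i).
  apply/existsP; move: c0; apply: contraNT => /existsPn h.
  by apply/eqP/rowP => i; rewrite mxE; apply/eqP; rewrite -[_ == _]negbK h.
have -> : \sum_i c 0 i *: f i = \sum_i c 0 i *: (f i - r i) + \sum_i c 0 i *: r i.
  by rewrite -big_split /=; apply: eq_bigr => i _; rewrite -scalerDr subrK.
apply: vanishes_onD.
  apply: big_ind => [|p q|i _]; [exact: vanishes_on0|exact: vanishes_onD|].
  by apply: vanishes_onZ; case: (hr i).
suff -> : \sum_i c 0 i *: r i = 0 by exact: vanishes_on0.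
apply/mpolyP => m; rewrite raddf_sum mcoeff0 /=.
have [/existsP[i mi]|/existsPn nm] := boolP [exists i, m \in msupp (r i)]; last first.
  by apply: big1 => i _; rewrite mcoeffZ memN_msupp_eq0 ?mulr0.
have [h1 h2 _] := hr i.
have ltm j : (m j < maxn a t.+1)%N.
  rewrite leq_max; apply/orP; right; rewrite ltnS; apply: leq_trans (h2 _ mi).
  by rewrite mdegE (bigD1 j) //= leq_addr.
pose e : {ffun 'I_n -> 'I_(maxn a t.+1)} := [ffun j => Ordinal (ltm j)].
have ein : e \in reduced_exponents t.
  rewrite inE; apply/familyP => j; rewrite inE ffunE /=; case: ifP => [/(h1 _ mi)//|_].
  by rewrite ltnS (leq_trans _ (h2 _ mi)) // mdegE (bigD1 j) //= leq_addr.
have em : mon e = m by apply/mnmP => j; rewrite monE ffunE.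
have /rowP /(_ (enum_rank_in ein e)) := cA; rewrite !mxE => {2}<-.
by apply: eq_bigr => j _; rewrite mxE enum_rankK_in // em mcoeffZ.
Qed.

End Reduction.

Section AlgebraicDependence.
Variables (K : fieldType) (n : nat) (V : ('I_n -> K) -> Prop).
Variables (piv : {pred 'I_n}) (a : nat) (w : 'I_n -> nat).
Hypothesis rewriting : has_rewriting V piv a w.

(** Monomials in [d] functions grow like [s ^ d], while reduced monomials grow
    like [s ^ (n - #|piv|)]. *)
Lemma algebraic_dependence d (f : 'I_d -> mpoly n K) :
  (n < d + #|piv|)%N ->
  exists2 P : mpoly d K, P != 0 &
    forall v, V v -> meval (fun i => meval v (f i)) P = 0.
Proof.
move=> nd; have [e he] := mdeg_le_ex f.
(* At most [B * s ^ (n - #|piv|)] reduced monomials have degree at most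
   [e * d * s], and [s = B + 1] makes this smaller than the number [s ^ d] of
   monomials in the [f i] with exponents below [s]. *)
pose B := (a ^ #|piv| * (e * d).+1 ^ (n - #|piv|))%N.
pose s := B.+1.
have d0 : (0 < d)%N.
  by case: d nd {f he B s} => //; rewrite add0n ltnNge -[n in (_ <= n)%N]card_ord max_card.
pose T := {ffun 'I_d -> 'I_s}.
have cT : #|{: T}| = (s ^ d)%N by rewrite card_ffun !card_ord.
pose g (th : T) : mpoly n K := \prod_i f i ^+ th i.
have gdeg th : mdeg_le (e * d * s) (g th).
  have -> : (e * d * s = #|'I_d| * (s * e))%N by rewrite card_ord; lia.
  apply: mdeg_le_prod => i.
  have := @mdeg_le_exp _ _ _ _ (th i) (he i); apply: mdeg_le_mono.
  by rewrite leq_mul2r ltnW ?orbT.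
pose h (k : 'I_(#|{: T}|)) := g (enum_val k).
have [|c [k0 ck0] hc] := @linear_dependence K n V piv a w rewriting (e * d * s) _ h
   (fun k => gdeg _).
  rewrite cT.
  have kn : (#|piv| <= n)%N by rewrite -[n in (_ <= n)%N]card_ord max_card.
  have le1 : (a ^ #|piv| * (e * d * s).+1 ^ (n - #|piv|) <=
      B * s ^ (n - #|piv|))%N.
    rewrite /B -[leqRHS]mulnA leq_mul2l -expnMn; apply/orP; right.
    case: (n - #|piv|)%N => // k; rewrite leq_exp2r //.
    by rewrite mulSn addnC -addn1 leq_add2l.
  apply: (leq_ltn_trans le1); apply: (@leq_trans (s ^ (n - #|piv|).+1)%N).
    by rewrite [leqRHS]expnS ltn_pmul2r ?expn_gt0 // /s.
  by rewrite (leq_pexp2l) // ltn_subLR // addnC.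
pose mon (th : T) : multinom d := Multinom [tuple (th i : nat) | i < d].
have mon_inj : injective mon.
  move=> x y /mnmP xy; apply/ffunP => i; apply: val_inj.
  by have := xy i; rewrite /mon !mnmE.
exists (\sum_k c k *: mpolyX K (mon (enum_val k))).
  apply/eqP => /mpolyP /(_ (mon (enum_val k0))) /eqP.
  rewrite raddf_sum mcoeff0 /= (bigD1 k0) //= big1 ?addr0.
    by rewrite mcoeffZ mcoeffX eqxx mulr1 (negbTE ck0).
  move=> k kk0; rewrite mcoeffZ mcoeffX (inj_eq mon_inj) (inj_eq enum_val_inj).
  by rewrite (negbTE kk0) mulr0.
move=> v /hc <-; rewrite !raddf_sum /=; apply: eq_bigr => k _.
rewrite !mevalZ mevalX /h /g rmorph_prod; congr (_ * _).
by apply: eq_bigr => i _; rewrite rmorphXn /= /mon mnmE.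
Qed.
End AlgebraicDependence.

(** * Chains of irreducible sets give algebraically independent functions *)

Section Chains.
Variables (K : fieldType) (n : nat).
Implicit Types (Z : ('I_n -> K) -> Prop) (p q : mpoly n K).

Definition prime_locus Z := forall p q, vanishes_on Z (p * q) ->
  vanishes_on Z p \/ vanishes_on Z q.

(** Evaluation of [P] as a univariate polynomial in its last variable. *)
Definition peel d (f : 'I_d.+1 -> K) (P : mpoly d.+1 K) : K :=
  (map_poly (meval (fun i => f (widen_ord (leqnSn d) i))) (muni P)).[f ord_max].

Lemma peelE d (f : 'I_d.+1 -> K) P : peel f P = meval f P.
Proof.
rewrite /peel muniE rmorph_sum horner_sum mevalE.
apply: eq_bigr => m _ /=; rewrite map_polyZ hornerZ map_polyXn hornerXn /=.
rewrite mevalZ mevalX big_ord_recr /= mulrA; congr (_ * _ * _).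
by apply: eq_bigr => i _; rewrite mnmE.
Qed.

(** By induction on the length: the last function is a polynomial [p] that
    vanishes on [Z d] but not on [Z d.+1].  Divided by the largest power of its
    last variable, as [Z d.+1] is irreducible, a relation on [Z d.+1] restricts
    to [Z d] as a nonzero relation between the functions found before. *)
Lemma chain_algebraic_independence d (Z : nat -> ('I_n -> K) -> Prop) :
  (exists v, Z 0%N v) ->
  (forall i, (i <= d)%N -> prime_locus (Z i)) ->
  (forall i, (i < d)%N -> (forall v, Z i v -> Z i.+1 v) /\
     exists2 p, vanishes_on (Z i) p & ~ vanishes_on (Z i.+1) p) ->
  exists f : 'I_d -> mpoly n K, forall P : mpoly d K,
    (forall v, Z d v -> meval (fun i => meval v (f i)) P = 0) -> P = 0.
Proof.
move=> [v0 Zv0]; elim: d => [|d IH] pr st.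
  exists (fun _ => 0) => P /(_ _ Zv0).
  by rewrite [P]nvar0_mpolyC mevalC => ->; rewrite mpolyC0.
have [||f hf] := IH; first by move=> i id; apply: pr; exact: leqW.
  by move=> i id; apply: st; exact: ltnW.
have [sub [p pd pd1]] := st d (ltnSn d).
pose g (i : 'I_d.+1) : mpoly n K :=
  if unlift ord_max i is Some j then f j else p.
have gmax : g ord_max = p by rewrite /g unlift_none.
have gw i : g (widen_ord (leqnSn d) i) = f i.
  have -> : widen_ord (leqnSn d) i = lift ord_max i.
    by apply: val_inj; rewrite /= /bump leqNgt ltn_ord.
  by rewrite /g liftK.
exists g => P hP.
suff u0 : muni P = 0.
  apply/mpolyP => m; rewrite mcoeff0.
  pose r (m0 : multinom d.+1) :=
    Multinom [tuple m0 (widen_ord (leqnSn d) i) | i < d].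
  have rE (m0 : multinom d.+1) : (m0 == m) = (r m0 == r m) && (m0 ord_max == m ord_max).
    apply/eqP/andP => [->//|[/eqP/mnmP h1 /eqP h2]]; apply/mnmP => i.
    have [j ->|->] := unliftP ord_max i; last exact: h2.
    have -> : lift ord_max j = widen_ord (leqnSn d) j.
      by apply: val_inj; rewrite /= /bump leqNgt ltn_ord.
    by have := h1 j; rewrite /r !mnmE.
  have /polyP /(_ (m ord_max)) /mpolyP /(_ (r m)) := u0.
  rewrite coef0 mcoeff0 muniE coef_sum raddf_sum /= => <-.
  rewrite {1}(mpolyE P) raddf_sum /=; apply: eq_bigr => m0 _.
  rewrite mcoeffZ mcoeffX rE coefZ coefXn mulr_natr mcoeffMn mcoeffZ mcoeffX.
  by rewrite -mulnb natrM mulrA [m ord_max == _]eq_sym; case: (m0 _ == _); rewrite ?mulr1 ?mulr0.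
apply/eqP; apply/negPn/negP => u0.
(* [k] is the largest power of the last variable that divides [P]. *)
have [k [u [uE u00]]] : exists k (u : {poly mpoly d K}),
    muni P = u * 'X^k /\ u`_0 != 0.
  have [k [u /implyP/(_ u0) ru uE]] := multiplicity_XsubC (muni P) 0.
  by exists k, u; rewrite uE subr0; split => //; rewrite -horner_coef0.
pose E (u : {poly mpoly d K}) : mpoly n K :=
  (map_poly (comp_mpoly [tuple f i | i < d]) u).[p].
have EE u' v : meval v (E u') =
    (map_poly (meval (fun i => meval v (f i))) u').[meval v p].
  rewrite /E -horner_map -map_poly_comp; congr (_.[_]).
  apply: eq_map_poly => q /=; rewrite comp_mpoly_meval.
  by apply: meval_eq => i; rewrite tnth_mktuple.
have [] := pr d.+1 (leqnn _) (p ^+ k) (E u).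
- move=> v Zv; rewrite mevalM EE rmorphXn -(hP v Zv) -peelE /peel gmax uE.
  rewrite rmorphM /= map_polyXn hornerM hornerXn mulrC; congr (_.[_] * _).
  by apply: eq_map_poly => q; apply: meval_eq => i; rewrite gw.
- move=> hk; apply: pd1 => v /hk; rewrite rmorphXn /= => /eqP.
  by rewrite expf_eq0 => /andP[_ /eqP].
- move=> Eu; case/eqP: u00; apply: hf => v Zv.
  have := Eu v (sub _ Zv); rewrite EE pd // horner_coef0 coef_map /= => <-.
  by [].
Qed.
End Chains.

(** * The modulus of a complex number and completeness *)

Section Modulus.
Variable R : realType.
Local Notation C := (Cplx R).
Implicit Types (x y z : C) (e : R).

(** The norm of [C] has its values in [C] itself. *)
Definition cabs z : R := complex.Re (`|z| : C).
Definition ofR (r : R) : C := real_complex R r.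

Lemma normE z : `|z| = ofR (cabs z).
Proof. by rewrite /cabs /ofR RRe_real // ger0_real. Qed.

Lemma ofR_le r s : (ofR r <= ofR s) = (r <= s).
Proof. exact: lecR. Qed.

Lemma ofR_lt r s : (ofR r < ofR s) = (r < s).
Proof. exact: ltcR. Qed.

Lemma ofRD r s : ofR (r + s) = ofR r + ofR s.
Proof. exact: rmorphD. Qed.

Lemma ofRM r s : ofR (r * s) = ofR r * ofR s.
Proof. exact: rmorphM. Qed.

Lemma ofRX r k : ofR (r ^+ k) = ofR r ^+ k.
Proof. exact: rmorphXn. Qed.

Lemma ofR0 : ofR 0 = 0. Proof. by []. Qed.

Lemma ofR_inj : injective ofR.
Proof. by move=> r s []. Qed.

Lemma gt0_ofR (t : C) : 0 < t -> exists2 r, 0 < r & t = ofR r.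
Proof.
move=> t0; have tE : t = ofR (cabs t) by rewrite -normE gtr0_norm.
by exists (cabs t) => //; rewrite -ofR_lt -tE.
Qed.

Lemma cabs_ge0 z : 0 <= cabs z.
Proof. by rewrite -ofR_le -normE ofR0. Qed.

Lemma cabs0 : cabs 0 = 0.
Proof. by apply: ofR_inj; rewrite -normE normr0. Qed.

Lemma cabs1 : cabs 1 = 1.
Proof. by apply: ofR_inj; rewrite -normE normr1. Qed.

Lemma cabsM x y : cabs (x * y) = cabs x * cabs y.
Proof. by apply: ofR_inj; rewrite ofRM -!normE normrM. Qed.

Lemma cabsN x : cabs (- x) = cabs x.
Proof. by apply: ofR_inj; rewrite -!normE normrN. Qed.

Lemma cabsB x y : cabs (x - y) = cabs (y - x).
Proof. by rewrite -cabsN opprB. Qed.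

Lemma cabsD x y : cabs (x + y) <= cabs x + cabs y.
Proof. by rewrite -ofR_le ofRD -!normE ler_normD. Qed.

Lemma cabs_tri z x y : cabs (x - y) <= cabs (x - z) + cabs (z - y).
Proof. by rewrite -(subrKA z); exact: cabsD. Qed.

Lemma cabsX x k : cabs (x ^+ k) = cabs x ^+ k.
Proof. by apply: ofR_inj; rewrite ofRX -!normE normrX. Qed.

Lemma cabs_ofR r : 0 <= r -> cabs (ofR r) = r.
Proof. by move=> r0; apply: ofR_inj; rewrite -normE ger0_norm // -ofR0 ofR_le. Qed.

Lemma cabs_eq0 x : cabs x = 0 -> x = 0.
Proof. by move=> h; apply: normr0_eq0; rewrite normE h. Qed.

Lemma cabs_nat k : cabs k%:R = k%:R.
Proof.
by apply: ofR_inj; rewrite -normE normr_nat /ofR rmorph_nat.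
Qed.

Lemma cabs_sum (I : Type) (r : seq I) (P : pred I) (F : I -> C) :
  cabs (\sum_(i <- r | P i) F i) <= \sum_(i <- r | P i) cabs (F i).
Proof.
elim/big_ind2: _ => [|x1 r1 x2 r2 h1 h2|//]; first by rewrite cabs0.
exact: le_trans (cabsD _ _) (lerD h1 h2).
Qed.

Lemma cabs_prod (I : Type) (r : seq I) (P : pred I) (F : I -> C) :
  cabs (\prod_(i <- r | P i) F i) = \prod_(i <- r | P i) cabs (F i).
Proof. by rewrite (big_morph _ cabsM cabs1). Qed.

Lemma cabs_Re z : `|complex.Re z| <= cabs z.
Proof. by rewrite -ofR_le -normE; exact: normc_ge_Re. Qed.

Lemma cabs_Im z : `|complex.Im z| <= cabs z.
Proof.
have -> : cabs z = cabs (z * ('i%C : C)).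
  by rewrite cabsM -[cabs 'i%C]/(cabs _) /cabs normc_def /= expr0n /= expr1n add0r sqrtr1 mulr1.
by have := cabs_Re (z * ('i%C : C)); rewrite ReiNIm normrN.
Qed.

Lemma cabs_le_ReIm z : cabs z <= `|complex.Re z| + `|complex.Im z|.
Proof.
rewrite -ofR_le -normE [z in `|z|]complexE (le_trans (ler_normD _ _)) //.
rewrite ofRD lerD //.
  by rewrite normc_def /= expr0n /= addr0 sqrtr_sqr.
by rewrite normrM !normc_def /= !expr0n /= expr1n add0r addr0 sqrtr1 mul1r sqrtr_sqr.
Qed.

Definition tends (u : nat -> C) (l : C) :=
  forall e, 0 < e -> exists k0, forall k, (k0 <= k)%N -> cabs (u k - l) <= e.

Definition cauchy_seq (u : nat -> C) :=
  forall e, 0 < e -> exists k0, forall j k, (k0 <= j)%N -> (k0 <= k)%N ->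
    cabs (u j - u k) <= e.

Lemma tends_uniq u l l' : tends u l -> tends u l' -> l = l'.
Proof.
move=> h h'; apply/eqP; rewrite -subr_eq0; apply/eqP/cabs_eq0/eqP.
rewrite eq_le cabs_ge0 andbT; apply/ler_addgt0Pl => e e0; rewrite addr0.
have [k1 h1] := h (e / 2) ltac:(lra); have [k2 h2] := h' (e / 2) ltac:(lra).
have := h1 (maxn k1 k2) (leq_maxl _ _); have := h2 (maxn k1 k2) (leq_maxr _ _).
by have := cabs_tri (u (maxn k1 k2)) l l'; rewrite [cabs (l - u _)]cabsB; lra.
Qed.

Lemma real_complete (r : nat -> R) :
  (forall e, 0 < e -> exists k0, forall j k, (k0 <= j)%N -> (k0 <= k)%N ->
    `|r j - r k| <= e) ->
  exists l, forall e, 0 < e -> exists k0, forall k, (k0 <= k)%N -> `|r k - l| <= e.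
Proof.
move=> h; have cv : cvg (r @ \oo).
  apply: cauchy_cvg; apply/cauchy_exP => e e0.
  have [k0 hk] := h (e / 2) ltac:(lra); exists (r k0).
  exists k0 => // k /= kk; rewrite /ball /=.
  by have := hk k0 k (leqnn _) kk; lra.
exists (lim (r @ \oo)) => e e0; move/cvgrPdist_le : cv => /(_ _ e0) [k0 _ hk].
by exists k0 => k kk; rewrite distrC; exact: hk.
Qed.

Lemma cauchy_tends u : cauchy_seq u -> exists l, tends u l.
Proof.
move=> h.
have [e e0|a ha] := @real_complete (fun k => complex.Re (u k)).
  have [k0 hk] := h e e0; exists k0 => j k j0 kk.
  by rewrite -raddfB; apply: le_trans (cabs_Re _) (hk _ _ j0 kk).
have [e e0|b hb] := @real_complete (fun k => complex.Im (u k)).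
  have [k0 hk] := h e e0; exists k0 => j k j0 kk.
  by rewrite -raddfB; apply: le_trans (cabs_Im _) (hk _ _ j0 kk).
exists (Complex a b) => e e0.
have [k1 h1] := ha (e / 2) ltac:(lra); have [k2 h2] := hb (e / 2) ltac:(lra).
exists (maxn k1 k2) => k; rewrite geq_max => /andP[kk1 kk2].
apply: le_trans (cabs_le_ReIm _) _; rewrite !raddfB /=.
by have := h1 k kk1; have := h2 k kk2; lra.
Qed.

Lemma tends_cabs_le u l (b : R) k0 :
  tends u l -> (forall k, (k0 <= k)%N -> cabs (u k) <= b) -> cabs l <= b.
Proof.
move=> h hb; apply/ler_addgt0Pr => e e0; have [k1 hk] := h e e0.
have := hk (maxn k0 k1) (leq_maxr _ _); have := hb (maxn k0 k1) (leq_maxl _ _).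
rewrite cabsB => h1 h2.
by have := cabsD (l - u (maxn k0 k1)) (u (maxn k0 k1)); rewrite subrK; lra.
Qed.

End Modulus.

(** * Uniform limits of polynomials on polydiscs *)

Section Approximable.
Variable R : realType.
Local Notation C := (Cplx R).
Implicit Types (rho e : R).

Definition disc (T : Type) rho (x : T -> C) := forall t, cabs (x t) <= rho.

Lemma disc_le (T : Type) rho1 rho2 (x : T -> C) :
  rho1 <= rho2 -> disc rho1 x -> disc rho2 x.
Proof. by move=> h hx t; apply: le_trans (hx t) h. Qed.

Lemma disc0 (T : Type) rho : 0 <= rho -> disc rho (fun _ : T => 0 : C).
Proof. by move=> h t; rewrite cabs0. Qed.

Section OneSpace.
Variable T : finType.
Implicit Types (f g : (T -> C) -> C) (p q : mpoly #|T| C) (x : T -> C).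

Definition pev p x : C := meval (fun k => x (enum_val k)) p.

(** Uniform limits of polynomials are stable under sums, products, composition
    and uniform limits by their very definition; that they are sums of power
    series comes from the Cauchy estimates. *)
Definition approx rho f := forall e, 0 < e ->
  exists p, forall x, disc rho x -> cabs (f x - pev p x) <= e.

Lemma pev_const c x : pev (mpolyC _ c) x = c.
Proof. exact: mevalC. Qed.

Lemma pev_coord t x : pev (mpolyX C (mnm1 (enum_rank t))) x = x t.
Proof. by rewrite /pev mevalXU enum_rankK. Qed.

(** A property of polynomials that gives their uniform limits continuity at the
    origin. *)
Definition lipschitz_at0 rho f := exists2 B : R, 0 <= B &
  forall x, disc rho x -> cabs (f x) <= B /\
    forall d : R, 0 <= d -> disc d x -> cabs (f x - f (fun _ => 0)) <= B * d.

Lemma lipschitz_at0_const rho c : lipschitz_at0 rho (fun _ => c).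
Proof.
exists (cabs c); first exact: cabs_ge0.
by move=> x _; split=> // d d0 _; rewrite subrr cabs0 mulr_ge0 ?cabs_ge0.
Qed.

Lemma lipschitz_at0_coord rho t : 0 <= rho -> lipschitz_at0 rho (fun x => x t).
Proof.
move=> r0; exists (rho + 1); first by lra.
move=> x hx; have := hx t => ht; split=> [|d d0 hd]; first by lra.
by rewrite subr0; have := hd t; nra.
Qed.

Lemma lipschitz_at0D rho f g : lipschitz_at0 rho f -> lipschitz_at0 rho g ->
  lipschitz_at0 rho (fun x => f x + g x).
Proof.
move=> [B1 B10 h1] [B2 B20 h2]; exists (B1 + B2); first by lra.
move=> x hx; have [a1 b1] := h1 x hx; have [a2 b2] := h2 x hx; split.
  by apply: le_trans (cabsD _ _) _; lra.
move=> d d0 hd; rewrite opprD addrACA mulrDl.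
by apply: le_trans (cabsD _ _) (lerD (b1 d d0 hd) (b2 d d0 hd)).
Qed.

Lemma lipschitz_at0M rho f g : 0 <= rho ->
  lipschitz_at0 rho f -> lipschitz_at0 rho g ->
  lipschitz_at0 rho (fun x => f x * g x).
Proof.
move=> r0 [B1 B10 h1] [B2 B20 h2]; exists (2 * B1 * B2); first by nra.
move=> x hx; have [a1 b1] := h1 x hx; have [a2 b2] := h2 x hx; split.
  rewrite cabsM; have := cabs_ge0 (f x); have := cabs_ge0 (g x); nra.
move=> d d0 hd /=; set f0 := f (fun _ => 0); set g0 := g (fun _ => 0).
have -> : f x * g x - f0 * g0 = f x * (g x - g0) + g0 * (f x - f0) by ring.
have [c1 _] := h2 _ (@disc0 T rho r0).
apply: le_trans (cabsD _ _) _; rewrite !cabsM.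
have := b1 d d0 hd; have := b2 d d0 hd; rewrite -/f0 -/g0.
move: (cabs_ge0 (f x)) (cabs_ge0 g0) (cabs_ge0 (f x - f0)) (cabs_ge0 (g x - g0)).
move: (cabs (f x)) (cabs g0) (cabs (f x - f0)) (cabs (g x - g0)) a1 c1.
move=> u v w y a1 c1 u0 v0 w0 y0 h h'.
have : u * y <= B1 * (B2 * d) by apply: ler_pM.
have : v * w <= B2 * (B1 * d) by apply: ler_pM.
lra.
Qed.

(** Induction over the algebra of functions generated by given ones. *)
Lemma meval_ind (P : ((T -> C) -> C) -> Prop) n (g : 'I_n -> (T -> C) -> C)
    (p : mpoly n C) :
  (forall c, P (fun _ => c)) ->
  (forall f h, P f -> P h -> P (fun x => f x + h x)) ->
  (forall f h, P f -> P h -> P (fun x => f x * h x)) ->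
  (forall i, P (g i)) -> P (fun x => meval (fun i => g i x) p).
Proof.
move=> Pc PD PMul Pg.
have PX f k : P f -> P (fun x => f x ^+ k).
  move=> Pf; elim: k => [|k IH]; first exact: (Pc 1).
  have -> : (fun x => f x ^+ k.+1) = (fun x => f x * f x ^+ k).
    by apply: funext => x; rewrite exprS.
  exact: PMul.
elim/mpolyind: p => [|c m p _ _ IH].
  by rewrite (_ : (fun _ => _) = fun _ => 0) //; apply: funext => x; rewrite meval0.
have -> : (fun x => meval (fun i => g i x) (c *: mpolyX C m + p)) =
    fun x => c * \prod_i g i x ^+ m i + meval (fun i => g i x) p.
  by apply: funext => x; rewrite mevalD mevalZ mevalX.
apply: PD => //; apply: (PMul) => //.
elim: (index_enum _) => [|i s IHs].
  by rewrite (_ : (fun _ => _) = fun _ => 1) //; apply: funext => x; rewrite big_nil.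
have -> : (fun x => \prod_(j <- i :: s) g j x ^+ m j) =
    fun x => g i x ^+ m i * \prod_(j <- s) g j x ^+ m j.
  by apply: funext => x; rewrite big_cons.
by apply: (PMul) => //; apply: PX.
Qed.

Lemma lipschitz_at0_pev rho p : 0 <= rho -> lipschitz_at0 rho (pev p).
Proof.
move=> r0; apply: (@meval_ind _ _ (fun k x => x (enum_val k))).
- exact: lipschitz_at0_const.
- by move=> f h; apply: lipschitz_at0D.
- by move=> f h; apply: lipschitz_at0M.
- by move=> k; apply: lipschitz_at0_coord.
Qed.

Lemma approx_pev rho p : approx rho (pev p).
Proof. by move=> e e0; exists p => x _; rewrite subrr cabs0 ltW. Qed.

Lemma approx_ext rho f g :
  (forall x, disc rho x -> f x = g x) -> approx rho f -> approx rho g.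
Proof.
move=> fg h e e0; have [p hp] := h e e0; exists p => x hx.
by rewrite -fg //; exact: hp.
Qed.

Lemma approx_le rho1 rho2 f : rho1 <= rho2 -> approx rho2 f -> approx rho1 f.
Proof.
move=> r h e e0; have [p hp] := h e e0; exists p => x hx.
by apply: hp; apply: disc_le hx.
Qed.

Lemma approx_lim rho f :
  (forall e, 0 < e -> exists2 g, approx rho g &
     forall x, disc rho x -> cabs (f x - g x) <= e) -> approx rho f.
Proof.
move=> h e e0; have [g ag hg] := h (e / 2) ltac:(lra).
have [p hp] := ag (e / 2) ltac:(lra); exists p => x hx.
by have := cabs_tri (g x) (f x) (pev p x); have := hg x hx; have := hp x hx; lra.
Qed.

Lemma approx_const rho c : approx rho (fun _ => c).
Proof. by apply: approx_ext (approx_pev rho (mpolyC _ c)) => x _; exact: pev_const. Qed.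

Lemma approx_coord rho t : approx rho (fun x => x t).
Proof. by apply: approx_ext (approx_pev rho (mpolyX C (mnm1 (enum_rank t)))) => x _; exact: pev_coord. Qed.

Lemma approxD rho f g : approx rho f -> approx rho g -> approx rho (fun x => f x + g x).
Proof.
move=> hf hg e e0; have [p hp] := hf (e / 2) ltac:(lra).
have [q hq] := hg (e / 2) ltac:(lra); exists (p + q) => x hx.
rewrite /pev mevalD opprD addrACA; apply: le_trans (cabsD _ _) _.
by have := hp x hx; have := hq x hx; rewrite /pev; lra.
Qed.

Lemma approx_bounded rho f : 0 <= rho -> approx rho f -> exists2 B : R, 0 < B &
  forall x, disc rho x -> cabs (f x) <= B.
Proof.
move=> r0 h; have [p hp] := h 1 ltr01; have [B B0 hB] := lipschitz_at0_pev p r0.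
exists (B + 1) => [|x hx]; first by lra.
have [hb _] := hB x hx; have := hp x hx; have := cabsD (f x - pev p x) (pev p x).
by rewrite subrK; lra.
Qed.

Lemma approxM rho f g : 0 <= rho ->
  approx rho f -> approx rho g -> approx rho (fun x => f x * g x).
Proof.
move=> r0 hf hg e e0; have [B B0 hB] := approx_bounded r0 hf.
have [q hq] := hg (e / (2 * B)) ltac:(by apply: divr_gt0; lra).
have [D D0 hD] := approx_bounded r0 (approx_pev rho q).
have [p hp] := hf (e / (2 * D)) ltac:(by apply: divr_gt0; lra).
exists (p * q) => x hx; rewrite /pev mevalM -/(pev p x) -/(pev q x).
have -> : f x * g x - pev p x * pev q x =
  f x * (g x - pev q x) + (f x - pev p x) * pev q x by ring.
apply: le_trans (cabsD _ _) _; rewrite !cabsM.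
have h1 : cabs (f x) * cabs (g x - pev q x) <= B * (e / (2 * B)).
  by apply: ler_pM; rewrite ?cabs_ge0 ?hB ?hq.
have h2 : cabs (f x - pev p x) * cabs (pev q x) <= (e / (2 * D)) * D.
  by apply: ler_pM; rewrite ?cabs_ge0 ?hD ?hp.
apply: le_trans (lerD h1 h2) _.
suff -> : B * (e / (2 * B)) + e / (2 * D) * D = e by [].
by field; rewrite !gt_eqF.
Qed.

Lemma approx_meval rho n (g : 'I_n -> (T -> C) -> C) (p : mpoly n C) : 0 <= rho ->
  (forall i, approx rho (g i)) -> approx rho (fun x => meval (fun i => g i x) p).
Proof.
move=> r0; apply: meval_ind.
- exact: approx_const.
- by move=> f h; apply: approxD.
- by move=> f h; apply: approxM.
Qed.

End OneSpace.

Lemma approx_comp (S T : finType) rho1 rho2 (f : (S -> C) -> C)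
    (g : S -> (T -> C) -> C) : 0 <= rho2 ->
  approx rho1 f -> (forall s, approx rho2 (g s)) ->
  (forall x, disc rho2 x -> forall s, cabs (g s x) <= rho1) ->
  approx rho2 (fun x => f (fun s => g s x)).
Proof.
move=> r0 hf hg hb; apply: approx_lim => e e0; have [p hp] := hf e e0.
exists (fun x => pev p (fun s => g s x)); first by apply: approx_meval.
by move=> x hx; apply: hp => s; exact: hb.
Qed.

End Approximable.

(** * Cauchy estimates *)

Section Cauchy.
Variable R : realType.
Local Notation C := (Cplx R).

Lemma prim_root_exists D : (0 < D)%N -> exists z : C, D.-primitive_root z.
Proof.
move=> D0; have D0C : D%:R != 0 :> R[i] by rewrite pnatr_eq0 -lt0n.
have [r rE] := closed_field_poly_normal ('X^D - 1 : {poly R[i]}).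
move: rE; rewrite (monicP _) ?monicXnsubC // scale1r => rE.
have ur : uniq r by rewrite -separable_prod_XsubC -rE separable_Xn_sub_1.
have sz : (D <= size r)%N.
  by rewrite -ltnS -(size_prod_XsubC r id) -rE size_XnsubC.
have ra : all D.-unity_root r.
  apply/allP => x xr; rewrite unity_rootE -subr_eq0.
  have : root ('X^D - 1) x by rewrite rE root_prod_XsubC.
  by rewrite rootE !hornerE.
have /hasP[z _ pz] := has_prim_root D0 ra ur sz.
by exists z.
Qed.

Lemma sum_prim_root D (z : C) k : D.-primitive_root z ->
  \sum_(t < D) z ^+ (t * k) = if (D %| k)%N then D%:R else 0.
Proof.
move=> pz; have D0 := prim_order_gt0 pz.
case: ifP => [Dk|/negbT Dk].
  have zk1 : z ^+ k = 1 by apply/eqP; rewrite -(prim_order_dvd pz).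
  under eq_bigr => t _ do rewrite mulnC exprM zk1 expr1n.
  by rewrite sumr_const card_ord.
have zk : z ^+ k - 1 != 0 by rewrite subr_eq0 -(prim_order_dvd pz).
apply: (mulfI zk); rewrite mulr0.
under eq_bigr => t _ do rewrite mulnC exprM.
by rewrite -subrX1 -exprM mulnC exprM (prim_expr_order pz) expr1n subrr.
Qed.

(** The integral of Cauchy's formula is replaced by a mean over roots of unity,
    which extracts a coefficient exactly when their order [D] exceeds the degrees
    in play. *)
Lemma cauchy_estimate n (p : mpoly n C) (rho B : R) (a : multinom n) :
  0 < rho -> (forall x, disc rho x -> cabs (meval x p) <= B) ->
  cabs (mcoeff a p) * rho ^+ mdeg a <= B.
Proof.
move=> r0 hB; pose D := (msize p + mdeg a).+1.
have [z pz] := @prim_root_exists D isT.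
have cz : cabs z = 1.
  have := cabsX z D; rewrite (prim_expr_order pz) cabs1 => /esym/eqP.
  by rewrite pexpr_eq1 ?cabs_ge0 // => /eqP.
pose T := {ffun 'I_n -> 'I_D}.
pose x (th : T) i : C := ofR rho * z ^+ th i.
pose S := \sum_(th : T) (\prod_i z ^+ (th i * (D - a i))) * meval (x th) p.
have SE : S = mcoeff a p * ofR rho ^+ mdeg a * (D ^ n)%:R.
  rewrite /S; under eq_bigr => th _ do rewrite mevalE mulr_sumr.
  rewrite exchange_big /=.
  have term m : m \in msupp p ->
      \sum_(th : T) (\prod_i z ^+ (th i * (D - a i))) *
         (mcoeff m p * \prod_i x th i ^+ m i) =
      if m == a then mcoeff a p * ofR rho ^+ mdeg a * (D ^ n)%:R else 0.
    move=> mp.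
    transitivity (mcoeff m p * ofR rho ^+ mdeg m *
       \prod_i \sum_(t < D) z ^+ (t * (m i + (D - a i)))).
      rewrite bigA_distr_bigA /= mulr_sumr; apply: eq_bigr => th _.
      rewrite mulrCA -mulrA; congr (_ * _).
      rewrite mdegE -prodrXr -!big_split /=; apply: eq_bigr => i _.
      by rewrite exprMn -exprM mulrCA -exprD mulnDr addnC.
    have ltD i : (m i < D)%N /\ (a i < D)%N.
      have := msize_mdeg_lt mp; rewrite /D mdegE (bigD1 i) //= => h1.
      by rewrite [mdeg a]mdegE (bigD1 i) //=; split; lia.
    case: eqP => [->|/eqP ma].
      congr (_ * _); rewrite natrX -[n in RHS]card_ord -prodr_const.
      apply: eq_bigr => i _; rewrite sum_prim_root // subnKC ?dvdnn //.
      by have [_ /ltnW] := ltD i.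
    have [i mi] : exists i, m i != a i.
      by apply/existsP; move: ma; apply: contraNT => /existsPn h;
         apply/eqP/mnmP => i; apply/eqP/negPn/h.
    rewrite (bigD1 i) //= sum_prim_root //; case: ifP => [|_]; last by rewrite mul0r mulr0.
    have [h1 h2] := ltD i; rewrite addnBA ?(ltnW h2) // => /dvdnP[q hq].
    by case: q hq => [|[|q]]; nia.
  rewrite (eq_big_seq _ term).
  have [ap|ap] := boolP (a \in msupp p).
    rewrite (bigD1_seq a) ?msupp_uniq //= eqxx big1 ?addr0 // => m /negbTE.
    by move=> ->.
  rewrite (memN_msupp_eq0 ap) !mul0r big_seq big1 // => m mp.
  by case: eqP => // ma; rewrite -ma mp in ap.
have : cabs S <= (D ^ n)%:R * B.
  apply: le_trans (cabs_sum _ _ _) _.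
  have -> : (D ^ n)%:R * B = \sum_(th : T) B.
    by rewrite sumr_const card_ffun !card_ord mulr_natl.
  apply: ler_sum => th _; rewrite cabsM cabs_prod big1 ?mul1r.
    apply: hB => i; rewrite /x cabsM cabsX cz expr1n mulr1 cabs_ofR //.
    exact: ltW.
  by move=> i _; rewrite cabsX cz expr1n.
rewrite SE !cabsM cabsX cabs_ofR ?(ltW r0) // cabs_nat mulrC ler_pM2l //.
by rewrite ltr0n expn_gt0.
Qed.

End Cauchy.

(** * Power series on a polydisc *)

Section Sums.
Variable n : nat.

Lemma sum_bmultinom_le (V : nmodType) d d' (F : multinom n -> V) : (d <= d')%N ->
  \sum_(a : bmultinom n d) F (bmnm a) =
  \sum_(a : bmultinom n d' | (mdeg (bmnm a) < d)%N) F (bmnm a).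
Proof.
move=> dd'; rewrite -(big_map (@bmnm n d) xpredT F) -(big_map (@bmnm n d') (fun m => mdeg m < d)%N F).
rewrite -[RHS]big_filter; apply: perm_big; apply: uniq_perm.
- by rewrite map_inj_uniq ?index_enum_uniq //; exact: val_inj.
- by rewrite filter_uniq // map_inj_uniq ?index_enum_uniq //; exact: val_inj.
move=> m; rewrite mem_filter; apply/mapP/andP => [[a _ ->]|[md _]].
  split; first exact: bmdeg.
  apply/mapP; exists (BMultinom (leq_trans (bmdeg a) dd')) => //.
  exact: mem_index_enum.
by exists (BMultinom md) => //; exact: mem_index_enum.
Qed.

(** Multi-indices are functions on ['I_n]: the sum is a part of the [n]-th power
    of a geometric series. *)
Lemma sum_half_le (R : realFieldType) d :
  \sum_(a : bmultinom n d) (2^-1 : R) ^+ mdeg (bmnm a) <= 2 ^+ n.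
Proof.
have geo : \sum_(t < d) (2^-1 : R) ^+ t <= 2.
  suff -> : \sum_(t < d) (2^-1 : R) ^+ t = 2 - 2 * 2^-1 ^+ d.
    by rewrite lerBlDr lerDl mulr_ge0 // exprn_ge0 // invr_ge0.
  elim: d => [|d IH]; first by rewrite big_ord0 expr0; lra.
  by rewrite big_ord_recr /= IH exprS; lra.
pose phi (a : bmultinom n d) : {ffun 'I_n -> 'I_d} :=
  [ffun i => Ordinal (leq_ltn_trans (leq_trans (leq_addr _ _)
     (eq_leq (esym (etrans (mdegE (bmnm a)) (bigD1 i isT))))) (bmdeg a))].
have phi_inj : injective phi.
  move=> a b /ffunP ab; apply: val_inj; apply/mnmP => i.
  by have := congr1 val (ab i); rewrite !ffunE.
pose G (th : {ffun 'I_n -> 'I_d}) : R := \prod_i 2^-1 ^+ th i.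
have G0 th : 0 <= G th by apply: prodr_ge0 => i _; rewrite exprn_ge0 // invr_ge0.
have -> : \sum_(a : bmultinom n d) (2^-1 : R) ^+ mdeg (bmnm a) =
   \sum_(th in [set phi a | a : bmultinom n d]%SET) G th.
  rewrite big_imset /=; last by move=> a b _ _; exact: phi_inj.
  apply: eq_bigr => a _; rewrite mdegE -prodrXr.
  by apply: eq_bigr => i _; rewrite ffunE.
apply: (@le_trans _ _ (\sum_th G th)).
  by rewrite big_mkcond; apply: ler_sum => th _; case: ifP.
rewrite -(bigA_distr_bigA (fun _ (t : 'I_d) => (2^-1 : R) ^+ t)).
rewrite prodr_const card_ord; apply: lerXn2r => //; rewrite ?nnegrE //.
by apply: sumr_ge0 => t _; rewrite exprn_ge0 // invr_ge0.
Qed.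

End Sums.

Lemma half_exp_small (R : realType) (K e : R) : 0 < e ->
  exists k0, forall k, (k0 <= k)%N -> K * 2^-1 ^+ k <= e.
Proof.
move=> e0; have [k0 hk0] : exists k0 : nat, `|K| / e <= k0%:R.
  by exists (Num.truncn (`|K| / e)).+1; rewrite ltW // truncnS_gt.
exists k0 => k kk; have p0 : 0 < (2 : R) ^+ k by rewrite exprn_gt0.
rewrite exprVn ler_pdivrMr //; apply: le_trans (ler_norm _) _.
rewrite mulrC -ler_pdivrMr //; apply: le_trans hk0 _.
rewrite -natrX ler_nat; apply: leq_trans kk _.
exact/ltnW/ltn_expl.
Qed.

Section Series.
Variables (R : realType) (n : nat).
Local Notation C := (Cplx R).

Definition psum (h : multinom n -> C) d := \sum_(a : bmultinom n d) h (bmnm a).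

(** Half of the ratio [4^-1] pays for the number of multi-indices, by
    [sum_half_le], and the other half makes the tails small. *)
Definition geometric (B : R) (h : multinom n -> C) :=
  forall a, cabs (h a) <= B * 4^-1 ^+ mdeg a.

Lemma psum_tail B (h : multinom n -> C) d d' : 0 <= B -> geometric B h ->
  (d <= d')%N -> cabs (psum h d' - psum h d) <= B * 2 ^+ n * 2^-1 ^+ d.
Proof.
move=> B0 hh dd'; rewrite /psum (sum_bmultinom_le _ dd').
rewrite [X in X - _](bigID (fun a : bmultinom n d' => mdeg (bmnm a) < d)%N) /=.
rewrite [X in cabs X]addrC addKr; apply: le_trans (cabs_sum _ _ _) _.
apply: (@le_trans _ _ (\sum_(a : bmultinom n d') B * 2^-1 ^+ d * 2^-1 ^+ mdeg (bmnm a))).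
  rewrite big_mkcond; apply: ler_sum => a _; case: ifP => [|_]; last first.
    by rewrite !mulr_ge0 // exprn_ge0 // invr_ge0.
  rewrite -leqNgt => da; apply: le_trans (hh _) _.
  rewrite -mulrA ler_wpM2l //.
  have -> : 4^-1 = 2^-1 * 2^-1 :> R by rewrite -invfM; congr (_^-1); lra.
  rewrite exprMn ler_wpM2r ?exprn_ge0 ?invr_ge0 //.
  by apply: ler_wiXn2l => //; rewrite ?invr_ge0 // invf_le1 // ler1n.
rewrite -mulr_sumr -mulrA [X in _ <= X]mulrAC -[X in _ <= X]mulrA ler_wpM2l //.
rewrite ler_wpM2l ?exprn_ge0 ?invr_ge0 //.
exact: sum_half_le.
Qed.

Lemma psum_cauchy B h : 0 <= B -> geometric B h -> cauchy_seq (psum h).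
Proof.
move=> B0 hh e e0.
have [k0 hk] := @half_exp_small R (2 * (B * 2 ^+ n)) e e0.
exists k0 => j k jk kk; apply: le_trans (cabs_tri (psum h k0) _ _) _.
have h1 := psum_tail B0 hh jk; have h2 := psum_tail B0 hh kk.
have := hk k0 (leqnn _); rewrite [cabs (psum h k0 - _)]cabsB; lra.
Qed.

End Series.

Section TermwiseApproximation.
Variables (R : realType) (n : nat) (S : finType).
Local Notation C := (Cplx R).

(** The Weierstrass test: the sum of a series of approximable functions
    dominated by a geometric one is approximable. *)
Lemma approx_series (tau B : R) (h : multinom n -> (S -> C) -> C) :
  0 <= tau -> 0 <= B -> (forall a, approx tau (h a)) ->
  (forall x, disc tau x -> geometric B (fun a => h a x)) ->
  exists2 g, approx tau g &
    forall x, disc tau x -> tends (psum (fun a => h a x)) (g x).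
Proof.
move=> t0 B0 ha hb.
have /choice[g hg] : forall x, exists l,
    disc tau x -> tends (psum (fun a => h a x)) l.
  move=> x; have [hx|nx] := pselect (disc tau x); last by exists 0.
  by have [l hl] := cauchy_tends (psum_cauchy B0 (hb x hx)); exists l.
exists g => //; apply: approx_lim => e e0.
have [k0 hk] := @half_exp_small R (B * 2 ^+ n) e e0.
exists (fun x => psum (fun a => h a x) k0).
  rewrite /psum; elim: (index_enum _) => [|a s IH].
    rewrite (_ : (fun _ => _) = fun _ => 0); first exact: approx_const.
    by apply: funext => x; rewrite big_nil.
  rewrite (_ : (fun _ => _) = fun x => h (bmnm a) x +
      \sum_(a <- s) h (bmnm a) x); first exact: approxD.
  by apply: funext => x; rewrite big_cons.
move=> x hx; have tx : tends (fun d => psum (fun a => h a x) d -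
    psum (fun a => h a x) k0) (g x - psum (fun a => h a x) k0).
  move=> e' e'0; have [k1 h1] := hg x hx e' e'0; exists k1 => k kk.
  by rewrite opprB addrA subrK; exact: h1.
apply: (tends_cabs_le tx (k0 := k0)) => k kk.
exact: le_trans (psum_tail B0 (hb x hx) kk) (hk _ (leqnn _)).
Qed.

End TermwiseApproximation.

Section PowerSeries.
Variables (R : realType) (n : nat).
Local Notation C := (Cplx R).
Implicit Types (x : 'I_n -> C) (c : multinom n -> C).

Lemma cabs_mmap1 (rho : R) x (a : multinom n) :
  disc rho x -> cabs (mmap1 x a) <= rho ^+ mdeg a.
Proof.
move=> hx; rewrite /mmap1 cabs_prod mdegE -prodrXr.
apply: ler_prod => i _; rewrite cabs_ge0 cabsX /=.
by apply: lerXn2r; rewrite ?nnegrE ?cabs_ge0 // (le_trans _ (hx i)) ?cabs_ge0.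
Qed.

(** [approx], with polynomials in the variables ['I_n] themselves rather than in
    an enumeration of them. *)
Definition polynomially_approx rho (f : ('I_n -> C) -> C) := forall e, 0 < e ->
  exists p : mpoly n C, forall x, disc rho x -> cabs (f x - meval x p) <= e.

Lemma approx_polynomially (rho : R) (f : ('I_n -> C) -> C) : 0 <= rho ->
  approx rho f <-> polynomially_approx rho f.
Proof.
move=> r0; split=> h.
  move=> e /h[p hp].
  exists (comp_mpoly [tuple mpolyX C (mnm1 (enum_val k)) | k < #|'I_n|] p) => x hx.
  rewrite comp_mpoly_meval (_ : meval _ p = pev p x) ?hp //.
  by apply: meval_eq => k; rewrite tnth_mktuple mevalXU.
apply: approx_lim => e /h[p hp]; exists (fun x => meval x p) => //.
by apply: (@approx_meval _ _ _ _ (fun i x => x i)) => // i; exact: approx_coord.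
Qed.

Definition coef_bound (rho B : R) c := forall a, cabs (c a) * rho ^+ mdeg a <= B.

Lemma coef_bound_geometric (rho B : R) c x : 0 < rho -> coef_bound rho B c ->
  disc (rho / 4) x -> geometric B (fun a => c a * mmap1 x a).
Proof.
move=> r0 hc hx a; rewrite cabsM; have := cabs_mmap1 a hx.
rewrite exprMn => h; have := hc a => h'.
apply: le_trans (ler_wpM2l (cabs_ge0 _) h) _.
by rewrite mulrA ler_wpM2r // exprn_ge0 // invr_ge0.
Qed.

Lemma psum_meval c x d : psum (fun a => c a * mmap1 x a) d =
  meval x (\sum_(a : bmultinom n d) c (bmnm a) *: mpolyX C (bmnm a)).
Proof.
rewrite raddf_sum; apply: eq_bigr => a _ /=.
by rewrite mevalZ /meval mmapX.
Qed.

(** The coefficients are the limits of those of the approximating polynomials,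
    which converge by the Cauchy estimates. *)
Lemma approx_power_series (rho : R) f : 0 < rho -> approx rho f ->
  exists c, [/\ exists2 B, 0 <= B & coef_bound rho B c &
    forall x, disc (rho / 4) x -> tends (psum (fun a => c a * mmap1 x a)) (f x)].
Proof.
move=> r0 /(approx_polynomially _ (ltW r0)) h.
have h2 k : 0 < (2^-1 : R) ^+ k by rewrite exprn_gt0 // invr_gt0.
have /choice[p hp] k := h _ (h2 k).
have dif j k a : (j <= k)%N ->
    cabs (mcoeff a (p j) - mcoeff a (p k)) * rho ^+ mdeg a <= 2 * 2^-1 ^+ j.
  move=> jk; rewrite -mcoeffB; apply: cauchy_estimate => // x hx.
  rewrite mevalB; apply: le_trans (cabs_tri (f x) _ _) _.
  have := hp j x hx; have := hp k x hx; rewrite [cabs (_ - f x)]cabsB.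
  have : (2^-1 : R) ^+ k <= 2^-1 ^+ j.
    by apply: ler_wiXn2l => //; rewrite ?invr_ge0 // invf_le1 // ler1n.
  lra.
have rp (a : multinom n) : 0 < rho ^+ mdeg a by rewrite exprn_gt0.
have dif' j k a : (j <= k)%N ->
    cabs (mcoeff a (p j) - mcoeff a (p k)) <= 2 / rho ^+ mdeg a * 2^-1 ^+ j.
  by move=> jk; rewrite mulrAC ler_pdivlMr //; exact: dif.
have /choice[c hc] : forall a, exists l, tends (fun k => mcoeff a (p k)) l.
  move=> a; apply: cauchy_tends => e e0.
  have [k0 hk] := half_exp_small (2 * (2 / rho ^+ mdeg a)) e0.
  exists k0 => j k j0 kk; apply: le_trans (cabs_tri (mcoeff a (p k0)) _ _) _.
  have := dif' _ _ a j0; have := dif' _ _ a kk.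
  have := hk _ (leqnn k0); rewrite [cabs (mcoeff a (p j) - _)]cabsB; lra.
have cp k a : cabs (c a - mcoeff a (p k)) * rho ^+ mdeg a <= 2 * 2^-1 ^+ k.
  rewrite -ler_pdivlMr //.
  have t : tends (fun j => mcoeff a (p j) - mcoeff a (p k)) (c a - mcoeff a (p k)).
    move=> e e0; have [k1 h1] := hc a e e0; exists k1 => j /h1.
    by rewrite opprB addrA subrK.
  apply: (tends_cabs_le t (k0 := k)) => j kj.
  by rewrite cabsB ler_pdivlMr //; exact: dif.
exists c; split.
  have [B B0 hB] := approx_bounded (ltW r0) ((approx_polynomially _ (ltW r0)).2 h).
  exists (B + 3) => [|a]; first by lra.
  have p0 : cabs (mcoeff a (p 0%N)) * rho ^+ mdeg a <= B + 1.
    apply: cauchy_estimate => // x hx; have := hB x hx; have := hp 0%N x hx.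
    rewrite expr0 cabsB; have := cabsD (meval x (p 0%N) - f x) (f x).
    by rewrite subrK; lra.
  have := cp 0%N a; rewrite expr0.
  have := cabsD (c a - mcoeff a (p 0%N)) (mcoeff a (p 0%N)); rewrite subrK.
  have := rp a; nra.
move=> x hx e e0.
have [k0 hk] := half_exp_small (2 * 2 ^+ n + 1) e0.
exists (msize (p k0)) => d hd.
have -> : psum (fun a => c a * mmap1 x a) d =
   psum (fun a => (c a - mcoeff a (p k0)) * mmap1 x a) d + meval x (p k0).
  rewrite [meval x _](mmapE d hd) -big_split /=; apply: eq_bigr => a _.
  by rewrite mulrBl subrK.
have hx' : disc rho x by apply: disc_le hx; lra.
rewrite -addrA; apply: le_trans (cabsD _ _) _.
have b1 := hp k0 x hx'; rewrite cabsB in b1.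
have b2 : cabs (psum (fun a => (c a - mcoeff a (p k0)) * mmap1 x a) d) <=
    2 * 2^-1 ^+ k0 * 2 ^+ n.
  apply: le_trans (cabs_sum _ _ _) _.
  apply: le_trans (ler_wpM2l _ (sum_half_le n R d)); last by rewrite mulr_ge0 // ltW.
  rewrite mulr_sumr; apply: ler_sum => a _.
  have gg := @coef_bound_geometric rho (2 * 2^-1 ^+ k0)
    (fun a => c a - mcoeff a (p k0)) x r0 (cp k0) hx (bmnm a).
  apply: le_trans gg _; apply: ler_wpM2l.
    by rewrite mulr_ge0 // ltW.
  by apply: lerXn2r; rewrite ?nnegrE ?invr_ge0 // lef_pV2 ?posrE // ler_nat.
have := hk _ (leqnn k0); lra.
Qed.

(** Near the origin the partial sums are small, hence so are their coefficients,
    by the Cauchy estimates. *)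
Lemma power_series_unique (rho delta B : R) c : 0 < rho -> 0 < delta -> 0 <= B ->
  coef_bound rho B c ->
  (forall x, disc delta x -> tends (psum (fun a => c a * mmap1 x a)) 0) ->
  forall a, c a = 0.
Proof.
move=> r0 d0 B0 hc hz a.
pose del := Num.min delta (rho / 4).
have del0 : 0 < del by rewrite lt_min d0 divr_gt0.
apply: cabs_eq0; apply/eqP; rewrite eq_le cabs_ge0 andbT.
rewrite -(ler_pM2r (exprn_gt0 (mdeg a) del0)) mul0r.
apply/ler_addgt0Pr => e e0; rewrite add0r.
have [k0 hk] := half_exp_small (B * 2 ^+ n) e0.
pose d := maxn k0 (mdeg a).+1.
have -> : c a = mcoeff a (\sum_(a : bmultinom n d) c (bmnm a) *: mpolyX C (bmnm a)).
  have ad : (mdeg a < d)%N by rewrite leq_max leqnn orbT.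
  rewrite raddf_sum (bigD1 (BMultinom ad)) //= mcoeffZ mcoeffX eqxx mulr1.
  rewrite big1 ?addr0 // => b /negbTE ba; rewrite mcoeffZ mcoeffX.
  by rewrite (_ : (bmnm b == a) = false) ?mulr0 //; rewrite -ba.
apply: cauchy_estimate => // x hx; rewrite -psum_meval.
have x1 : disc delta x by apply: disc_le hx; rewrite ge_min lexx.
have x2 : disc (rho / 4) x by apply: disc_le hx; rewrite ge_min lexx orbT.
have t : tends (fun j => psum (fun a => c a * mmap1 x a) j -
    psum (fun a => c a * mmap1 x a) d) (0 - psum (fun a => c a * mmap1 x a) d).
  move=> e' e'0; have [k1 h1] := hz x x1 e' e'0; exists k1 => j /h1.
  by rewrite opprB addrA subrK.
rewrite -[cabs _]cabsN -sub0r; apply: (tends_cabs_le t (k0 := d)) => j dj.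
apply: le_trans (psum_tail B0 (coef_bound_geometric r0 hc x2) dj) _.
exact: hk _ (leq_maxl _ _).
Qed.

End PowerSeries.

(** * Hadamard quotients and division by monomials *)

Section SeriesGerms.
Variables (R : realType).
Local Notation C := (Cplx R).

Lemma tends_const (l : C) : tends (fun _ => l) l.
Proof. by move=> e e0; exists 0%N => k _; rewrite subrr cabs0 ltW. Qed.

Lemma tends_ext (u v : nat -> C) l : (forall k, u k = v k) -> tends u l -> tends v l.
Proof. by move=> /funext ->. Qed.

Lemma tendsD (u v : nat -> C) l m : tends u l -> tends v m ->
  tends (fun k => u k + v k) (l + m).
Proof.
move=> hu hv e e0; have [k1 h1] := hu (e / 2) ltac:(lra).
have [k2 h2] := hv (e / 2) ltac:(lra); exists (maxn k1 k2) => k.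
rewrite geq_max => /andP[/h1 a /h2 b]; rewrite opprD addrACA.
by apply: le_trans (cabsD _ _) _; lra.
Qed.

Lemma tendsZ (c : C) (u : nat -> C) l : tends u l -> tends (fun k => c * u k) (c * l).
Proof.
move=> hu e e0; have c0 := cabs_ge0 c.
have [k1 h1] := hu (e / (cabs c + 1)) ltac:(apply: divr_gt0; lra).
exists k1 => k /h1; rewrite -mulrBr cabsM ler_pdivlMr; last by lra.
have := cabs_ge0 (u k - l); nra.
Qed.

Lemma tends_sum (I : Type) (s : seq I) (u : I -> nat -> C) (l : I -> C) :
  (forall i, tends (u i) (l i)) ->
  tends (fun k => \sum_(i <- s) u i k) (\sum_(i <- s) l i).
Proof.
move=> h; elim: s => [|i s IH].
  rewrite big_nil (_ : (fun _ => _) = fun _ => 0); first exact: tends_const.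
  by apply: funext => k; rewrite big_nil.
rewrite big_cons (_ : (fun _ => _) = fun k => u i k + \sum_(j <- s) u j k).
  exact: tendsD.
by apply: funext => k; rewrite big_cons.
Qed.

Lemma tends_shift (u : nat -> C) l j : tends u l -> tends (fun k => u (k + j)%N) l.
Proof.
move=> h e /h[k0 hk]; exists k0 => k kk; apply: hk.
by rewrite (leq_trans kk) // leq_addr.
Qed.

Section OneSpace.
Variable n : nat.
Implicit Types (rho : R) (c : multinom n -> C) (f g : ('I_n -> C) -> C) (x : 'I_n -> C).

(** The coefficients are bounded on the scale [rho], and convergence is asserted
    on the smaller polydisc of radius [rho / 4], where it is geometric. *)
Definition series_at rho c f := [/\ 0 < rho,
  exists2 B, 0 <= B & coef_bound rho B c &
  forall x, disc (rho / 4) x -> tends (psum (fun a => c a * mmap1 x a)) (f x)].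

Lemma approx_series_at rho f : 0 < rho -> approx rho f ->
  exists c, series_at rho c f.
Proof. by move=> r0 /(approx_power_series r0)[c [h1 h2]]; exists c. Qed.

Lemma approx_monomial rho (a : multinom n) : 0 <= rho ->
  approx rho (fun x : 'I_n -> C => mmap1 x a).
Proof.
move=> r0; have := @approx_meval R 'I_n rho n (fun i x => x i) (mpolyX C a) r0
  (fun i => approx_coord rho i).
by apply: approx_ext => x _; rewrite /meval mmapX.
Qed.

Lemma series_sum rho c : 0 < rho -> (exists2 B, 0 <= B & coef_bound rho B c) ->
  exists f, series_at rho c f.
Proof.
move=> r0 [B B0 hB].
have [||||g _ gg] := @approx_series R n 'I_n (rho / 4) B (fun a x => c a * mmap1 x a).
- by lra.
- by [].
- by move=> a; apply: approxM; [lra|exact: approx_const|apply: approx_monomial; lra].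
- by move=> x hx; exact: coef_bound_geometric hB hx.
by exists g; split => //; exists B.
Qed.

Lemma series_at_approx rho c f : series_at rho c f -> approx (rho / 4) f.
Proof.
move=> [r0 [B B0 hB] hf].
have [||||g ag gg] := @approx_series R n 'I_n (rho / 4) B (fun a x => c a * mmap1 x a).
- by lra.
- by [].
- by move=> a; apply: approxM; [lra|exact: approx_const|apply: approx_monomial; lra].
- by move=> x hx; exact: coef_bound_geometric hB hx.
apply: approx_ext ag => x hx; exact: (tends_uniq (gg x hx) (hf x hx)).
Qed.

Lemma series_at_le rho1 rho2 c f : 0 < rho1 -> rho1 <= rho2 ->
  series_at rho2 c f -> series_at rho1 c f.
Proof.
move=> r1 r12 [r2 [B B0 hB] h]; split => //.
  exists B => // a; apply: le_trans (hB a); rewrite ler_wpM2l ?cabs_ge0 //.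
  by apply: lerXn2r; rewrite ?nnegrE // ltW.
by move=> x hx; apply: h; apply: disc_le hx; lra.
Qed.

Lemma series_atB rho c c' f g : series_at rho c f -> series_at rho c' g ->
  series_at rho (fun a => c a - c' a) (fun x => f x - g x).
Proof.
move=> [r0 [B B0 hB] hf] [_ [B' B0' hB'] hg]; split => //.
  exists (B + B') => [|a]; first by lra.
  apply: le_trans (ler_wpM2r _ (cabsD _ _)) _; first by rewrite exprn_ge0 // ltW.
  by rewrite cabsN mulrDl lerD.
move=> x hx; have := tendsD (hf x hx) (tendsZ (-1) (hg x hx)).
rewrite mulN1r; apply: tends_ext => d; rewrite mulN1r /psum -sumrB.
by apply: eq_bigr => a _; rewrite mulrBl.
Qed.

Lemma series_at_uniq rho rho' c c' f : series_at rho c f -> series_at rho' c' f ->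
  c = c'.
Proof.
move=> h h'; have [r0 _ _] := h; have [r0' _ _] := h'.
pose r := Num.min rho rho'; have rr : 0 < r by rewrite lt_min r0.
have h1 : series_at r c f by apply: series_at_le h; rewrite // ge_min lexx.
have h2 : series_at r c' f by apply: series_at_le h'; rewrite // ge_min lexx orbT.
have [_ [B B0 hB] ht] := series_atB h1 h2.
apply: funext => a; apply/eqP; rewrite -subr_eq0; apply/eqP.
apply: (@power_series_unique R n r (r / 4) B (fun a => c a - c' a)) => //.
  by lra.
by move=> x /ht; rewrite subrr.
Qed.

Lemma series_at_poly rho (p : mpoly n C) : 0 < rho ->
  series_at rho (fun a => mcoeff a p) (fun x => meval x p).
Proof.
move=> r0; split=> //.
  exists (\sum_(a <- msupp p) cabs (mcoeff a p) * rho ^+ mdeg a).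
    by apply: sumr_ge0 => a _; rewrite mulr_ge0 ?cabs_ge0 // exprn_ge0 // ltW.
  move=> a; have [ap|ap] := boolP (a \in msupp p); last first.
    rewrite (memN_msupp_eq0 ap) cabs0 mul0r.
    by apply: sumr_ge0 => b _; rewrite mulr_ge0 ?cabs_ge0 // exprn_ge0 // ltW.
  rewrite (bigD1_seq a) ?msupp_uniq //= lerDl.
  by apply: sumr_ge0 => b _; rewrite mulr_ge0 ?cabs_ge0 // exprn_ge0 // ltW.
move=> x hx e e0; exists (msize p) => d pd.
by rewrite [meval x p](mmapE d pd) subrr cabs0 ltW.
Qed.

Lemma series_at_value0 rho c f : series_at rho c f -> f (fun _ => 0) = c (@mnm0 n).
Proof.
move=> [r0 _ h]; have r4 : 0 <= rho / 4 by lra.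
apply: (tends_uniq (h _ (@disc0 R _ _ r4))).
move=> e e0; exists 1%N => d d1.
rewrite /psum (bigD1 (BMultinom (_ : (mdeg (@mnm0 n) < d)%N))) ?mdeg0 //= => d0.
rewrite mmap11 mulr1 big1 ?addr0 ?subrr ?cabs0 ?ltW // => a /negP a0.
rewrite /mmap1; have [i ai] : exists i, bmnm a i != 0%N.
  apply/existsP; apply: contra_notT a0 => /existsPn h0.
  apply/eqP/val_inj/mnmP => i /=; rewrite mnm0E.
  by apply/eqP; move: (h0 i); rewrite negbK.
by rewrite (bigD1 i) //= expr0n (negbTE ai) mul0r mulr0.
Qed.

(** ** Division by the monomials of a given degree *)

Lemma submonomial K (a : multinom n) : (K <= mdeg a)%N ->
  exists b, lem b a /\ mdeg b = K.
Proof.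
elim: K => [|K IH] Ka.
  by exists (@mnm0 n); rewrite mdeg0; split => //; apply/mnm_lepP => i; rewrite mnm0E.
have [b [ba bK]] := IH (ltnW Ka).
have [i bi] : exists i, (b i < a i)%N.
  apply/existsP; move: Ka; rewrite -bK ltnNge; apply: contraNT => /existsPn h.
  rewrite !mdegE.
  by apply: leq_sum => i _; rewrite leqNgt.
exists (mnm_add b (mnm1 i)); rewrite mdegD mdeg1 addn1 bK; split=> //.
apply/mnm_lepP => j; rewrite mnmDE mnm1E; case: eqP => [<-|_].
  by rewrite addn1.
by rewrite addn0; exact: (mnm_lepP ba).
Qed.

(** Each monomial is assigned one monomial of degree [K] that divides it. *)
Lemma series_division rho c f K L : series_at rho c f ->
  (forall a, (mdeg a < K + L)%N -> c a = 0) ->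
  exists (h : bmultinom n K.+1 -> ('I_n -> C) -> C)
         (ch : bmultinom n K.+1 -> multinom n -> C),
    [/\ forall b, series_at rho (ch b) (h b),
        forall b a, (mdeg a < L)%N -> ch b a = 0 &
        forall x, disc (rho / 4) x ->
          f x = \sum_(b | mdeg (bmnm b) == K) mmap1 x (bmnm b) * h b x].
Proof.
move=> [r0 [B B0 hB] hf] hc.
have /choice[beta hbeta] : forall a : multinom n, exists b, (K <= mdeg a)%N ->
    lem b a /\ mdeg b = K.
  move=> a; have [Ka|] := boolP (K <= mdeg a)%N; last by exists a.
  by have [b hb] := submonomial Ka; exists b.
pose ch (b : bmultinom n K.+1) (a : multinom n) : C :=
  if (mdeg (bmnm b) == K) && (beta (mnm_add a (bmnm b)) == bmnm b)
  then c (mnm_add a (bmnm b)) else 0.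
have chb b : exists2 B, 0 <= B & coef_bound rho B (ch b).
  have rK : 0 < rho ^+ K by rewrite exprn_gt0.
  exists (B / rho ^+ K) => [|a]; first by rewrite divr_ge0 // ltW.
  rewrite /ch; case: ifP => [/andP[/eqP bK _]|_]; last first.
    by rewrite cabs0 mul0r divr_ge0 // ltW.
  rewrite ler_pdivlMr // -mulrA -exprD; have := hB (mnm_add a (bmnm b)).
  by rewrite mdegD bK.
have /choice[h hh] b := series_sum r0 (chb b).
exists h, ch; split=> //.
  move=> b a aL; rewrite /ch; case: ifP => // /andP[/eqP bK _].
  by rewrite hc // mdegD bK addnC ltn_add2l.
move=> x hx; apply: (tends_uniq (tends_shift K (hf x hx))).
have := tends_sum (index_enum _) (fun b => tendsZ
  (if mdeg (bmnm b) == K then mmap1 x (bmnm b) else 0)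
  (let: And3 _ _ t := hh b in t x hx)).
rewrite [X in tends _ X -> _](_ : _ = \sum_(b | mdeg (bmnm b) == K) mmap1 x (bmnm b) * h b x); last first.
  by rewrite [RHS]big_mkcond; apply: eq_bigr => b _; case: ifP => // _; rewrite mul0r.
apply: tends_ext => d.
rewrite psum_meval.
pose q := \sum_(b : bmultinom n K.+1)
  (if mdeg (bmnm b) == K then mpolyX C (bmnm b) else 0) *
  \sum_(a : bmultinom n d) ch b (bmnm a) *: mpolyX C (bmnm a).
transitivity (meval x q).
  rewrite /q raddf_sum /=; apply: eq_bigr => b _; rewrite psum_meval mevalM.
  by case: ifP => _; rewrite ?meval0 // /meval mmapX.
congr (meval x _); apply/mpolyP => a; rewrite /q !raddf_sum /=.
under eq_bigr => b _ do rewrite mulr_sumr raddf_sum /=.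
have [Ka|Ka] := leqP K (mdeg a); last first.
  rewrite !big1 //.
    move=> e _; rewrite mcoeffZ mcoeffX; case: eqP => [ea|_]; last by rewrite mulr0.
    by rewrite hc ?mul0r // ea (leq_trans Ka) // leq_addr.
  move=> b _; apply: big1 => e _; case: eqP => [bK|]; last by rewrite mul0r mcoeff0.
  rewrite -scalerAr -mpolyXD mcoeffZ mcoeffX; case: eqP => [E|_]; last by rewrite mulr0.
  by move: Ka; rewrite -E mdegD bK ltnNge leq_addr.
have [ba bK] := hbeta a Ka.
have bb : (mdeg (beta a) < K.+1)%N by rewrite bK.
have eqa (b : bmultinom n K.+1) (e : bmultinom n d) :
   mcoeff a ((if mdeg (bmnm b) == K then mpolyX C (bmnm b) else 0) *
     (ch b (bmnm e) *: mpolyX C (bmnm e))) =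
   ((b == BMultinom bb) && (bmnm e == mnm_sub a (beta a)))%:R * c a.
  case: eqP => [bK'|bK']; last first.
    rewrite mul0r mcoeff0; case: eqP => [E|_]; last by rewrite mul0r.
    by case: bK'; rewrite E.
  rewrite -scalerAr -mpolyXD mcoeffZ mcoeffX.
  case: eqP => [E|NE]; last first.
    case: eqP => [Eb|_] /=; last by rewrite mulr0 mul0r.
    case: eqP => [Ee|_]; last by rewrite mulr0 mul0r.
    by case: NE; rewrite Eb Ee /= addmC submK.
  rewrite mulr1 /ch bK' eqxx /= addmC E.
  have -> : (b == BMultinom bb) = (beta a == bmnm b) by rewrite -val_eqE /= eq_sym.
  case: eqP => [Eb|_]; last by rewrite mul0r.
  have -> : bmnm e = mnm_sub a (beta a) by rewrite Eb -E addmC addmK.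
  by rewrite eqxx mul1r.
under eq_bigr => b _ do under eq_bigr => e _ do rewrite eqa.
rewrite (bigD1 (BMultinom bb)) //= [X in _ + X]big1 ?addr0; last first.
  by move=> b /negbTE nb; apply: big1 => e _; rewrite nb mul0r.
have [ad|ad] := ltnP (mdeg (mnm_sub a (beta a))) d.
  have adK : (mdeg a < d + K)%N.
    by rewrite -(submK ba) mdegD bK ltn_add2r.
  rewrite (bigD1 (BMultinom ad)) //= !eqxx mul1r big1 ?addr0; last first.
    move=> e; rewrite -val_eqE /= => /negbTE ne.
    by rewrite ne mul0r.
  rewrite (bigD1 (BMultinom adK)) //= mcoeffZ mcoeffX eqxx mulr1 big1 ?addr0 //.
  by move=> e; rewrite -val_eqE /= => /negbTE ne; rewrite mcoeffZ mcoeffX ne mulr0.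
have eqb (e : bmultinom n d) : (bmnm e == mnm_sub a (beta a)) = false.
  by apply/eqP => E; have := bmdeg e; rewrite E ltnNge ad.
rewrite [LHS]big1 => [|e _]; last by rewrite eqb andbF mul0r.
apply/esym.
apply: big1 => e _; rewrite mcoeffZ mcoeffX.
case: (bmnm e =P a) => [E|_]; last by rewrite mulr0.
have := bmdeg e; rewrite E -{1}(submK ba) mdegD bK ltn_add2r ltnNge.
by rewrite ad.
Qed.

End OneSpace.
End SeriesGerms.

Section Hadamard.
Variables (R : realType).
Local Notation C := (Cplx R).

(** Points of a product space. *)
Definition scat (S T : Type) (x : S -> C) (y : T -> C) : S + T -> C :=
  fun s => match s with inl s => x s | inr t => y t end.

Lemma disc_scat (S T : Type) (rho : R) (x : S -> C) (y : T -> C) :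
  disc rho x -> disc rho y -> disc rho (scat x y).
Proof. by move=> hx hy [s|t] /=. Qed.

(** By induction on the degree, splitting off one variable as in the Leibniz
    rule; the bound lets these quotients be summed over a power series. *)
Lemma monomial_hadamard n (tau : R) (a : multinom n) : 0 < tau ->
  exists D : 'I_n -> ('I_n + 'I_n -> C) -> C,
  [/\ forall i, approx tau (D i),
      forall x y, mmap1 y a - mmap1 x a = \sum_i (y i - x i) * D i (scat x y),
      forall i z, disc tau z -> cabs (D i z) <= (mdeg a)%:R * (tau ^+ mdeg a / tau) &
      forall i x, D i (scat x x) = meval x (mderiv i (mpolyX C a))].
Proof.
move=> t0; have [k] := ubnP (mdeg a); elim: k a => // k IH a ka.
have [a0|] := eqVneq (mdeg a) 0%N.
  have {a0}-> : a = @mnm0 n by apply/eqP; rewrite -mdeg_eq0 a0.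
  exists (fun _ _ => 0); split.
  - by move=> i; exact: approx_const.
  - by move=> x y; rewrite !mmap11 subrr big1 // => i _; rewrite mulr0.
  - by move=> i z _; rewrite cabs0 mdeg0 mul0r.
  - by move=> i x; rewrite mderivX mnm0E scale0r meval0.
rewrite -lt0n => a0.
have [j aj] : exists j, a j != 0%N.
  apply/existsP; move: a0; rewrite lt0n; apply: contraNT => /existsPn h.
  rewrite mdegE big1 // => j _; apply/eqP; move: (h j); by rewrite negbK.
pose b := mnm_sub a (mnm1 j).
have aE : a = mnm_add (mnm1 j) b.
  by rewrite /b addmC submK // lep1mP.
have bdeg : mdeg a = (mdeg b).+1 by rewrite aE mdegD mdeg1.
have [|D [h1 h2 h3 h4]] := IH b; first by rewrite -ltnS -bdeg.
exists (fun i z => (i == j)%:R * mmap1 (fun i => z (inl i)) b + z (inr j) * D i z); split.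
- move=> i; apply: approxD; apply: approxM; rewrite ?ltW //.
  + exact: approx_const.
  + apply: approx_ext (@approx_meval R _ tau n (fun i z => z (inl i))
      (mpolyX C b) (ltW t0) (fun i => approx_coord tau (inl i))) => z _.
    by rewrite /meval mmapX.
  + exact: approx_coord.
- move=> x y; rewrite aE !(@commr_mmap1_M _ _ _ _ _ (fun i x => mulrC x _)) !mmap1U.
  under eq_bigr => i _ do rewrite mulrDr.
  rewrite big_split /= (bigD1 j) //= eqxx big1 ?addr0; last first.
    by move=> i /negbTE ->; rewrite mul0r mulr0.
  have -> : \sum_i (y i - x i) * (y j * D i (scat x y)) =
     y j * (mmap1 y b - mmap1 x b).
    by rewrite h2 mulr_sumr; apply: eq_bigr => i _; rewrite mulrCA.
  rewrite mul1r; ring.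
- move=> i z hz; apply: le_trans (cabsD _ _) _; rewrite !cabsM.
  have e1 : cabs ((i == j)%:R : C) <= 1.
    by case: (i == j); rewrite ?cabs1 ?cabs0.
  have e2 : cabs (mmap1 (fun i => z (inl i)) b) <= tau ^+ mdeg b.
    by apply: cabs_mmap1 => i'; exact: hz.
  have e3 := h3 i z hz; have e4 := hz (inr j).
  have u1 := ler_pM (cabs_ge0 _) (cabs_ge0 _) e1 e2.
  have u2 := ler_pM (cabs_ge0 _) (cabs_ge0 _) e4 e3.
  apply: le_trans (lerD u1 u2) _; rewrite bdeg exprS -addn1 natrD le_eqVlt.
  by apply/orP; left; apply/eqP; field; rewrite gt_eqF.
- move=> i x; rewrite h4 /= [in RHS]aE mpolyXD mderivM mevalD !mevalM.
  have -> : meval x (mderiv i (mpolyX C (mnm1 j))) = (i == j)%:R.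
    rewrite mderivX mevalZ mnm1E eq_sym; case: eqP => [->|_]; last by rewrite mul0r.
    rewrite mul1r mevalX big1 // => l _.
    by rewrite mnmBE mnm1E subnn expr0.
  have -> : meval x (mpolyX C (mnm1 j)) = x j by rewrite /meval mmapX mmap1U.
  by rewrite [meval x (mpolyX C b)]mmapX.
Qed.

(** Differences of an analytic function are a combination of differences of the
    coordinates, with coefficients analytic in both points; on the diagonal
    these coefficients are the partial derivatives. *)
Lemma series_hadamard n (rho : R) c (f : ('I_n -> C) -> C) : series_at rho c f ->
  exists D : 'I_n -> ('I_n + 'I_n -> C) -> C,
  [/\ forall i, approx (rho / 8) (D i),
      forall x y, disc (rho / 8) x -> disc (rho / 8) y ->
        f y - f x = \sum_i (y i - x i) * D i (scat x y) &
      forall i, series_at (rho / 2)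
        (fun b => c (mnm_add b (mnm1 i)) *+ (b i).+1) (fun x => D i (scat x x))].
Proof.
move=> [r0 [B B0 hB] hf]; have t0 : 0 < rho / 8 by lra.
have /choice[D0 hD0] (a : multinom n) := @monomial_hadamard n (rho / 8) a t0.
have geo i z : disc (rho / 8) z ->
    geometric (B / (rho / 8)) (fun a => c a * D0 a i z).
  move=> hz a; rewrite cabsM; have [_ _ h3 _] := hD0 a.
  apply: le_trans (ler_wpM2l (cabs_ge0 _) (h3 i z hz)) _.
  (* The factor [mdeg a] costs a factor 2 in the radius. *)
  have two : (mdeg a)%:R <= (2 : R) ^+ mdeg a.
    by rewrite -natrX ler_nat ltnW // ltn_expl.
  have h8 : (rho / 8) ^+ mdeg a * 2 ^+ mdeg a = rho ^+ mdeg a * 4^-1 ^+ mdeg a.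
    rewrite -!exprMn; congr (_ ^+ _); have : (8^-1 : R) * 2 = 4^-1 by field.
    by move=> e; rewrite -mulrA e.
  have p8 : 0 < (rho / 8) ^+ mdeg a by rewrite exprn_gt0.
  have i8 : 0 <= (rho / 8)^-1 by rewrite invr_ge0 ltW.
  have k2 : cabs (c a) * ((mdeg a)%:R * (rho / 8) ^+ mdeg a) <= B * 4^-1 ^+ mdeg a.
    apply: (@le_trans _ _ (cabs (c a) * ((rho / 8) ^+ mdeg a * 2 ^+ mdeg a))).
      by rewrite ler_wpM2l ?cabs_ge0 // mulrC ler_wpM2l // ltW.
    rewrite h8 mulrA; apply: ler_wpM2r; last exact: hB.
    by rewrite exprn_ge0 // invr_ge0.
  have := ler_wpM2r i8 k2; rewrite [leRHS]mulrAC => k3.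
  by apply: le_trans k3; rewrite -!mulrA.
have Br : 0 <= B / (rho / 8) by rewrite divr_ge0 // ltW.
have /choice[D hD] i : exists g, approx (rho / 8) g /\
    forall z, disc (rho / 8) z -> tends (psum (fun a => c a * D0 a i z)) (g z).
  have [|||g ag gg] := @approx_series R n _ (rho / 8) _ (fun a z => c a * D0 a i z) _ Br.
  - exact: ltW.
  - move=> a; apply: approxM; first exact: ltW.
      exact: approx_const.
    by have [h1 _ _ _] := hD0 a.
  - by move=> z hz; exact: geo.
  by exists g.
exists D; split; first by move=> i; have [] := hD i.
  move=> x y hx hy.
  have d4 (z : 'I_n -> C) : disc (rho / 8) z -> disc (rho / 4) z.
    by move=> hz; apply: disc_le hz; lra.
  have t1 := tendsD (hf y (d4 y hy)) (tendsZ (-1) (hf x (d4 x hx))).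
  have t2 := tends_sum (index_enum _) (fun i => tendsZ (y i - x i)
     ((hD i).2 _ (disc_scat hx hy))).
  rewrite mulN1r in t1; apply: tends_uniq t1 _; apply: tends_ext t2 => d.
  rewrite mulN1r /psum -sumrB.
  under eq_bigr => i _ do rewrite mulr_sumr.
  rewrite exchange_big /=; apply: eq_bigr => a _.
  have [_ h2 _ _] := hD0 (bmnm a); rewrite -mulrBr h2 mulr_sumr.
  by apply: eq_bigr => i _; rewrite mulrCA.
move=> i; split; first by lra.
  exists (B / rho * 2) => [|b]; first by rewrite !mulr_ge0 // invr_ge0 ltW.
  have p2 : 0 < (2 : R) ^+ mdeg b by rewrite exprn_gt0.
  have := hB (mnm_add b (mnm1 i)); rewrite mdegD mdeg1 addn1 exprS => h.
  have bi : ((b i).+1)%:R <= 2 * (2 : R) ^+ mdeg b.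
    rewrite -exprS -natrX ler_nat; apply: (@leq_trans (mdeg b).+1).
      by rewrite ltnS mdegE (bigD1 i) //= leq_addr.
    exact/ltnW/ltn_expl.
  rewrite -[c _ *+ _]mulr_natr cabsM cabs_nat exprMn exprVn mulrA ler_pdivrMr //.
  rewrite mulrAC [leRHS](_ : _ = B / rho * (2 * 2 ^+ mdeg b)); last by ring.
  apply: ler_pM; rewrite ?mulr_ge0 ?cabs_ge0 ?exprn_ge0 ?(ltW r0) //.
  by rewrite ler_pdivlMr // -mulrA [_ * rho]mulrC.
move=> x hx; have hx8 : disc (rho / 8) x by apply: disc_le hx; lra.
apply: tends_ext (tends_shift 1 ((hD i).2 _ (disc_scat hx8 hx8))) => d.
rewrite (psum_meval (fun b => c (mnm_add b (mnm1 i)) *+ (b i).+1)).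
transitivity (meval x (mderiv i
   (\sum_(a : bmultinom n (d + 1)) c (bmnm a) *: mpolyX C (bmnm a)))).
  rewrite [mderiv i _]raddf_sum [RHS]raddf_sum; apply: eq_bigr => a _ /=.
  by rewrite mderivZ mevalZ; have [_ _ _ ->] := hD0 (bmnm a).
congr (meval x _); apply/mpolyP => b; rewrite mcoeff_deriv.
have coefE e (k : multinom n -> C) m : mcoeff m (\sum_(a : bmultinom n e) k (bmnm a) *: mpolyX C (bmnm a)) =
    if (mdeg m < e)%N then k m else 0.
  rewrite raddf_sum /=; case: ifP => me.
    rewrite (bigD1 (BMultinom me)) //= mcoeffZ mcoeffX eqxx mulr1 big1 ?addr0 //.
    by move=> a; rewrite -val_eqE /= => /negbTE am; rewrite mcoeffZ mcoeffX am mulr0.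
  apply: big1 => a _; rewrite mcoeffZ mcoeffX; case: (bmnm a =P m) => [am|_].
    by move: me; rewrite -am bmdeg.
  by rewrite mulr0.
rewrite coefE (coefE d (fun b => c (mnm_add b (mnm1 i)) *+ (b i).+1)).
rewrite mdegD mdeg1 ltn_add2r; case: ifP => // _; exact: mul0rn.
Qed.

(** The same over an arbitrary finite set of variables. *)
Lemma approx_hadamard (T : finType) (rho : R) (f : (T -> C) -> C) : 0 < rho ->
  approx rho f -> exists D : T -> (T + T -> C) -> C,
  (forall t, approx (rho / 8) (D t)) /\
  forall x y, disc (rho / 8) x -> disc (rho / 8) y ->
        f y - f x = \sum_t (y t - x t) * D t (scat x y).
Proof.
move=> r0 af.
pose F (x : 'I_#|T| -> C) := f (fun t => x (enum_rank t)).
have aF : approx rho F.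
  apply: (@approx_comp R T _ rho rho f (fun t x => x (enum_rank t))) => //.
  - exact: ltW.
  - by move=> t; exact: approx_coord.
have [c hc] := approx_series_at r0 aF.
have [D [h1 h2 _]] := series_hadamard hc.
pose up (x : T -> C) : 'I_#|T| -> C := fun k => x (enum_val k).
have Fup x : F (up x) = f x.
  by rewrite /F; congr f; apply: funext => t; rewrite /up enum_rankK.
pose e (s : 'I_#|T| + 'I_#|T|) : T + T :=
  match s with inl k => inl (enum_val k) | inr k => inr (enum_val k) end.
exists (fun t z => D (enum_rank t) (fun s => z (e s))); split.
  move=> t; apply: (@approx_comp R _ _ (rho / 8) (rho / 8) _ (fun s z => z (e s))) => //.
  - by lra.
  - by move=> s; exact: approx_coord.
move=> x y hx hy; rewrite -!Fup h2; last by [| move=> k; exact: hy].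
  rewrite (reindex (@enum_rank T)) /=; last first.
    by exists enum_val => k _; rewrite ?enum_valK ?enum_rankK.
  apply: eq_bigr => t _; rewrite /up enum_rankK; congr (_ * D _ _).
  by apply: funext => -[k|k].
by move=> k; exact: hx.
Qed.

End Hadamard.

(** * Germs of analytic functions and the implicit function theorem *)

Section Germs.
Variable R : realType.
Local Notation C := (Cplx R).

Definition near0 (T : Type) (P : (T -> C) -> Prop) :=
  exists2 d : R, 0 < d & forall x, disc d x -> P x.

Lemma near0_and (T : Type) (P Q : (T -> C) -> Prop) :
  near0 P -> near0 Q -> near0 (fun x => P x /\ Q x).
Proof.
move=> [d1 h1 k1] [d2 h2 k2]; exists (Num.min d1 d2); first by rewrite lt_min h1.
move=> x hx; split; [apply: k1|apply: k2]; apply: disc_le hx.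
  by rewrite ge_min lexx.
by rewrite ge_min lexx orbT.
Qed.

Lemma near0_all (T : Type) (I : finType) (P : I -> (T -> C) -> Prop) :
  (forall i, near0 (P i)) -> near0 (fun x => forall i, P i x).
Proof.
move=> h; suff [d d0 hd] : near0 (fun x => forall i, i \in enum I -> P i x).
  by exists d => // x /hd hx i; apply: hx; rewrite mem_enum.
elim: (enum I) => [|i s IH]; first by exists 1.
have [d d0 hd] := near0_and (h i) IH; exists d => // x /hd[h1 h2] j.
by rewrite in_cons => /orP[/eqP ->|/h2].
Qed.

Lemma near0_imp (T : Type) (P Q : (T -> C) -> Prop) :
  (forall x, P x -> Q x) -> near0 P -> near0 Q.
Proof. by move=> pq [d d0 hd]; exists d => // x /hd/pq. Qed.

(** The germs of analytic functions, by [analytic_at0P] below. *)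
Definition agerm (T : finType) (f : (T -> C) -> C) :=
  exists2 rho : R, 0 < rho & approx rho f.

Section Closure.
Variable T : finType.
Implicit Types f g : (T -> C) -> C.

Lemma agerm_ext f g : near0 (fun x => f x = g x) -> agerm f -> agerm g.
Proof.
move=> [d d0 fg] [r r0 hf]; have m0 : 0 < Num.min d r by rewrite lt_min d0.
exists (Num.min d r) => //; apply: (@approx_ext _ _ _ f) => [x hx|].
  by apply: fg; apply: disc_le hx; rewrite ge_min lexx.
by apply: approx_le hf; rewrite ge_min lexx orbT.
Qed.

Lemma agerm_const c : agerm (fun _ : T -> C => c).
Proof. by exists 1 => //; exact: approx_const. Qed.

Lemma agerm_coord t : agerm (fun x : T -> C => x t).
Proof. by exists 1 => //; exact: approx_coord. Qed.

Lemma agerm_common f g : agerm f -> agerm g ->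
  exists2 rho : R, 0 < rho & approx rho f /\ approx rho g.
Proof.
move=> [r r0 hf] [s s0 hg]; exists (Num.min r s); first by rewrite lt_min r0.
by split; [apply: approx_le hf|apply: approx_le hg]; rewrite ge_min lexx ?orbT.
Qed.

Lemma agermD f g : agerm f -> agerm g -> agerm (fun x => f x + g x).
Proof.
by move=> hf /(agerm_common hf)[r r0 [h1 h2]]; exists r => //; exact: approxD.
Qed.

Lemma agermM f g : agerm f -> agerm g -> agerm (fun x => f x * g x).
Proof.
move=> hf /(agerm_common hf)[r r0 [h1 h2]]; exists r => //.
by apply: approxM => //; exact: ltW.
Qed.

Lemma agermN f : agerm f -> agerm (fun x => - f x).
Proof.
move=> /(agermM (agerm_const (-1))); apply: agerm_ext.
by exists 1 => // x _; rewrite mulN1r.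
Qed.

Lemma agermB f g : agerm f -> agerm g -> agerm (fun x => f x - g x).
Proof. by move=> hf hg; apply: agermD => //; exact: agermN. Qed.

Lemma agerm_sum (I : Type) (s : seq I) (P : pred I) (F : I -> (T -> C) -> C) :
  (forall i, agerm (F i)) -> agerm (fun x => \sum_(i <- s | P i) F i x).
Proof.
move=> h; elim: s => [|i s IH].
  rewrite (_ : (fun _ => _) = fun _ => 0); first exact: agerm_const.
  by apply: funext => x; rewrite big_nil.
case Pi : (P i).
  rewrite (_ : (fun _ => _) = fun x => F i x + \sum_(j <- s | P j) F j x).
    exact: agermD.
  by apply: funext => x; rewrite big_cons Pi.
rewrite (_ : (fun _ => _) = fun x => \sum_(j <- s | P j) F j x) //.
by apply: funext => x; rewrite big_cons Pi.
Qed.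

Lemma agerm_meval n (g : 'I_n -> (T -> C) -> C) (p : mpoly n C) :
  (forall i, agerm (g i)) -> agerm (fun x => meval (fun i => g i x) p).
Proof.
apply: meval_ind; [exact: agerm_const|exact: agermD|exact: agermM].
Qed.

Lemma approx_continuous0 (rho : R) f : 0 < rho -> approx rho f ->
  forall e : R, 0 < e -> near0 (fun x => cabs (f x - f (fun _ => 0)) <= e).
Proof.
move=> r0 hf e e0; have [p hp] := hf (e / 3) ltac:(lra).
have [B B0 hB] := lipschitz_at0_pev p (ltW r0).
pose d := Num.min rho (e / (3 * (B + 1))).
have d0 : 0 < d by rewrite lt_min r0 divr_gt0 // mulr_gt0 //; lra.
exists d => // x hx.
have hx' : disc rho x by apply: disc_le hx; rewrite ge_min lexx.
have [_ h] := hB x hx'; have h1 := h d (ltW d0) hx.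
have h2 := hp x hx'; have h3 := hp _ (@disc0 R T rho (ltW r0)).
have Bd : B * d <= e / 3.
  have : d <= e / (3 * (B + 1)) by rewrite ge_min lexx orbT.
  rewrite ler_pdivlMr; last by lra.
  have := d0; nra.
rewrite cabsB in h3.
have := cabs_tri (pev p x) (f x) (f (fun _ => 0)).
have := cabs_tri (pev p (fun _ => 0)) (pev p x) (f (fun _ => 0)).
lra.
Qed.

Lemma agerm_continuous0 f : agerm f ->
  forall e : R, 0 < e -> near0 (fun x => cabs (f x - f (fun _ => 0)) <= e).
Proof. by move=> [rho r0 hf]; exact: approx_continuous0 hf. Qed.

Lemma agerm_small f : agerm f -> f (fun _ => 0) = 0 ->
  forall e : R, 0 < e -> near0 (fun x => cabs (f x) <= e).
Proof.
move=> hf f0 e e0; apply: near0_imp (agerm_continuous0 hf e0) => x.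
by rewrite f0 subr0.
Qed.

End Closure.

Lemma agerm_comp (S T : finType) (f : (S -> C) -> C) (g : S -> (T -> C) -> C) :
  agerm f -> (forall s, agerm (g s)) -> (forall s, g s (fun _ => 0) = 0) ->
  agerm (fun x => f (fun s => g s x)).
Proof.
move=> [rho r0 hf] hg g0.
have [d d0 hd] := near0_all (fun s => agerm_small (hg s) (g0 s) r0).
have [d' d'0 hd'] : exists2 r : R, 0 < r & forall s, approx r (g s).
  suff [r r1 hr] : exists2 r : R, 0 < r & forall s, s \in enum S -> approx r (g s).
    by exists r => // s; apply: hr; rewrite mem_enum.
  elim: (enum S) => [|s l [r r1 hr]]; first by exists 1.
  have [r' r'0 hr'] := hg s; exists (Num.min r r'); first by rewrite lt_min r1.
  move=> s'; rewrite in_cons => /orP[/eqP ->|/hr h].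
    by apply: approx_le hr'; rewrite ge_min lexx orbT.
  by apply: approx_le h; rewrite ge_min lexx.
have m0 : 0 < Num.min d d' by rewrite lt_min d0.
exists (Num.min d d') => //; apply: (approx_comp (ltW m0) hf).
  by move=> s; apply: approx_le (hd' s); rewrite ge_min lexx orbT.
by move=> x hx; apply: hd; apply: disc_le hx; rewrite ge_min lexx.
Qed.

Lemma scat00 (S T : Type) : scat (fun _ : S => 0 : C) (fun _ : T => 0 : C) = fun _ => 0.
Proof. by apply: funext => -[]. Qed.

Section ImplicitFunction.
Variables (T X : finType) (Phi : X -> (T + X -> C) -> C).
Hypothesis Phi_germ : forall k, agerm (Phi k).
Hypothesis Phi0 : forall k, Phi k (fun _ => 0) = 0.
Hypothesis Phi_quadratic : forall k, exists2 K : R, 0 < K &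
  near0 (fun w : X -> C => forall t : R, 0 <= t -> disc t w ->
           cabs (Phi k (scat (fun _ => 0) w)) <= K * t ^+ 2).

(** The partial derivatives with respect to the unknowns vanish at the origin,
    as the quadratic bound along the axes shows. *)
Lemma implicit_contraction : exists2 d : R, 0 < d &
  (forall k, approx d (Phi k)) /\
  forall x w w' (e : R), disc d x -> disc d w -> disc d w' ->
    disc e (fun j => w' j - w j) ->
    disc (e / 2) (fun k => Phi k (scat x w') - Phi k (scat x w)).
Proof.
suff h k : exists2 d : R, 0 < d & approx d (Phi k) /\
    forall x w w' (e : R), disc d x -> disc d w -> disc d w' ->
    disc e (fun j => w' j - w j) ->
    cabs (Phi k (scat x w') - Phi k (scat x w)) <= e / 2.
  suff [d d0 hd] : exists2 d : R, 0 < d & forall k, k \in enum X -> approx d (Phi k) /\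
    forall x w w' (e : R), disc d x -> disc d w -> disc d w' ->
    disc e (fun j => w' j - w j) ->
    cabs (Phi k (scat x w') - Phi k (scat x w)) <= e / 2.
    exists d => //; split=> [k|x w w' e h1 h2 h3 h4 k].
      by have [] := hd k (mem_enum _ k).
    by have [_] := hd k (mem_enum _ k); apply.
  elim: (enum X) => [|k l [d d0 hd]]; first by exists 1.
  have [d' d'0 [hd1 hd2]] := h k.
  exists (Num.min d d'); first by rewrite lt_min d0.
  have l1 : Num.min d d' <= d by rewrite ge_min lexx.
  have l2 : Num.min d d' <= d' by rewrite ge_min lexx orbT.
  move=> k'; rewrite in_cons => /orP[/eqP ->|/hd [h1 h2]].
    split; first exact: approx_le l2 hd1.
    by move=> x w w' e a b c; apply: hd2; exact: disc_le l2 _.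
  split; first exact: approx_le l1 h1.
  by move=> x w w' e a b c; apply: h2; exact: disc_le l1 _.
have [rho r0 hP] := Phi_germ k.
have [D [hD1 hD2]] := approx_hadamard r0 hP.
have r8 : 0 < rho / 8 by lra.
(* On the axis of [j], [Phi k] is both [t * D (inr j)] and [O(t ^ 2)]. *)
have D0 j : D (inr j) (fun _ => 0) = 0.
  apply: cabs_eq0; apply/eqP; rewrite eq_le cabs_ge0 andbT.
  apply/ler_addgt0Pr => e e0; rewrite add0r.
  have [d1 d10 hd1] := approx_continuous0 r8 (hD1 (inr j)) (e := e / 2) ltac:(lra).
  have [K K0 [d2 d20 hd2]] := Phi_quadratic k.
  pose t := Num.min (Num.min d1 d2) (Num.min (rho / 8) (e / (2 * K))).
  have t0 : 0 < t by rewrite !lt_min d10 d20 r8 divr_gt0 // mulr_gt0.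
  have [t1 t2 t3 t4] : [/\ t <= d1, t <= d2, t <= rho / 8 & t <= e / (2 * K)].
    by split; rewrite /t !ge_min !lexx ?orbT.
  pose w (i : X) : C := if i == j then ofR t else 0.
  have dw : disc t w.
    by move=> i; rewrite /w; case: ifP => _; rewrite ?cabs0 ?cabs_ofR // ltW.
  have dz : disc t (scat (fun _ : T => 0) w).
    by apply: disc_scat => // i; rewrite cabs0 ltW.
  have := hD2 (fun _ => 0) (scat (fun _ => 0) w) (disc0 (ltW r8)) (disc_le t3 dz).
  rewrite Phi0 subr0 (bigD1 (inr j)) //= [w j]/w eqxx subr0 big1 ?addr0; last first.
    case=> [i|i] ij; first by rewrite subrr mul0r.
    rewrite /= /w; case: eqP => [E|_]; last by rewrite subrr mul0r.
    by rewrite E eqxx in ij.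
  move=> /(congr1 (@cabs R)); rewrite cabsM cabs_ofR ?(ltW t0) // => E.
  have := hd2 w (disc_le t2 dw) t (ltW t0) dw.
  rewrite E expr2 mulrA [K * t * t]mulrC ler_pM2l // => hK.
  have := hd1 (scat (fun _ => 0) (scat (fun _ => 0) w))
    (disc_le t1 (disc_scat (disc0 (ltW t0)) dz)).
  rewrite cabsB => h'.
  have := cabsD (D (inr j) (fun _ => 0) - D (inr j) (scat (fun=> 0) (scat (fun=> 0) w)))
    (D (inr j) (scat (fun=> 0) (scat (fun=> 0) w))).
  rewrite subrK; move: t4; rewrite ler_pdivlMr ?mulr_gt0 //; nra.
have X1 : 0 < 2 * (#|X|%:R + 1) :> R by rewrite mulr_gt0 // ltr_wpDl.
have eps0 : 0 < (2 * (#|X|%:R + 1))^-1 :> R by rewrite invr_gt0.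
have [d1 d10 hd1] := near0_all (fun j => agerm_small
  (ex_intro2 _ _ (rho / 8) r8 (hD1 (inr j))) (D0 j) eps0).
have d0 : 0 < Num.min d1 (rho / 8) by rewrite lt_min d10.
have l1 : Num.min d1 (rho / 8) <= d1 by rewrite ge_min lexx.
have l2 : Num.min d1 (rho / 8) <= rho / 8 by rewrite ge_min lexx orbT.
exists (Num.min d1 (rho / 8)) => //; split.
  by apply: approx_le hP; apply: le_trans l2 _; lra.
move=> x w w' e hx hw hw' he.
have dz := disc_scat hx hw; have dz' := disc_scat hx hw'.
rewrite (hD2 _ _ (disc_le l2 dz) (disc_le l2 dz')) big_sumType /= big1 ?add0r; last first.
  by move=> i _; rewrite subrr mul0r.
apply: le_trans (cabs_sum _ _ _) _.
apply: (@le_trans _ _ (\sum_(j : X) e * (2 * (#|X|%:R + 1))^-1)).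
  apply: ler_sum => j _; rewrite cabsM; apply: ler_pM; rewrite ?cabs_ge0 ?he //.
  by apply: hd1; apply: disc_le l1 (disc_scat dz dz').
have e0 : 0 <= e := le_trans (cabs_ge0 _) (he k).
rewrite sumr_const -[leLHS]mulr_natr -mulrA; apply: ler_wpM2l => //.
rewrite mulrC ler_pdivrMr //.
have -> : 2^-1 * (2 * (#|X|%:R + 1)) = #|X|%:R + 1 :> R by field.
by rewrite lerDl.
Qed.

(** Picard iteration: by [implicit_contraction] the iterates converge uniformly
    on a polydisc, so that their limit is again analytic. *)
Theorem implicit_function : exists w : X -> (T -> C) -> C,
  [/\ forall k, agerm (w k), forall k, w k (fun _ => 0) = 0,
      near0 (fun x => forall k, w k x = Phi k (scat x (fun j => w j x))) &
      exists2 s : R, 0 < s & near0 (fun x => forall v, disc s v ->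
        (forall k, v k = Phi k (scat x v)) -> forall k, v k = w k x)].
Proof.
have [d d0 [hd1 hd2]] := implicit_contraction.
have d2 : 0 < d / 2 by lra.
have [r r0 hr] : near0 (fun x : T -> C => forall k,
    cabs (Phi k (scat x (fun _ => 0))) <= d / 2).
  apply: near0_all => k.
  apply: agerm_small d2; last by rewrite scat00.
  have -> : (fun x => Phi k (scat x (fun _ => 0))) =
    (fun x => Phi k (fun s => (fun s x => scat x (fun _ => 0) s) s x)) by [].
  apply: agerm_comp => //; last by case.
  by case=> [t|j]; [exact: agerm_coord|exact: agerm_const].
pose rho := Num.min r d.
have rho0 : 0 < rho by rewrite lt_min r0.
have rr : rho <= r by rewrite ge_min lexx.
have rd : rho <= d by rewrite ge_min lexx orbT.
pose W m (x : T -> C) := iter m (fun v k => Phi k (scat x v)) (fun _ => 0).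
have WS m x k : W m.+1 x k = Phi k (scat x (W m x)) by [].
have Wd m x : disc rho x -> disc d (W m x).
  move=> hx; elim: m => [|m IH]; first by apply: disc0; exact: ltW.
  move=> k; rewrite WS.
  have dz : disc d (fun j => W m x j - (fun _ => 0) j).
    by move=> j; rewrite subr0; exact: IH.
  have := hd2 x _ _ d (disc_le rd hx) (disc0 (ltW d0)) IH dz k.
  have := hr x (disc_le rr hx) k.
  have := cabsD (Phi k (scat x (W m x)) - Phi k (scat x (fun _ => 0)))
    (Phi k (scat x (fun _ => 0))).
  by rewrite subrK; lra.
have Wstep x v m : disc rho x -> disc d v -> (forall k, v k = Phi k (scat x v)) ->
    disc (2 * d * 2^-1 ^+ m) (fun k => v k - W m x k).
  move=> hx hv fv; elim: m => [|m IH] k.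
    rewrite expr0; have := cabsD (v k) (- W 0%N x k).
    by have := hv k; have := Wd 0%N x hx k; rewrite cabsN; lra.
  rewrite fv WS; have := hd2 x _ _ _ (disc_le rd hx) (Wd m x hx) hv IH k.
  by rewrite exprSr mulrA.
have Wcauchy x m : disc rho x -> disc (d * 2^-1 ^+ m) (fun k => W m.+1 x k - W m x k).
  move=> hx; elim: m => [|m IH] k.
    by rewrite expr0 mulr1 subr0; exact: Wd.
  have := hd2 x _ _ _ (disc_le rd hx) (Wd m x hx) (Wd m.+1 x hx) IH k.
  by rewrite exprSr mulrA.
have half1 m : 0 < (2^-1 : R) ^+ m by rewrite exprn_gt0 // invr_gt0.
have Wcauchy' x m j : disc rho x ->
    disc (2 * d * (2^-1 ^+ m - 2^-1 ^+ (m + j))) (fun k => W (m + j)%N x k - W m x k).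
  move=> hx; elim: j => [|j IH] k; first by rewrite addn0 !subrr mulr0 cabs0.
  rewrite addnS; have := Wcauchy x (m + j)%N hx k; have := IH k.
  have := cabs_tri (W (m + j)%N x k) (W (m + j).+1 x k) (W m x k).
  by rewrite exprS; lra.
have /choice[w hw] : forall x, exists v : X -> C, disc rho x ->
    forall k, tends (fun m => W m x k) (v k).
  move=> x; have [hx|] := pselect (disc rho x); last by exists (fun _ => 0).
  have /choice[v hv] k : exists l, tends (fun m => W m x k) l.
    apply: cauchy_tends => e e0.
    have [k0 hk] := half_exp_small (4 * d) e0; exists k0 => i j ki kj.
    have h i' : (k0 <= i')%N -> cabs (W i' x k - W k0 x k) <= 2 * d * 2^-1 ^+ k0.
      move=> ki'; have := Wcauchy' x k0 (i' - k0)%N hx k; rewrite subnKC // => h.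
      apply: le_trans h _; rewrite ler_wpM2l ?mulr_ge0 ?ltW //.
      by rewrite ltrBlDr ltrDl.
    have := h i ki; have := h j kj; have := cabs_tri (W k0 x k) (W i x k) (W j x k).
    rewrite [cabs (W k0 x k - W j x k)]cabsB.
    by have := hk k0 (leqnn _); lra.
  by exists v => _; exact: hv.
have wW x m : disc rho x -> disc (2 * d * 2^-1 ^+ m) (fun k => w x k - W m x k).
  move=> hx k.
  have t : tends (fun j => W (j + m)%N x k - W m x k) (w x k - W m x k).
    have := tendsD (tends_shift m (hw x hx k)) (tends_const (- W m x k)).
    by apply: tends_ext.
  apply: (tends_cabs_le t (k0 := 0%N)) => j _; rewrite addnC.
  apply: le_trans (Wcauchy' x m j hx k) _; rewrite ler_wpM2l ?mulr_ge0 ?ltW //.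
  by rewrite ltrBlDr ltrDl.
have wd x : disc rho x -> disc d (w x).
  move=> hx k; apply: (tends_cabs_le (hw x hx k) (k0 := 0%N)) => m _.
  exact: Wd.
exists (fun k x => w x k); split.
- move=> k; exists rho => //; apply: approx_lim => e e0.
  have [k0 hk] := half_exp_small (2 * d) e0.
  exists (fun x => W k0 x k); last first.
    by move=> x hx; apply: le_trans (wW x k0 hx k) (hk _ (leqnn _)).
  elim: k0 k {hk} => [|m IH] k; first exact: approx_const.
  have -> : (fun x => W m.+1 x k) =
    (fun x => Phi k (fun s => (fun s x => scat x (W m x) s) s x)) by [].
  apply: (@approx_comp R _ _ d rho) (ltW rho0) (hd1 k) _ _.
    by case=> [t|j] /=; [exact: approx_coord|exact: IH].
  by move=> x hx s; apply: disc_scat; [exact: disc_le rd hx|exact: Wd].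
- move=> k; have h0 : disc rho (fun _ : T => 0 : C) by apply: disc0; exact: ltW.
  apply: (tends_uniq (hw _ h0 k)).
  suff E m : W m (fun _ => 0) = fun _ => 0.
    by apply: tends_ext (tends_const 0) => m; rewrite E.
  elim: m => // m IH; apply: funext => j; by rewrite WS IH scat00 Phi0.
- exists rho => // x hx k; apply/eqP; rewrite -subr_eq0; apply/eqP/cabs_eq0/eqP.
  rewrite eq_le cabs_ge0 andbT; apply/ler_addgt0Pr => e e0; rewrite add0r.
  have [k0 hk] := half_exp_small (2 * d) e0.
  have h1 := wW x k0.+1 hx k.
  have h2 := hd2 x _ _ _ (disc_le rd hx) (Wd k0 x hx) (wd x hx) (wW x k0 hx) k.
  have := cabs_tri (W k0.+1 x k) (w x k) (Phi k (scat x (w x))).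
  rewrite [cabs (W k0.+1 x k - _)]cabsB WS; rewrite WS exprS in h1.
  by have := hk _ (leqnn k0); lra.
- exists d => //; exists rho => // x hx v hv fv k.
  apply/eqP; rewrite -subr_eq0; apply/eqP/cabs_eq0/eqP.
  rewrite eq_le cabs_ge0 andbT; apply/ler_addgt0Pr => e e0; rewrite add0r.
  have [k0 hk] := half_exp_small (4 * d) e0.
  have h1 := wW x k0 hx k; have h2 := Wstep x v k0 hx hv fv k.
  have := cabs_tri (W k0 x k) (v k) (w x k).
  rewrite [cabs (W k0 x k - _)]cabsB.
  by have := hk _ (leqnn k0); lra.
Qed.

End ImplicitFunction.
End Germs.

(** * Tougeron's implicit function theorem *)

Section Tougeron.
Variables (R : realType) (T L J B : finType).
Local Notation C := (Cplx R).

Lemma agerm_inl (X : finType) (f : (T -> C) -> C) : agerm f ->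
  agerm (fun z : T + X -> C => f (fun t => z (inl t))).
Proof.
move=> hf; apply: (agerm_comp (g := fun t z => z (inl t))) => // t.
exact: agerm_coord.
Qed.

Variables (mu : B -> (T -> C) -> C) (f0 : J -> (T -> C) -> C)
  (u : B -> B -> J -> (T -> C) -> C) (A : L -> J -> (T -> C) -> C)
  (v : B -> J -> L -> (T -> C) -> C) (s : B -> J -> B -> J -> (T -> C) -> C)
  (H : L -> L -> J -> (T + L -> C) -> C).
Hypotheses (mu_germ : forall b, agerm (mu b))
  (u_germ : forall b b' j, agerm (u b b' j))
  (v_germ : forall b j l, agerm (v b j l))
  (s_germ : forall b j b' j', agerm (s b j b' j'))
  (H_germ : forall l l' j, agerm (H l l' j)).
Hypotheses (mu0 : forall b, mu b (fun _ => 0) = 0)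
  (u0 : forall b b' j, u b b' j (fun _ => 0) = 0)
  (s0 : forall b j b' j', s b j b' j' (fun _ => 0) = 0).
Hypothesis f0E : near0 (fun x => forall j,
  f0 j x = \sum_b \sum_b' mu b x * mu b' x * u b b' j x).
Hypothesis AvE : near0 (fun x => forall b j j', \sum_l v b j l x * A l j' x =
  \sum_b' mu b' x * (((b == b') && (j == j'))%:R + s b j b' j' x)).

(** The system is [f0 + A y + H(y, y) = 0], where [f0] belongs to the square of
    the ideal generated by the [mu b], and where the vectors [v b j] show that the
    image of [A] contains this ideal, up to terms of higher order.  The unknowns
    are sought in the form [y l = \sum_b mu b * eta b l], with [eta b] in the span
    of the [v b' j]: all terms become combinations of the products
    [mu b * mu b'], and the vanishing of their coefficients is a system to which
    the implicit function theorem applies. *)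
Theorem tougeron : exists y z,
  [/\ forall l, agerm (y l : (T -> C) -> C),
      forall b l, agerm (z b l : (T -> C) -> C) /\ z b l (fun _ => 0) = 0,
      near0 (fun x => forall l, y l x = \sum_b mu b x * z b l x) &
      near0 (fun x => forall j, f0 j x + \sum_l A l j x * y l x +
        \sum_l \sum_l' y l x * y l' x * H l l' j (scat x (fun l => y l x)) = 0)].
Proof.
pose X := (B * B * J)%type.
pose pr (z : T + X -> C) : T -> C := fun t => z (inl t).
pose eta b l (z : T + X -> C) := \sum_b' \sum_j v b' j l (pr z) * z (inr (b, b', j)).
pose Y l (z : T + X -> C) := \sum_b mu b (pr z) * eta b l z.
pose Phi (k : X) (z : T + X -> C) := let: (b, b', j) := k in
  - u b b' j (pr z) - \sum_b1 \sum_j1 z (inr (b, b1, j1)) * s b1 j1 b' j (pr z) -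
  \sum_l \sum_l' eta b l z * eta b' l' z * H l l' j (scat (pr z) (fun l => Y l z)).
have eta_germ b l : agerm (eta b l).
  apply: agerm_sum => b'; apply: agerm_sum => j.
  by apply: agermM; [exact: agerm_inl|exact: agerm_coord].
have Y_germ l : agerm (Y l).
  by apply: agerm_sum => b; apply: agermM => //; exact: agerm_inl.
have eta0 b l : eta b l (fun _ => 0) = 0.
  by rewrite /eta big1 // => b' _; rewrite big1 // => j _; rewrite mulr0.
have Y0 l : Y l (fun _ => 0) = 0.
  by rewrite /Y big1 // => b _; rewrite eta0 mulr0.
have [||k|w [w1 w2 w3 _]] := @implicit_function R T X Phi.
- move=> [[b b'] j]; rewrite /Phi; apply: agermB; first apply: agermB.
  + by apply: agermN; exact: agerm_inl.
  + apply: agerm_sum => b1; apply: agerm_sum => j1.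
    by apply: agermM; [exact: agerm_coord|exact: agerm_inl].
  + apply: agerm_sum => l; apply: agerm_sum => l'; apply: agermM.
      exact: agermM.
    apply: (agerm_comp (g := fun s z => scat (pr z) (fun l => Y l z) s)) => //.
      by case=> [t|l1] /=; [exact: agerm_coord|exact: Y_germ].
    by case=> [t|l1] /=.
- move=> [[b b'] j]; rewrite /Phi u0 !big1 ?oppr0 ?addr0 //.
    by move=> l _; rewrite big1 // => l' _; rewrite eta0 !mul0r.
  by move=> b1 _; rewrite big1 // => j1 _; rewrite mul0r.
- case: k => [[b b'] j].
  pose c l : R := \sum_b' \sum_j cabs (v b' j l (fun _ => 0)).
  have c0 l : 0 <= c l.
    by apply: sumr_ge0 => b1 _; apply: sumr_ge0 => j1 _; exact: cabs_ge0.
  (* At [x = 0] only the quadratic terms of [Phi] remain. *)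
  pose K : R := \sum_l \sum_l' c l * c l' * cabs (H l l' j (fun _ => 0)).
  have K0 : 0 <= K.
    apply: sumr_ge0 => l _; apply: sumr_ge0 => l' _.
    by rewrite !mulr_ge0 ?cabs_ge0.
  exists (K + 1); first by lra.
  exists 1 => // w _ t t0 hw.
  have prE : pr (scat (fun _ => 0) w) = fun _ => 0 by [].
  have YE l : Y l (scat (fun _ => 0) w) = 0.
    by rewrite /Y big1 // => b1 _; rewrite prE mu0 mul0r.
  have etaB b1 l : cabs (eta b1 l (scat (fun _ => 0) w)) <= c l * t.
    rewrite /eta /c mulr_suml; apply: le_trans (cabs_sum _ _ _) _.
    apply: ler_sum => b2 _; rewrite mulr_suml; apply: le_trans (cabs_sum _ _ _) _.
    apply: ler_sum => j2 _; rewrite cabsM prE ler_wpM2l ?cabs_ge0 //.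
    exact: hw.
  rewrite /Phi prE u0 oppr0 sub0r [X in - X]big1 ?oppr0 ?sub0r; last first.
    by move=> b1 _; rewrite big1 // => j1 _; rewrite s0 mulr0.
  rewrite cabsN; apply: (@le_trans _ _ (K * t ^+ 2)); last first.
    by rewrite ler_wpM2r ?exprn_ge0 // lerDl.
  apply: le_trans (cabs_sum _ _ _) _; rewrite /K mulr_suml.
  apply: ler_sum => l _; apply: le_trans (cabs_sum _ _ _) _; rewrite mulr_suml.
  apply: ler_sum => l' _; rewrite !cabsM.
  have -> : scat (pr (scat (fun _ => 0) w)) (fun l => Y l (scat (fun _ => 0) w)) =
      (fun _ : T + L => 0 : C).
    by apply: funext => -[t1|l1] //=; exact: YE.
  rewrite mulrAC expr2 mulrACA [leLHS]mulrAC.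
  have := ler_pM (cabs_ge0 _) (cabs_ge0 _) (etaB b l) (etaB b' l').
  move/(ler_wpM2r (cabs_ge0 (H l l' j (fun _ => 0)))).
  by rewrite -!mulrA => h; apply: le_trans h _; rewrite le_eqVlt; apply/orP; left;
     apply/eqP; ring.
pose Z x : T + X -> C := scat x (fun k => w k x).
have lift_germ (f : (T + X -> C) -> C) : agerm f -> agerm (fun x => f (Z x)).
  move=> hf; apply: (agerm_comp (g := fun s x => Z x s)) => //.
    by case=> [t|k] /=; [exact: agerm_coord|exact: w1].
  by case=> [t|k] /=.
have Z0 : Z (fun _ => 0) = fun _ => 0.
  by apply: funext => -[t|k] //=; exact: w2.
exists (fun l x => Y l (Z x)), (fun b l x => eta b l (Z x)); split.
- by move=> l; exact: lift_germ.
- by move=> b l; split; [exact: lift_germ|rewrite Z0].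
- by exists 1.
apply: near0_imp (near0_and w3 (near0_and f0E AvE)) => x [hw [hf hA]] j.
have prZ : pr (Z x) = x by [].
have lin : \sum_l A l j x * Y l (Z x) = \sum_b \sum_b' mu b x * mu b' x *
    (w (b, b', j) x + \sum_b1 \sum_j1 w (b, b1, j1) x * s b1 j1 b' j x).
  transitivity (\sum_b mu b x * \sum_b1 \sum_j1 w (b, b1, j1) x *
      \sum_l v b1 j1 l x * A l j x).
    transitivity (\sum_l \sum_b mu b x * \sum_b1 \sum_j1 w (b, b1, j1) x * (v b1 j1 l x * A l j x)).
      apply: eq_bigr => l _; rewrite /Y prZ mulr_sumr; apply: eq_bigr => b _.
      rewrite mulrCA; congr (_ * _); rewrite /eta mulr_sumr; apply: eq_bigr => b1 _.
      rewrite mulr_sumr; apply: eq_bigr => j1 _; rewrite prZ /=; ring.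
    rewrite exchange_big /=; apply: eq_bigr => b _; rewrite -mulr_sumr; congr (_ * _).
    rewrite exchange_big /=; apply: eq_bigr => b1 _.
    rewrite exchange_big /=; apply: eq_bigr => j1 _.
    by rewrite mulr_sumr.
  apply: eq_bigr => b _.
  transitivity (mu b x * \sum_b' mu b' x * \sum_b1 \sum_j1 w (b, b1, j1) x *
     (((b1 == b') && (j1 == j))%:R + s b1 j1 b' j x)).
    congr (_ * _).
    under eq_bigr => b1 _ do under eq_bigr => j1 _ do rewrite hA mulr_sumr.
    under eq_bigr => b1 _ do rewrite exchange_big /=.
    rewrite exchange_big /=; apply: eq_bigr => b' _; rewrite mulr_sumr.
    apply: eq_bigr => b1 _; rewrite mulr_sumr; apply: eq_bigr => j1 _.
    by rewrite mulrCA.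
  rewrite mulr_sumr; apply: eq_bigr => b' _; rewrite -mulrA; congr (_ * (_ * _)).
  under eq_bigr => b1 _ do under eq_bigr => j1 _ do rewrite mulrDr.
  under eq_bigr => b1 _ do rewrite big_split /=.
  rewrite big_split /=; congr (_ + _).
  rewrite (bigD1 b') //= (bigD1 j) //= !eqxx mulr1 !big1 ?addr0 //.
    by move=> b1 /negbTE nb; rewrite big1 // => j1 _; rewrite nb mulr0.
  by move=> j1 /negbTE nj; rewrite nj andbF mulr0.
have quad : \sum_l \sum_l' Y l (Z x) * Y l' (Z x) *
      H l l' j (scat x (fun l => Y l (Z x))) =
    \sum_b \sum_b' mu b x * mu b' x * \sum_l \sum_l' eta b l (Z x) *
      eta b' l' (Z x) * H l l' j (scat x (fun l => Y l (Z x))).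
  transitivity (\sum_l \sum_l' \sum_b \sum_b' mu b x * mu b' x * (eta b l (Z x) *
      eta b' l' (Z x) * H l l' j (scat x (fun l => Y l (Z x))))).
    apply: eq_bigr => l _; apply: eq_bigr => l' _.
    rewrite {1 2}/Y prZ mulr_suml mulr_suml; apply: eq_bigr => b _.
    rewrite mulr_sumr mulr_suml; apply: eq_bigr => b' _; ring.
  under eq_bigr => l _ do rewrite exchange_big /=.
  rewrite exchange_big /=; apply: eq_bigr => b _.
  under eq_bigr => l _ do rewrite exchange_big /=.
  rewrite exchange_big /=; apply: eq_bigr => b' _.
  by rewrite mulr_sumr; apply: eq_bigr => l _; rewrite mulr_sumr.
rewrite hf lin quad -!big_split /= big1 // => b _.
rewrite -!big_split /= big1 // => b' _; rewrite -!mulrDr hw /Phi -/(Z x) prZ.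
rewrite [X in _ * X](_ : _ = 0) ?mulr0 //; ring.
Qed.

End Tougeron.

(** * Analytic germs on the space of row vectors *)

Section Interface.
Variables (R : realType) (N : nat).
Local Notation C := (Cplx R).
Implicit Types (f : 'rV[C]_N -> C) (x : 'I_N -> C) (z : 'rV[C]_N).

Definition rowof x : 'rV[C]_N := \row_i x i.

Lemma rowofK x : (rowof x) ord0 = x.
Proof. by apply: funext => i; rewrite mxE. Qed.

Lemma rowof_ord0 z : rowof (z ord0) = z.
Proof. by apply/rowP => i; rewrite mxE. Qed.

Lemma rowof0 : rowof (fun _ => 0) = 0.
Proof. by apply/rowP => i; rewrite !mxE. Qed.

Lemma near_rowP (P : 'rV[C]_N -> Prop) :
  (\forall z \near (0 : 'rV[C]_N), P z) <-> near0 (fun x => P (rowof x)).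
Proof.
split=> [/nbhs_ballP[e /= e0 he]|[d d0 hd]].
  have [r r0 eE] := gt0_ofR e0; exists (r / 2) => [|x hx]; first by lra.
  apply: he; split=> // i j; rewrite !mxE /ball /= sub0r normrN normE eE ofR_lt.
  by have := hx j; lra.
apply/nbhs_ballP; exists (ofR d); first by rewrite /= -ofR0 ofR_lt.
move=> z hz; rewrite -(rowof_ord0 z); apply: hd => i.
have := hz.2 ord0 i; rewrite mxE /ball /= sub0r normrN normE ofR_lt.
exact: ltW.
Qed.

Lemma cvg_tends (u : nat -> C) (l : C) : (u d @[d --> \oo] --> l) <-> tends u l.
Proof.
split=> [/cvgrPdist_le h e e0|h].
  have [|k0 _ hk] := h (ofR e); first by rewrite -ofR0 ofR_lt.
  by exists k0 => k /hk; rewrite normE ofR_le cabsB.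
apply/cvgrPdist_le => e /gt0_ofR[r r0 ->]; have [k0 hk] := h r r0.
by exists k0 => // k /hk; rewrite normE ofR_le cabsB.
Qed.

(** Absolute convergence at the point with all its coordinates equal to [d]
    bounds the coefficients on the scale [d]. *)
Lemma power_series_series_at c f : power_series_at0 c f ->
  exists rho, series_at rho c (fun x => f (rowof x)).
Proof.
move=> /near_rowP[d d0 hd]; exists d.
have dd : disc d (fun _ : 'I_N => ofR d : C) by move=> i; rewrite cabs_ofR // ltW.
have [[M hM] _] := hd _ dd.
split=> //; last first.
  move=> x hx; have hx' : disc d x by apply: disc_le hx; lra.
  by have [_ /cvg_tends] := hd x hx'; rewrite /monomial_term rowofK.
exists (cabs M) => [|a]; first exact: cabs_ge0.
have := hM (mdeg a).+1; rewrite (bigD1 (BMultinom (ltnSn (mdeg a)))) //=.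
rewrite /monomial_term rowofK => h.
have h1 : `|c a * mmap1 (fun _ : 'I_N => ofR d) a| <= M.
  by apply: le_trans h; rewrite lerDl; apply: sumr_ge0.
have M0 : 0 <= M by apply: le_trans h1.
move: h1; rewrite -(ger0_norm M0) !normE ofR_le cabsM.
suff -> : cabs (mmap1 (fun _ : 'I_N => ofR d) a) = d ^+ mdeg a.
  by rewrite cabs_ofR ?cabs_ge0.
rewrite /mmap1 cabs_prod mdegE -prodrXr; apply: eq_bigr => i _.
by rewrite cabsX cabs_ofR // ltW.
Qed.

Lemma series_at_power_series rho c f : series_at rho c (fun x => f (rowof x)) ->
  power_series_at0 c f.
Proof.
move=> [r0 [B B0 hB] hf]; apply/near_rowP; exists (rho / 4) => [|x hx]; first by lra.
split; last by rewrite /monomial_term rowofK; apply/cvg_tends/hf.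
exists (ofR (B * 2 ^+ N)) => d.
apply: (@le_trans _ _ (ofR (\sum_(a : bmultinom N d) B * 2^-1 ^+ mdeg (bmnm a)))).
  rewrite /ofR rmorph_sum; apply: ler_sum => a _.
  rewrite normE /monomial_term rowofK ofR_le.
  apply: le_trans (coef_bound_geometric r0 hB hx (bmnm a)) _; apply: ler_wpM2l => //.
  by apply: lerXn2r; rewrite ?nnegrE ?invr_ge0 // lef_pV2 ?posrE // ler_nat.
rewrite ofR_le -mulr_sumr; apply: ler_wpM2l => //.
exact: sum_half_le.
Qed.

Lemma taylor_coefE rho c f : series_at rho c (fun x => f (rowof x)) ->
  taylor_coef f = c.
Proof.
move=> h; rewrite /taylor_coef; case: xgetP => [c' _ /= /power_series_series_at[r h']|].
  exact: (series_at_uniq h' h).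
by move=> /(_ c) /=; case; exact: series_at_power_series h.
Qed.

Lemma analytic_taylor f : analytic_at0 f ->
  exists rho, series_at rho (taylor_coef f) (fun x => f (rowof x)).
Proof.
move=> [c /power_series_series_at[rho h]].
by exists rho; rewrite (taylor_coefE h).
Qed.

Lemma analytic_at0P f : analytic_at0 f <-> agerm (fun x => f (rowof x)).
Proof.
split=> [/analytic_taylor[rho h]|[rho r0 h]].
  by exists (rho / 4); [case: h; lra|exact: series_at_approx h].
have [c hc] := approx_series_at r0 h.
by exists c; exact: series_at_power_series hc.
Qed.

End Interface.

(** * Invertible germs close to the identity *)

Section Perturbations.
Variables (R : realType) (N : nat).
Local Notation C := (Cplx R).

Lemma analytic_mxP m n (F : 'rV[C]_N -> 'M[C]_(m, n)) :
  analytic_mx F <-> forall i j, agerm (fun x => F (rowof x) i j).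
Proof.
by split=> h i j; have [h1 h2] := analytic_at0P (fun z => F z i j); auto.
Qed.

(** The inverse [1 + w] of [1 + A] solves [w = - A - A w]. *)
Lemma GL_germ_near1 k (A : 'I_k -> 'I_k -> ('I_N -> C) -> C) :
  (forall i j, agerm (A i j)) -> (forall i j, A i j (fun _ => 0) = 0) ->
  GL_germ (fun z : 'rV[C]_N => 1%:M + \matrix_(i, j) A i j (z ord0)).
Proof.
move=> hA A0.
have germ1 (B : 'I_k -> 'I_k -> ('I_N -> C) -> C) : (forall i j, agerm (B i j)) ->
    analytic_mx (fun z : 'rV[C]_N => 1%:M + \matrix_(i, j) B i j (z ord0)).
  move=> hB; apply/analytic_mxP => i j.
  have -> : (fun x => (1%:M + \matrix_(i, j) B i j (rowof x ord0)) i j) =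
     (fun x => (i == j)%:R + B i j x).
    by apply: funext => x; rewrite !mxE rowofK.
  by apply: agermD => //; exact: agerm_const.
split; first exact: germ1.
pose X := ('I_k * 'I_k)%type.
pose Phi (e : X) (z : 'I_N + X -> C) : C :=
  - A e.1 e.2 (fun t => z (inl t)) -
  \sum_j A e.1 j (fun t => z (inl t)) * z (inr (j, e.2)).
have [|||w [w1 w2 w3 _]] := @implicit_function R 'I_N X Phi.
- move=> e; apply: agermB; first by apply: agermN; exact: agerm_inl.
  by apply: agerm_sum => j; apply: agermM; [exact: agerm_inl|exact: agerm_coord].
- by move=> e; rewrite /Phi A0 big1 ?subrr ?oppr0 ?addr0 // => j _; rewrite A0 mul0r.
- move=> e; exists 1 => //; exists 1 => // v _ t t0 _.
  rewrite /Phi A0 big1 ?oppr0 ?addr0 ?cabs0 ?mul1r ?exprn_ge0 // => j _.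
  by rewrite A0 mul0r.
exists (fun z => 1%:M + \matrix_(i, j) w (i, j) (z ord0)).
have inv : \forall z \near (0 : 'rV[C]_N),
    (1%:M + \matrix_(i, j) A i j ((z : 'rV[C]_N) ord0)) *m
    (1%:M + \matrix_(i, j) w (i, j) ((z : 'rV[C]_N) ord0)) = 1%:M.
  apply/near_rowP; apply: near0_imp w3 => x hw; rewrite rowofK.
  rewrite mulmxDl mul1mx mulmxDr mulmx1 -addrA -[RHS]addr0; congr (_ + _).
  apply/matrixP => i j; rewrite !mxE (hw (i, j)) /Phi /=.
  under [X in _ + (_ + X)]eq_bigr => l _ do rewrite !mxE.
  by rewrite addrACA addNr add0r addNr.
split=> //; first by apply: (germ1 (fun i j => w (i, j))) => i j; exact: w1.
by apply: filterS inv => z; exact: mulmx1C.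
Qed.

Lemma agerm_lipschitz0 (T : finType) (f : (T -> C) -> C) : agerm f ->
  f (fun _ => 0) = 0 -> exists2 B : R, 0 <= B &
  near0 (fun x => forall t : R, 0 <= t -> disc t x -> cabs (f x) <= B * t).
Proof.
move=> [rho r0 hf] f0; have [D [hD1 hD2]] := approx_hadamard r0 hf.
have r8 : 0 < rho / 8 by lra.
have /choice[b hb] t : exists b : R, 0 < b /\ forall z, disc (rho / 8) z -> cabs (D t z) <= b.
  by have [b b0 h] := approx_bounded (ltW r8) (hD1 t); exists b.
exists (\sum_t b t); first by apply: sumr_ge0 => t _; have [/ltW] := hb t.
exists (rho / 8) => // x hx t t0 ht.
have z0 := @disc0 R T (rho / 8) (ltW r8).
have := hD2 _ _ z0 hx; rewrite f0 subr0 => ->.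
apply: le_trans (cabs_sum _ _ _) _; rewrite mulr_suml; apply: ler_sum => s _.
rewrite subr0 cabsM mulrC; apply: ler_pM; rewrite ?cabs_ge0 //.
by have [_] := hb s; apply; exact: disc_scat.
Qed.

Lemma near0_comp (T S : finType) (g : S -> (T -> C) -> C) (P : (S -> C) -> Prop) :
  (forall s, agerm (g s)) -> (forall s, g s (fun _ => 0) = 0) -> near0 P ->
  near0 (fun x => P (fun s => g s x)).
Proof.
move=> hg g0 [d d0 hP].
apply: near0_imp (near0_all (fun s => agerm_small (hg s) (g0 s) d0)) => x h.
exact: hP.
Qed.

(** The inverse [x + w x] solves [w x = - xi (x + w x)], an equation whose right
    hand side has no linear part when [xi] is in the square of the maximal ideal;
    that it is also a left inverse follows from the uniqueness of [w]. *)
Lemma diffeo_germ_near_id (B : finType) (mu : B -> ('I_N -> C) -> C)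
    (zt : B -> 'I_N -> ('I_N -> C) -> C) (xi : 'I_N -> ('I_N -> C) -> C) :
  (forall i, agerm (xi i)) -> (forall b, agerm (mu b)) ->
  (forall b i, agerm (zt b i)) -> (forall b, mu b (fun _ => 0) = 0) ->
  (forall b i, zt b i (fun _ => 0) = 0) ->
  near0 (fun x => forall i, xi i x = \sum_b mu b x * zt b i x) ->
  diffeo_germ (fun z : 'rV[C]_N => \row_i (z ord0 i + xi i (z ord0))).
Proof.
move=> hxi hmu hzt mu0 zt0 xiE.
have xi0 i : xi i (fun _ => 0) = 0.
  have [d d0 /(_ (fun _ => 0))] := xiE; move=> -> //; last exact: disc0 (ltW d0).
  by rewrite big1 // => b _; rewrite mu0 mul0r.
have germ1 (w : 'I_N -> ('I_N -> C) -> C) : (forall i, agerm (w i)) ->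
    analytic_mx (fun z : 'rV[C]_N => \row_i (z ord0 i + w i (z ord0))).
  move=> hw; apply/analytic_mxP => i j.
  have -> : (fun x => (\row_i (rowof x ord0 i + w i (rowof x ord0))) i j) =
      (fun x => x j + w j x) by apply: funext => x; rewrite !mxE rowofK.
  by apply: agermD => //; exact: agerm_coord.
have zero1 (w : 'I_N -> ('I_N -> C) -> C) : (forall i, w i (fun _ => 0) = 0) ->
    (\row_i ((0 : 'rV[C]_N) ord0 i + w i ((0 : 'rV[C]_N) ord0))) = 0.
  by move=> w0; rewrite -rowof0 rowofK; apply/rowP => i; rewrite !mxE w0 addr0.
split; [exact: germ1|exact: zero1|].
pose Phi (i : 'I_N) (z : 'I_N + 'I_N -> C) : C :=
  - xi i (fun l => z (inl l) + z (inr l)).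
have [|||w [w1 w2 w3 [s s0 w4]]] := @implicit_function R 'I_N 'I_N Phi.
- move=> i; apply: agermN.
  apply: (agerm_comp (g := fun l z => z (inl l) + z (inr l))) => // l.
    by apply: agermD; exact: agerm_coord.
  by rewrite addr0.
- move=> i; rewrite /Phi (_ : (fun _ => _) = fun _ => 0) ?xi0 ?oppr0 //.
  by apply: funext => l; rewrite addr0.
- move=> i.
  have /choice[c hc] b : exists c : R, 0 <= c /\
      near0 (fun x => forall t : R, 0 <= t -> disc t x -> cabs (mu b x) <= c * t).
    by have [c c0 h] := agerm_lipschitz0 (hmu b) (mu0 b); exists c.
  have /choice[c' hc'] b : exists c : R, 0 <= c /\
      near0 (fun x => forall t : R, 0 <= t -> disc t x -> cabs (zt b i x) <= c * t).
    by have [c' c'0 h] := agerm_lipschitz0 (hzt b i) (zt0 b i); exists c'.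
  have S0 : 0 <= \sum_b c b * c' b.
    by apply: sumr_ge0 => b _; have [? _] := hc b; have [? _] := hc' b; exact: mulr_ge0.
  exists (\sum_b c b * c' b + 1); first by lra.
  have h1 := near0_all (fun b => (hc b).2); have h2 := near0_all (fun b => (hc' b).2).
  apply: near0_imp (near0_and xiE (near0_and h1 h2)) => v [vE [v1 v2]] t t0 hv.
  rewrite /Phi (_ : (fun l => _) = v); last by apply: funext => l /=; rewrite add0r.
  rewrite cabsN vE; apply: (@le_trans _ _ ((\sum_b c b * c' b) * t ^+ 2)).
    apply: le_trans (cabs_sum _ _ _) _; rewrite mulr_suml; apply: ler_sum => b _.
    rewrite cabsM expr2 mulrACA; apply: ler_pM; rewrite ?cabs_ge0 //.
      exact: v1.
    exact: v2.
  by rewrite ler_wpM2r ?exprn_ge0 // lerDl.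
exists (fun z => \row_i (z ord0 i + w i (z ord0))); split.
- exact: germ1.
- exact: zero1.
- apply/near_rowP.
  have g1 i : agerm (fun x : 'I_N -> C => x i + xi i x).
    by apply: agermD => //; exact: agerm_coord.
  have g0 i : (fun x : 'I_N -> C => x i + xi i x) (fun _ => 0) = 0.
    by rewrite /= xi0 addr0.
  have n1 := near0_comp g1 g0 w4.
  have n2 := near0_all (fun i => agerm_small (hxi i) (xi0 i) s0).
  apply: near0_imp (near0_and n1 n2) => x [hw hs].
  rewrite rowofK; apply/rowP => i; rewrite !mxE.
  have hE : (\row_i0 (x i0 + xi i0 x)) ord0 = fun i => x i + xi i x.
    by apply: funext => l; rewrite mxE.
  rewrite hE -(hw (fun i => - xi i x)) ?addrK //.
    by move=> l; rewrite cabsN; exact: hs.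
  move=> l; rewrite /Phi /=; congr (- xi l _); apply: funext => l' /=.
  by rewrite addrK.
- apply/near_rowP; apply: near0_imp w3 => x hw; rewrite rowofK.
  have hE : (\row_i (x i + w i x)) ord0 = fun i => x i + w i x.
    by apply: funext => l; rewrite mxE.
  apply/rowP => i; rewrite !mxE hE (hw i) /Phi /= -addrA.
  by rewrite addNr addr0.
Qed.

End Perturbations.

(** * A criterion for finite determinacy *)

Section Generators.
Variables (N m n : nat).

Definition gen_index : finType := ('I_N + ('I_m * 'I_m + 'I_n * 'I_n))%type.

(** The tangent space of the orbit of a matrix [F] is spanned by its partial
    derivatives [dF], by the products [E *m F] and by the products [F *m E],
    [E] an elementary matrix.  The two products have separate arguments [Fl] and
    [Fr] because [equivalence_expansion] involves two germs. *)
Definition tangent_gen (K : pzRingType) (dF : 'I_N -> 'I_m * 'I_n -> K)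
    (Fl Fr : 'I_m * 'I_n -> K) (l : gen_index) (j : 'I_m * 'I_n) : K :=
  match l with
  | inl a => dF a j
  | inr (inl cd) => (j.1 == cd.1)%:R * Fl (cd.2, j.2)
  | inr (inr cd) => Fr (j.1, cd.1) * (j.2 == cd.2)%:R
  end.

Definition poly_gen (K : comNzRingType) (p : 'I_m * 'I_n -> mpoly N K) :=
  tangent_gen (fun a j => mderiv a (p j)) p p.

End Generators.

Section Criterion.
Variables (R : realType) (N m n : nat).
Local Notation C := (Cplx R).
Local Notation J := ('I_m * 'I_n)%type.
Local Notation L := (gen_index N m n).

Lemma series_at_family (I : finType) (f : I -> ('I_N -> C) -> C)
    (c : I -> multinom N -> C) :
  (forall i, exists rho, series_at rho (c i) (f i)) ->
  exists rho, forall i, series_at rho (c i) (f i).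
Proof.
move=> h; suff [r r0 hr] : exists2 r : R, 0 < r &
    forall i, i \in enum I -> series_at r (c i) (f i).
  by exists r => i; apply: hr; rewrite mem_enum.
elim: (enum I) => [|i s [r r0 hr]]; first by exists 1.
have [r' hr'] := h i; have [r'0 _ _] := hr'.
have m0 : 0 < Num.min r r' by rewrite lt_min r0.
exists (Num.min r r') => // k; rewrite in_cons => /orP[/eqP ->|/hr hk].
  by apply: series_at_le hr'; rewrite // ge_min lexx orbT.
by apply: series_at_le hk; rewrite // ge_min lexx.
Qed.

(** [vanish_order K f]: the germ [f] lies in the [K]-th power of the maximal
    ideal. *)
Definition vanish_order K (f : ('I_N -> C) -> C) := exists rho c,
  series_at rho c f /\ forall a, (mdeg a < K)%N -> c a = 0.

(** The monomials of degree [K], indexed by the multi-indices of degree at most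
    [K] with the value 0 for the lower ones. *)
Definition hom_monomial K (b : bmultinom N K.+1) : ('I_N -> C) -> C :=
  if mdeg (bmnm b) == K then fun x => mmap1 x (bmnm b) else fun _ => 0.

Lemma vanish_order_germ K f : vanish_order K f -> agerm f.
Proof.
move=> [rho [c [h _]]]; exists (rho / 4); first by case: h; lra.
exact: series_at_approx h.
Qed.

Lemma vanish_order_ext K f g : near0 (fun x => f x = g x) ->
  vanish_order K f -> vanish_order K g.
Proof.
move=> [d d0 fg] [rho [c [h hc]]]; have [r0 _ _] := h.
have m0 : 0 < Num.min rho d by rewrite lt_min r0.
exists (Num.min rho d), c; split=> //.
have [r1 b t] : series_at (Num.min rho d) c f.
  by apply: series_at_le h; rewrite // ge_min lexx.
split=> // x hx; rewrite -fg; first exact: t.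
apply: disc_le hx; have : Num.min rho d <= d by rewrite ge_min lexx orbT.
lra.
Qed.

Lemma vanish_order0 K : vanish_order K (fun _ => 0).
Proof.
exists 1, (fun _ => 0); split=> //; have := series_at_poly (0 : mpoly N C) (@ltr01 R).
rewrite (_ : (fun _ => mcoeff _ _) = fun _ => 0); last by apply: funext => a; rewrite mcoeff0.
by rewrite (_ : (fun _ => meval _ _) = fun _ => 0) //; apply: funext => x; rewrite meval0.
Qed.

Lemma vanish_order_diff K f g rho1 rho2 cf cg : series_at rho1 cf f ->
  series_at rho2 cg g -> (forall a, (mdeg a < K)%N -> cf a = cg a) ->
  vanish_order K (fun x => f x - g x).
Proof.
move=> h1 h2 h; have [r1 _ _] := h1; have [r2 _ _] := h2.
have m0 : 0 < Num.min rho1 rho2 by rewrite lt_min r1.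
exists (Num.min rho1 rho2), (fun a => cf a - cg a); split.
  apply: series_atB.
    by apply: series_at_le h1; rewrite // ge_min lexx.
  by apply: series_at_le h2; rewrite // ge_min lexx orbT.
by move=> a /h ->; rewrite subrr.
Qed.

Lemma vanish_order_divide K L f : vanish_order (K + L) f ->
  exists h : bmultinom N K.+1 -> ('I_N -> C) -> C,
    (forall b, vanish_order L (h b)) /\
    near0 (fun x => f x = \sum_b hom_monomial b x * h b x).
Proof.
move=> [rho [c [hf hc]]]; have [h [ch [h1 h2 h3]]] := series_division hf hc.
exists h; split; first by move=> b; exists rho, (ch b); split => //; exact: h2.
exists (rho / 4); first by case: hf; lra.
move=> x hx; rewrite h3 // big_mkcond; apply: eq_bigr => b _.
by rewrite /hom_monomial; case: ifP; rewrite ?mul0r.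
Qed.

Lemma vanish_order1 f : vanish_order 1 f -> f (fun _ => 0) = 0.
Proof. by move=> [rho [c [h hc]]]; rewrite (series_at_value0 h) hc // mdeg0. Qed.

Lemma agerm_hom_monomial K (b : bmultinom N K.+1) : agerm (hom_monomial b).
Proof.
rewrite /hom_monomial; case: ifP => _; last exact: agerm_const.
by exists 1 => //; apply: approx_monomial.
Qed.

Lemma hom_monomial0 K (b : bmultinom N K.+1) : (0 < K)%N ->
  hom_monomial b (fun _ => 0) = 0.
Proof.
move=> K0; rewrite /hom_monomial; case: (mdeg (bmnm b) =P K) => // bK.
have := series_at_value0 (series_at_poly (mpolyX C (bmnm b)) (@ltr01 R)).
rewrite /meval mmapX => ->; rewrite mcoeffX; case: (bmnm b =P _) => // b0.
by move: K0; rewrite -bK b0 mdeg0.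
Qed.

(** The first-order data of [F]: its entries, their partial derivatives and the
    remainder of order two. *)
Lemma second_order_expansion rho c (f : ('I_N -> C) -> C) : series_at rho c f ->
  exists (D : 'I_N -> ('I_N + 'I_N -> C) -> C) (E : 'I_N -> 'I_N -> ('I_N + 'I_N -> C) -> C),
  [/\ forall i, agerm (D i), forall i k, agerm (E i k),
      forall i, series_at (rho / 2)
        (fun b => c (mnm_add b (mnm1 i)) *+ (b i).+1) (fun x => D i (scat x x)) &
      exists2 d : R, 0 < d & forall x y, disc d x -> disc d y ->
        f (fun i => x i + y i) - f x =
          \sum_i y i * D i (scat x (fun i => x i + y i)) /\
        forall i, D i (scat x (fun i => x i + y i)) - D i (scat x x) =
          \sum_k y k * E i k (scat x y)].
Proof.
move=> h; have [r0 _ _] := h; have [D [h1 h2 h3]] := series_hadamard h.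
have r8 : 0 < rho / 8 by lra.
have /choice[E0 hE0] i := approx_hadamard r8 (h1 i).
exists D, (fun i k z => E0 i (inr k) (scat (scat (fun t => z (inl t)) (fun t => z (inl t)))
   (scat (fun t => z (inl t)) (fun t => z (inl t) + z (inr t))))); split=> //.
- by move=> i; exists (rho / 8).
- move=> i k.
  pose g (s : ('I_N + 'I_N) + ('I_N + 'I_N)) (z : 'I_N + 'I_N -> C) : C :=
    scat (scat (fun t => z (inl t)) (fun t => z (inl t)))
         (scat (fun t => z (inl t)) (fun t => z (inl t) + z (inr t))) s.
  have hg : agerm (E0 i (inr k)).
    by exists (rho / 8 / 8); [lra|have [] := hE0 i].
  apply: (agerm_comp (g := g)) => //.
    case=> [[t|t]|[t|t]]; rewrite /g /=; try exact: agerm_coord.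
    by apply: agermD; exact: agerm_coord.
  by case=> [[t|t]|[t|t]]; rewrite /g //= addr0.
exists (rho / 8 / 8 / 2) => [|x y hx hy]; first by lra.
have dx (r : R) : rho / 8 / 8 / 2 <= r -> disc r x by move=> hr; exact: disc_le hr hx.
have dxy (r : R) : rho / 8 / 8 <= r -> disc r (fun i => x i + y i).
  move=> hr i; apply: le_trans (cabsD _ _) _; have := hx i; have := hy i; lra.
split.
  rewrite h2; [|by apply: dx; lra|by apply: dxy; lra].
  by apply: eq_bigr => i _; rewrite addrAC subrr add0r.
move=> i; have [_ hi] := hE0 i; rewrite hi; first last.
- by apply: disc_scat; [apply: dx|apply: dxy]; lra.
- by apply: disc_scat; apply: dx; lra.
rewrite big_sumType /= big1 ?add0r; last by move=> k _; rewrite subrr mul0r.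
by apply: eq_bigr => k _; rewrite addrAC subrr add0r.
Qed.

End Criterion.

Section Determinacy.
Variables (R : realType) (N m n : nat).
Local Notation C := (Cplx R).
Local Notation J := ('I_m * 'I_n)%type.
Local Notation L := (gen_index N m n).

Lemma sum_pair_delta1 (K : pzRingType) k l (p : 'I_k) (F : 'I_k * 'I_l -> K) :
  \sum_cd (p == cd.1)%:R * F cd = \sum_d F (p, d).
Proof.
rewrite (eq_bigr (fun cd => (p == cd.1)%:R * F (cd.1, cd.2))); last by case.
rewrite -(pair_bigA _ (fun c d => (p == c)%:R * F (c, d))) /= (bigD1 p) //=.
rewrite [X in _ + X]big1 ?addr0; last first.
  by move=> c /negbTE cp; rewrite big1 // => d _; rewrite eq_sym cp mul0r.
by apply: eq_bigr => d _; rewrite eqxx mul1r.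
Qed.

Lemma sum_pair_delta2 (K : pzRingType) k l (q : 'I_l) (F : 'I_k * 'I_l -> K) :
  \sum_cd F cd * (q == cd.2)%:R = \sum_c F (c, q).
Proof.
rewrite (eq_bigr (fun cd => F (cd.1, cd.2) * (q == cd.2)%:R)); last by case.
rewrite -(pair_bigA _ (fun c d => F (c, d) * (q == d)%:R)) /=.
apply: eq_bigr => c _; rewrite (bigD1 q) //= eqxx mulr1 big1 ?addr0 //.
by move=> d /negbTE dq; rewrite eq_sym dq mulr0.
Qed.

Variables (F G : 'rV[C]_N -> 'M[C]_(m, n)) (D : J -> 'I_N -> ('I_N + 'I_N -> C) -> C)
  (E : J -> 'I_N -> 'I_N -> ('I_N + 'I_N -> C) -> C).

(** The terms of order two in [xi], [A] and [B] of
    [F (x + xi) (1 + B) - (1 - A) G x]. *)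
Definition quadratic_part (l l' : L) (j : J) (z : 'I_N + L -> C) : C :=
  let x t := z (inl t) in let xi t := z (inr (inl t)) in
  match l, l' with
  | inl i, inl k => E j i k (scat x xi)
  | inl i, inr (inr cd) =>
      (j.2 == cd.2)%:R * D (j.1, cd.1) i (scat x (fun t => x t + xi t))
  | _, _ => 0
  end.

(** The equation [F (x + xi) (1 + B) = (1 - A) G x] expanded in the unknowns
    [xi], [A] and [B]. *)
Lemma equivalence_expansion (x : 'I_N -> C) (y : L -> C) :
  let xi i := y (inl i) in
  let f j := F (rowof x) j.1 j.2 in
  let g j := G (rowof x) j.1 j.2 in
  let Fx := F (rowof (fun i => x i + xi i)) in
  (forall j, Fx j.1 j.2 - f j = \sum_i xi i * D j i (scat x (fun i => x i + xi i))) ->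
  (forall j i, D j i (scat x (fun i => x i + xi i)) - D j i (scat x x) =
     \sum_k xi k * E j i k (scat x xi)) ->
  (forall j, f j - g j +
     \sum_l tangent_gen (fun a j => D j a (scat x x)) g f l j * y l +
     \sum_l \sum_l' y l * y l' * quadratic_part l l' j (scat x y) = 0) ->
  Fx *m (1%:M + \matrix_(c, d) y (inr (inr (c, d)))) =
  (1%:M + \matrix_(c, d) - y (inr (inl (c, d)))) *m G (rowof x).
Proof.
move=> xi f g Fx h1 h2 h; apply/matrixP => p q.
have {h} := h (p, q).
rewrite !big_sumType /=.
rewrite [X in _ + _ + (X + _)](_ : _ = \sum_i xi i * (\sum_k xi k * E (p, q) i k (scat x xi)) +
   \sum_c (\sum_i xi i * D (p, c) i (scat x (fun t => x t + xi t))) * y (inr (inr (c, q)))); last first.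
  transitivity (\sum_(i < N) ((\sum_k xi i * xi k * E (p, q) i k (scat x xi)) +
     \sum_(cd : 'I_n * 'I_n) xi i * y (inr (inr cd)) * ((q == cd.2)%:R *
       D (p, cd.1) i (scat x (fun t => x t + xi t))))).
    apply: eq_bigr => i _; rewrite !big_sumType /=; congr (_ + _).
    by rewrite big1 ?add0r // => cd _; rewrite mulr0.
  rewrite big_split /=; congr (_ + _).
    by apply: eq_bigr => i _; rewrite mulr_sumr; apply: eq_bigr => k _; rewrite mulrA.
  under [RHS]eq_bigr => c _ do rewrite mulr_suml.
  rewrite [RHS]exchange_big /=; apply: eq_bigr => i _.
  transitivity (\sum_(cd : 'I_n * 'I_n) (xi i * y (inr (inr cd)) *
      D (p, cd.1) i (scat x (fun t => x t + xi t))) * (q == cd.2)%:R).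
    apply: eq_bigr => cd _; rewrite -/(xi i) /xi; ring.
  by rewrite sum_pair_delta2 /=; apply: eq_bigr => c _; rewrite mulrAC.
rewrite [X in _ + _ + (_ + X)](_ : _ = 0); last first.
  rewrite !big1 ?addr0 // => l _.
    by rewrite big1 // => l' _; rewrite mulr0.
  by rewrite big1 // => l' _; rewrite mulr0.
have -> : \sum_(cd : 'I_m * 'I_m) (p == cd.1)%:R * g (cd.2, q) * y (inr (inl cd)) =
   \sum_d g (d, q) * y (inr (inl (p, d))).
  rewrite -(sum_pair_delta1 p (fun cd : 'I_m * 'I_m => g (cd.2, q) * y (inr (inl cd)))).
  by apply: eq_bigr => cd _; rewrite mulrA.
have -> : \sum_(cd : 'I_n * 'I_n) f (p, cd.1) * (q == cd.2)%:R * y (inr (inr cd)) =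
   \sum_c f (p, c) * y (inr (inr (c, q))).
  rewrite -(sum_pair_delta2 q (fun cd : 'I_n * 'I_n => f (p, cd.1) * y (inr (inr cd)))).
  by apply: eq_bigr => cd _; rewrite mulrAC.
move=> H.
have -> : (Fx *m (1%:M + \matrix_(c, d) y (inr (inr (c, d))))) p q =
    Fx p q + \sum_c Fx p c * y (inr (inr (c, q))).
  rewrite mulmxDr mulmx1 mxE; congr (_ + _); rewrite mxE.
  by apply: eq_bigr => c _; rewrite mxE.
have -> : ((1%:M + \matrix_(c, d) - y (inr (inl (c, d)))) *m G (rowof x)) p q =
    g (p, q) - \sum_d g (d, q) * y (inr (inl (p, d))).
  rewrite mulmxDl mul1mx mxE; congr (_ + _); rewrite mxE -sumrN.
  by apply: eq_bigr => d _; rewrite mxE mulNr mulrC.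
apply/eqP; rewrite -subr_eq0; apply/eqP; apply: etrans H; rewrite addr0.
have FE c : Fx p c = f (p, c) + \sum_i xi i * D (p, c) i (scat x (fun i => x i + xi i)).
  by rewrite -h1 /= addrC subrK.
have -> : \sum_c Fx p c * y (inr (inr (c, q))) =
    \sum_c f (p, c) * y (inr (inr (c, q))) +
    \sum_c (\sum_i xi i * D (p, c) i (scat x (fun t => x t + xi t))) *
       y (inr (inr (c, q))).
  by rewrite -big_split; apply: eq_bigr => c _; rewrite /= FE mulrDl.
rewrite FE.
have -> : \sum_i xi i * D (p, q) i (scat x (fun i => x i + xi i)) =
   \sum_i D (p, q) i (scat x x) * y (inl i) +
   \sum_i xi i * \sum_k xi k * E (p, q) i k (scat x xi).
  rewrite -big_split; apply: eq_bigr => i _ /=.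
  by rewrite -h2 /xi; ring.
ring.
Qed.

End Determinacy.

Section DeterminacyCriterion.
Variables (R : realType) (N m n : nat).
Local Notation C := (Cplx R).
Local Notation J := ('I_m * 'I_n)%type.
Local Notation L := (gen_index N m n).

Lemma jetE r (F : 'rV[C]_N -> 'M[C]_(m, n)) k :
  jet r F k = taylor_coef (fun z => F z k.1.1 k.1.2) (bmnm k.2).
Proof. exact: ffunE. Qed.

Lemma jet_taylor_coef r (F G : 'rV[C]_N -> 'M[C]_(m, n)) (j : J) (a : multinom N) :
  jet r G = jet r F -> (mdeg a <= r)%N ->
  taylor_coef (fun z => G z j.1 j.2) a = taylor_coef (fun z => F z j.1 j.2) a.
Proof.
move=> /[swap] ar; pose k : jet_index N m n r := (j, BMultinom (ar : (mdeg a < r.+1)%N)).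
move=> h; have hk := congr1 (fun f : jet_space R N m n r => f k) h.
have hG := jetE G k; have hF := jetE F k; cbv beta in hk; clear h.
have hGF := etrans (esym hG) hk; have h := etrans hGF hF.
exact: h.
Qed.

(** If the tangent space of [F] contains the [K]-th power of the maximal ideal,
    up to terms of higher order, then [F] is [2 K]-determined.  Let the [mu] of
    Tougeron's theorem be the monomials of degree [K]: the difference of two germs
    with the same [2 K]-jet lies in the square of the ideal they generate. *)
Theorem determinacy_criterion (F : 'rV[C]_N -> 'M[C]_(m, n)) (K r : nat)
    (p : J -> mpoly N C) :
  analytic_mx F -> (0 < K)%N -> (K < r)%N ->
  (forall j a, (mdeg a <= r)%N ->
     mcoeff a (p j) = taylor_coef (fun z => F z j.1 j.2) a) ->
  (forall (b : multinom N) j, mdeg b = K -> exists v : L -> mpoly N C,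
     forall j' a, (mdeg a <= K)%N ->
       mcoeff a (\sum_l v l * poly_gen p l j') = ((a == b) && (j == j'))%:R) ->
  G_determined (2 * K) F.
Proof.
move=> anF K0 Kr hp hv G anG jGF.
pose f (j : J) x := F (rowof x) j.1 j.2; pose g (j : J) x := G (rowof x) j.1 j.2.
pose cf (j : J) := taylor_coef (fun z => F z j.1 j.2).
pose cg (j : J) := taylor_coef (fun z => G z j.1 j.2).
have cgf j a : (mdeg a <= 2 * K)%N -> cg j a = cf j a by exact: jet_taylor_coef.
have [rf hf] : exists rho, forall j, series_at rho (cf j) (f j).
  by apply: series_at_family => j; exact: (analytic_taylor (anF j.1 j.2)).
have [rg hg] : exists rho, forall j, series_at rho (cg j) (g j).
  by apply: series_at_family => j; exact: (analytic_taylor (anG j.1 j.2)).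
have {}hp j a : (mdeg a <= r)%N -> mcoeff a (p j) = cf j a := @hp j a.
clear jGF; clearbody cf cg.
have /choice[D /choice[E hDE]] j := second_order_expansion (hf j).
(* The linear part of the equation [F (x + xi) (1 + B) = (1 - A) G x]. *)
pose A (l : L) (j : J) x :=
  tangent_gen (fun a j => D j a (scat x x)) (g^~ x) (f^~ x) l j.
have fp j : vanish_order K.+1 (fun x => f j x - meval x (p j)).
  apply: vanish_order_diff (hf j) (series_at_poly (p j) (@ltr01 R)) _ => a aK.
  by rewrite hp // (leq_trans _ (ltnW Kr)).
have gp j : vanish_order K.+1 (fun x => g j x - meval x (p j)).
  apply: vanish_order_diff (hg j) (series_at_poly (p j) (@ltr01 R)) _ => a aK.
  rewrite hp ?(leq_trans _ (ltnW Kr)) // cgf //.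
  by apply: (leq_trans (n := K)) => //; rewrite leq_pmull.
have Ap l j : vanish_order K.+1 (fun x => A l j x - meval x (poly_gen p l j)).
  case: l => [i|[[c d]|[c d]]]; rewrite /A /poly_gen /=.
  - have [_ _ h _] := hDE j.
    apply: vanish_order_diff (h i) (series_at_poly _ (@ltr01 R)) _ => a aK.
    rewrite mcoeff_deriv hp // mdegD mdeg1 addn1.
    exact: leq_trans aK Kr.
  - case: eqP => _.
      by apply: vanish_order_ext (gp (d, j.2)); exists 1 => // x _; rewrite !mul1r.
    apply: (vanish_order_ext _ (@vanish_order0 R N K.+1)).
    by exists 1 => // x _; rewrite !mul0r meval0 subrr.
  - case: eqP => _.
      by apply: vanish_order_ext (fp (j.1, c)); exists 1 => // x _; rewrite !mulr1.
    apply: (vanish_order_ext _ (@vanish_order0 R N K.+1)).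
    by exists 1 => // x _; rewrite !mulr0 meval0 subrr.
have /choice[h2 hh2] (lj : L * J) : exists h : bmultinom N K.+1 -> ('I_N -> C) -> C,
    (forall b, vanish_order 1 (h b)) /\
    near0 (fun x => A lj.1 lj.2 x - meval x (poly_gen p lj.1 lj.2) =
      \sum_b hom_monomial b x * h b x).
  by apply: vanish_order_divide; rewrite addn1.
pose B := bmultinom N K.+1.
(* The combinations [V] of the generators are the monomial vectors of degree [K]
   up to errors [e] that lie in the next power of the maximal ideal. *)
have /choice[V hV] (bj : B * J) : exists v : L -> mpoly N C,
    if mdeg (bmnm bj.1) == K then forall j' a, (mdeg a <= K)%N ->
       mcoeff a (\sum_l v l * poly_gen p l j') = ((a == bmnm bj.1) && (bj.2 == j'))%:R
    else v = (fun _ => 0).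
  case: eqP => [bK|_]; last by exists (fun _ => 0).
  exact: hv.
pose e (b : B) (j j' : J) : mpoly N C := if mdeg (bmnm b) == K then
  \sum_l V (b, j) l * poly_gen p l j' - (j == j')%:R *: mpolyX C (bmnm b) else 0.
have /choice[h1 hh1] (k : B * J * J) : exists h : bmultinom N K.+1 -> ('I_N -> C) -> C,
    (forall b, vanish_order 1 (h b)) /\
    near0 (fun x => meval x (e k.1.1 k.1.2 k.2) = \sum_b hom_monomial b x * h b x).
  apply: vanish_order_divide; exists 1, (fun a => mcoeff a (e k.1.1 k.1.2 k.2)).
  split=> [|a]; first exact: series_at_poly.
  rewrite addn1 ltnS /e; case: eqP => [bK|_] aK; last by rewrite mcoeff0.
  have := hV (k.1.1, k.1.2); rewrite /= bK eqxx => /(_ k.2 a aK) hh.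
  rewrite mcoeffB hh mcoeffZ mcoeffX eq_sym -natrM mulnb andbC.
  by rewrite subrr.
pose s (b : B) (j : J) (b' : B) (j' : J) (x : 'I_N -> C) :=
  h1 (b, j, j') b' x + \sum_l meval x (V (b, j) l) * h2 (l, j') b' x.
have AvE : near0 (fun x => forall b j j', \sum_l meval x (V (b, j) l) * A l j' x =
  \sum_b' hom_monomial b' x * (((b == b') && (j == j'))%:R + s b j b' j' x)).
  have n1 := near0_all (fun k => (hh1 k).2); have n2 := near0_all (fun lj => (hh2 lj).2).
  apply: near0_imp (near0_and n1 n2) => x [e1 e2] b j j'.
  rewrite /s; under [RHS]eq_bigr => b' _ do rewrite addrA mulrDr.
  rewrite big_split /=; under [in RHS]eq_bigr => b' _ do rewrite mulrDr.
  rewrite big_split /= -(e1 (b, j, j')) /=.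
  have -> : \sum_b' hom_monomial b' x * (\sum_l meval x (V (b, j) l) * h2 (l, j') b' x) =
      \sum_l meval x (V (b, j) l) * (A l j' x - meval x (poly_gen p l j')).
    under eq_bigr => b' _ do rewrite mulr_sumr.
    rewrite exchange_big; apply: eq_bigr => l _; rewrite (e2 (l, j')) mulr_sumr.
    by apply: eq_bigr => b' _; rewrite mulrCA.
  have -> : \sum_b' hom_monomial b' x * ((b == b') && (j == j'))%:R =
      (j == j')%:R * hom_monomial b x.
    rewrite (bigD1 b) //= eqxx big1 ?addr0 /=; first by rewrite mulrC.
    by move=> b' /negbTE bb; rewrite eq_sym bb mulr0.
  have -> : meval x (e b j j') = \sum_l meval x (V (b, j) l) * meval x (poly_gen p l j') -
      (j == j')%:R * hom_monomial b x.
    rewrite /e /hom_monomial; have := hV (b, j) => /=; case: eqP => [bK _|_ V0].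
      have mX : meval x (mpolyX C (bmnm b)) = mmap1 x (bmnm b) by rewrite /meval mmapX.
      rewrite mevalB raddf_sum mevalZ mX; congr (_ - _).
      by apply: eq_bigr => l _; rewrite /= mevalM.
    by rewrite meval0 mulr0 subr0 big1 // => l _; rewrite V0 meval0 mul0r.
  rewrite [X in _ = X + _]addrC subrK -big_split; apply: eq_bigr => l _ /=.
  by rewrite -mulrDr addrC subrK.
have /choice[u0 hu0] (j : J) : exists h : B -> ('I_N -> C) -> C,
    (forall b, vanish_order K.+1 (h b)) /\
    near0 (fun x => f j x - g j x = \sum_b hom_monomial b x * h b x).
  apply: vanish_order_divide; apply: vanish_order_diff (hf j) (hg j) _ => a.
  by rewrite addnS ltnS addnn -mul2n => /cgf.
have /choice[u hu] (jb : J * B) : exists h : B -> ('I_N -> C) -> C,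
    (forall b, vanish_order 1 (h b)) /\
    near0 (fun x => u0 jb.1 jb.2 x = \sum_b hom_monomial b x * h b x).
  by apply: vanish_order_divide; rewrite addn1; have [] := hu0 jb.1.
have f0E : near0 (fun x => forall j, f j x - g j x =
    \sum_b \sum_b' hom_monomial b x * hom_monomial b' x * u (j, b) b' x).
  have n1 := near0_all (fun j => (hu0 j).2); have n2 := near0_all (fun jb => (hu jb).2).
  apply: near0_imp (near0_and n1 n2) => x [e1 e2] j; rewrite e1.
  apply: eq_bigr => b _; rewrite (e2 (j, b)) mulr_sumr.
  by apply: eq_bigr => b' _; rewrite mulrA.
have [||||||||||y [z [y1 y2 y3 y4]]] := @tougeron R 'I_N L J B (@hom_monomial R N K)
  (fun j x => f j x - g j x) (fun b b' j => u (j, b) b') A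
  (fun b j l x => meval x (V (b, j) l)) s (fun l l' j => @quadratic_part R N m n D E l l' j).
- exact: agerm_hom_monomial.
- move=> b b' j; apply: (@vanish_order_germ _ _ 1); by have [] := hu (j, b).
- move=> b j l; apply: (@agerm_meval _ _ _ (fun i x => x i)); exact: agerm_coord.
- move=> b j b' j'; rewrite /s; apply: agermD.
    by apply: (@vanish_order_germ _ _ 1); have [] := hh1 (b, j, j').
  apply: agerm_sum => l; apply: agermM.
    by apply: (@agerm_meval _ _ _ (fun i x => x i)) => i; exact: agerm_coord.
  by apply: (@vanish_order_germ _ _ 1); have [] := hh2 (l, j').
- move=> l l' j; rewrite /quadratic_part.
  case: l => [i|l]; last exact: agerm_const.
  case: l' => [k|[cd|cd]].
  + have [_ hE _ _] := hDE j.
    pose gg (w : 'I_N + 'I_N) (z : 'I_N + L -> C) : C :=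
      scat (fun t => z (inl t)) (fun t => z (inr (inl t))) w.
    apply: (agerm_comp (g := gg)) => //; first by case=> t; exact: agerm_coord.
    by case.
  + exact: agerm_const.
  + have [hD _ _ _] := hDE (j.1, cd.1).
    apply: agermM; first exact: agerm_const.
    pose gg (w : 'I_N + 'I_N) (z : 'I_N + L -> C) : C :=
      scat (fun t => z (inl t)) (fun t => z (inl t) + z (inr (inl t))) w.
    apply: (agerm_comp (g := gg)) => //.
      by case=> t; [exact: agerm_coord|apply: agermD; exact: agerm_coord].
    by case=> t //=; rewrite /gg /= addr0.
- by move=> b; exact: hom_monomial0.
- move=> b b' j; apply: vanish_order1; by have [] := hu (j, b).
- move=> b j b' j'; rewrite /s (vanish_order1 ((hh1 (b, j, j')).1 b')) add0r.
  by rewrite big1 // => l _; rewrite (vanish_order1 ((hh2 (l, j')).1 b')) mulr0.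
- exact: f0E.
- exact: AvE.
have y0 l : y l (fun _ => 0) = 0.
  have [d d0 /(_ (fun _ => 0)) ->] := y3; last exact: disc0 (ltW d0).
  by rewrite big1 // => b _; rewrite hom_monomial0 // mul0r.
pose h (z : 'rV[C]_N) : 'rV[C]_N := \row_i (z ord0 i + y (inl i) (z ord0)).
pose Q (z : 'rV[C]_N) : 'M[C]_n :=
  1%:M + \matrix_(c, d) y (inr (inr (c, d))) (z ord0).
pose Lm (z : 'rV[C]_N) : 'M[C]_m :=
  1%:M + \matrix_(c, d) - y (inr (inl (c, d))) (z ord0).
have gL : GL_germ Lm.
  apply: (@GL_germ_near1 R N m (fun c d x => - y (inr (inl (c, d))) x)) => c d.
    exact: agermN.
  by rewrite y0 oppr0.
exists h, Q, Lm; split=> //.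
- apply: (@diffeo_germ_near_id R N B (@hom_monomial R N K)
    (fun b i => z b (inl i)) (fun i => y (inl i))).
  + by move=> i; exact: y1.
  + exact: agerm_hom_monomial.
  + by move=> b i; have [] := y2 b (inl i).
  + by move=> b; exact: hom_monomial0.
  + by move=> b i; have [] := y2 b (inl i).
  + by apply: near0_imp y3 => x hx i; exact: hx.
- by apply: (@GL_germ_near1 R N n (fun c d => y (inr (inr (c, d))))) => c d.
have eqn : \forall x \near (0 : 'rV[C]_N), F (h x) *m Q x = Lm x *m G x.
  apply/near_rowP.
  have n1 : near0 (fun x : 'I_N -> C => forall j,
      (f j (fun i => x i + y (inl i) x) - f j x =
          \sum_i y (inl i) x * D j i (scat x (fun i => x i + y (inl i) x))) /\
        forall i, D j i (scat x (fun i => x i + y (inl i) x)) - D j i (scat x x) =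
          \sum_k y (inl k) x * E j i k (scat x (fun i => y (inl i) x))).
    apply: near0_all => j; have [_ _ _ [d d0 hd]] := hDE j.
    have n2 := near0_all (fun i : 'I_N => agerm_small (y1 (inl i)) (y0 (inl i)) d0).
    have n3 : near0 (fun x : 'I_N -> C => disc d x) by exists d.
    apply: near0_imp (near0_and n2 n3) => x [a1 a2].
    exact: (hd x (fun i => y (inl i) x) a2 a1).
  apply: near0_imp (near0_and n1 y4) => x [a1 a2].
  have := @equivalence_expansion R N m n F G D E x (fun l => y l x).
  rewrite /h /Q /Lm rowofK; apply.
  - by move=> j; have [] := a1 j.
  - by move=> j; have [] := a1 j.
  - exact: a2.
have [_ [L' [_ hL _]]] := gL.
apply: filterS2 eqn hL => x e1 /mulmx1_unit[Lu _].
by rewrite -mulmxA e1 mulmxA mulVmx // mul1mx.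
Qed.

End DeterminacyCriterion.

(** * An algebraic condition on jets *)

Section Macaulay.
Variables (K : fieldType) (N m n : nat).
Local Notation J := ('I_m * 'I_n)%type.
Local Notation L := (gen_index N m n).
Implicit Types (p w : J -> mpoly N K).

(** [tangent_mod p d w]: modulo terms of degree at least [d], the vector [w]
    lies in the tangent space of [p]. *)
Definition tangent_mod p d w := exists v : L -> mpoly N K,
  forall j a, (mdeg a < d)%N ->
    mcoeff a (\sum_l v l * poly_gen p l j) = mcoeff a (w j).

Lemma tangent_mod0 p d : tangent_mod p d (fun _ => 0).
Proof.
exists (fun _ => 0) => j a _; congr (mcoeff a _).
by apply: big1 => l _; rewrite mul0r.
Qed.

Lemma tangent_modD p d w w' : tangent_mod p d w -> tangent_mod p d w' ->
  tangent_mod p d (fun j => w j + w' j).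
Proof.
move=> [v hv] [v' hv']; exists (fun l => v l + v' l) => j a ad.
rewrite mcoeffD -hv // -hv' // -mcoeffD -big_split; congr (mcoeff a _).
by apply: eq_bigr => l _; rewrite mulrDl.
Qed.

Lemma tangent_modZ p d w c : tangent_mod p d w ->
  tangent_mod p d (fun j => c *: w j).
Proof.
move=> [v hv]; exists (fun l => c *: v l) => j a ad.
rewrite mcoeffZ -hv // -mcoeffZ scaler_sumr; congr (mcoeff a _).
by apply: eq_bigr => l _; rewrite scalerAl.
Qed.

Lemma tangent_mod_sum p d (I : Type) (s : seq I) (F : I -> J -> mpoly N K) :
  (forall i, tangent_mod p d (F i)) ->
  tangent_mod p d (fun j => \sum_(i <- s) F i j).
Proof.
move=> h; elim: s => [|i s IH].
  rewrite (_ : (fun _ => _) = fun _ => 0); first exact: tangent_mod0.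
  by apply: funext => j; rewrite big_nil.
rewrite (_ : (fun _ => _) = fun j => F i j + \sum_(k <- s) F k j).
  exact: tangent_modD.
by apply: funext => j; rewrite big_cons.
Qed.

Lemma tangent_mod_le p d d' w w' : (d <= d')%N ->
  (forall j a, (mdeg a < d)%N -> mcoeff a (w j) = mcoeff a (w' j)) ->
  tangent_mod p d' w -> tangent_mod p d w'.
Proof.
move=> dd h [v hv]; exists v => j a ad; rewrite hv ?h //.
exact: leq_trans ad dd.
Qed.

Definition monomial_vec (b : multinom N) (j : J) : J -> mpoly N K :=
  fun j' => (j == j')%:R *: mpolyX K b.

Lemma mcoeff_monomial_vec b j j' a :
  mcoeff a (monomial_vec b j j') = ((a == b) && (j == j'))%:R.
Proof. by rewrite mcoeffZ mcoeffX [b == a]eq_sym -natrM mulnb andbC. Qed.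

Variables (e M : nat) (Gam : 'I_N -> J -> L -> mpoly N K).

Definition big_exponent (b : multinom N) := [exists i, (e <= b i)%N].

Definition big_monomial := {b : bmultinom N M | big_exponent (bmnm b)}.

Lemma big_exponentP (b : big_monomial) : exists i, (e <= bmnm (val b) i)%N.
Proof. exact/existsP/(valP b). Qed.

Definition pivot_var (b : big_monomial) : 'I_N := xchoose (big_exponentP b).

(** When [\sum_l Gam i j l * poly_gen g l j' = (j == j')%:R * 'X_i ^+ e], the row
    of [(b, j)] is the monomial vector of [(b, j)] in the case [p = g]. *)
Definition macaulay_row p (x : big_monomial * J) : J -> mpoly N K := fun j' =>
  mpolyX K (mnm_sub (bmnm (val x.1)) (mnm_muln (mnm1 (pivot_var x.1)) e)) *
  \sum_l Gam (pivot_var x.1) x.2 l * poly_gen p l j'.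

Definition macaulay p : 'M[K]_#|{: big_monomial * J}| :=
  \matrix_(x, y) mcoeff (bmnm (val (enum_val y).1))
     (macaulay_row p (enum_val x) (enum_val y).2).

Lemma macaulay_row_tangent p d x : tangent_mod p d (macaulay_row p x).
Proof.
exists (fun l => mpolyX K (mnm_sub (bmnm (val x.1)) (mnm_muln (mnm1 (pivot_var x.1)) e))
  * Gam (pivot_var x.1) x.2 l) => j a _; congr (mcoeff a _).
by rewrite /macaulay_row mulr_sumr; apply: eq_bigr => l _; rewrite mulrA.
Qed.

(** The number of these vectors does not depend on [M]. *)
Definition small_vec (y : {ffun 'I_N -> 'I_e} * J) : J -> mpoly N K :=
  monomial_vec (Multinom [tuple (y.1 i : nat) | i < N]) y.2.

(** The inverse matrix combines the rows, which are tangent, into vectors whose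
    components with a large exponent are those of a monomial vector. *)
Lemma macaulay_normal_form p b j : macaulay p \in unitmx -> (mdeg b < M)%N ->
  exists c : {ffun 'I_N -> 'I_e} * J -> K,
    tangent_mod p M (fun j' => monomial_vec b j j' - \sum_y c y *: small_vec y j').
Proof.
move=> Au bM.
have coef_small (c : {ffun 'I_N -> 'I_e} * J -> K) j' a :
    mcoeff a (\sum_y c y *: small_vec y j') =
    \sum_y c y * ((a == Multinom [tuple (y.1 i : nat) | i < N]) && (y.2 == j'))%:R.
  rewrite raddf_sum; apply: eq_bigr => y _.
  by rewrite /= mcoeffZ mcoeff_monomial_vec.
have small_mnm a : ~~ big_exponent a -> exists th : {ffun 'I_N -> 'I_e},
    forall th' : {ffun 'I_N -> 'I_e}, (a == Multinom [tuple (th' i : nat) | i < N]) = (th' == th).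
  move=> /existsPn ha.
  have lt i : (a i < e)%N by rewrite ltnNge ha.
  exists [ffun i => Ordinal (lt i)] => th'; apply/eqP/eqP => [aE|->].
    by apply/ffunP => i; rewrite ffunE; apply: val_inj; rewrite /= aE mnmE.
  by apply/mnmP => i; rewrite mnmE ffunE.
have coef_small1 (c : {ffun 'I_N -> 'I_e} * J -> K) j' a (th : {ffun 'I_N -> 'I_e}) :
    (forall th' : {ffun 'I_N -> 'I_e},
      (a == Multinom [tuple (th' i : nat) | i < N]) = (th' == th)) ->
    mcoeff a (\sum_y c y *: small_vec y j') = c (th, j').
  move=> hth; rewrite coef_small (bigD1 (th, j')) //= hth !eqxx mulr1 big1 ?addr0 //.
  case=> th' j2; rewrite xpair_eqE /= hth => /negbTE ->.
  by rewrite mulr0.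
have coef_big (c : {ffun 'I_N -> 'I_e} * J -> K) j' a : big_exponent a ->
    mcoeff a (\sum_y c y *: small_vec y j') = 0.
  move=> /existsP[i hi]; rewrite coef_small big1 // => y _.
  case: eqP => [aE|_]; last by rewrite mulr0.
  by move: hi; rewrite aE mnmE leqNgt ltn_ord.
have [bb|bs] := boolP (big_exponent b); last first.
  have [th hth] := small_mnm b bs.
  exists (fun y : {ffun 'I_N -> 'I_e} * J => (y == (th, j))%:R).
  apply: tangent_mod_le (leqnn M) _ (tangent_mod0 p M) => j' a _.
  rewrite mcoeff0 mcoeffB mcoeff_monomial_vec.
  have [ab|ab] := boolP (big_exponent a).
    rewrite coef_big // subr0; case: eqP => //= E.
    by move: bs; rewrite -E ab.
  have [th' hth'] := small_mnm a ab.
  rewrite (coef_small1 _ _ _ th') // xpair_eqE.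
  suff -> : (a == b) = (th' == th) by rewrite [j' == _]eq_sym subrr.
  have bE : b = Multinom [tuple (th i : nat) | i < N] by apply/eqP; rewrite hth.
  by rewrite [in LHS]bE hth' eq_sym.
pose x : big_monomial * J := (Sub (BMultinom bM) bb, j).
pose w j' := \sum_k (invmx (macaulay p)) (enum_rank x) k *:
   macaulay_row p (enum_val k) j'.
have wT : tangent_mod p M w.
  by apply: tangent_mod_sum => k; apply: tangent_modZ; exact: macaulay_row_tangent.
have wcoef (y : big_monomial * J) : mcoeff (bmnm (val y.1)) (w y.2) = (x == y)%:R.
  have := mulVmx Au => /matrixP /(_ (enum_rank x) (enum_rank y)).
  rewrite !mxE (inj_eq enum_rank_inj) => <-; rewrite raddf_sum.
  by apply: eq_bigr => k _; rewrite /= mcoeffZ mxE enum_rankK.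
exists (fun y : {ffun 'I_N -> 'I_e} * J => - mcoeff (Multinom [tuple (y.1 i : nat) | i < N]) (w y.2)).
apply: tangent_mod_le (leqnn M) _ wT => j' a aM.
rewrite mcoeffB mcoeff_monomial_vec.
have [ab|ab] := boolP (big_exponent a).
  have := wcoef (Sub (BMultinom aM) ab, j'); rewrite SubK /= => ->.
  rewrite coef_big // subr0 xpair_eqE -val_eqE /= -val_eqE /=.
  by rewrite [b == a]eq_sym.
have [th hth] := small_mnm a ab; rewrite (coef_small1 _ _ _ th) // opprK.
have aE : a = Multinom [tuple (th i : nat) | i < N] by apply/eqP; rewrite hth.
rewrite -aE; case: eqP => [E|_]; last by rewrite add0r.
by move: ab; rewrite E bb.
Qed.

(** Among more monomial vectors than small ones, of increasing degrees, some
    combination is tangent, and so is its term of least degree modulo terms of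
    higher degree. *)
Theorem macaulay_criterion p : macaulay p \in unitmx ->
  (#|{: {ffun 'I_N -> 'I_e} * J}| + 2 <= M)%N ->
  exists k, [/\ (0 < k)%N, (k < M)%N & forall b j, mdeg b = k ->
    tangent_mod p k.+1 (monomial_vec b j)].
Proof.
set s := #|{: {ffun 'I_N -> 'I_e} * J}| => Au sM.
have [//|nh] := pselect (exists k, [/\ (0 < k)%N, (k < M)%N & forall b j, mdeg b = k ->
    tangent_mod p k.+1 (monomial_vec b j)]).
(* Otherwise each of the degrees [1, ..., s + 1] has a monomial vector that is
   not tangent modulo higher degrees. *)
have /choice[bj hbj] (k : 'I_s.+1) : exists bj : multinom N * J,
    mdeg bj.1 = k.+1 /\ ~ tangent_mod p k.+2 (monomial_vec bj.1 bj.2).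
  apply: contrapT => /forallNP h; apply: nh; exists k.+1; split=> //.
    by have := ltn_ord k; lia.
  move=> b j bk; apply: contrapT => hn; exact: (h (b, j)).
have /choice[c hc] (k : 'I_s.+1) : exists c : {ffun 'I_N -> 'I_e} * J -> K,
    tangent_mod p M (fun j' => monomial_vec (bj k).1 (bj k).2 j' -
      \sum_y c y *: small_vec y j').
  apply: macaulay_normal_form => //; have [-> _] := hbj k.
  by have := ltn_ord k; lia.
pose A : 'M[K]_(s.+1, s) := \matrix_(k, y) c k (enum_val y).
have : \rank (kermx A) != 0%N.
  by rewrite mxrank_ker subn_eq0 -ltnNge ltnS rank_leq_col.
rewrite mxrank_eq0 => /rowV0Pn[d /sub_kermxP dA d0].
have [k1 k1P] : exists k : 'I_s.+1, d 0 k != 0.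
  apply/existsP; move: d0; apply: contraNT => /existsPn h.
  by apply/eqP/rowP => i; rewrite mxE; apply/eqP; rewrite -[_ == _]negbK h.
pose k0 := [arg min_(k < k1 | d ord0 k != 0%R) (k : nat)]%N.
have [k0P k0min] : d 0 k0 != 0 /\ forall k, d 0 k != 0 -> (k0 <= k)%N.
  by rewrite /k0; case: arg_minnP.
have [k0deg] := hbj k0; case.
have tM : tangent_mod p M (fun j' => \sum_k d 0 k *: monomial_vec (bj k).1 (bj k).2 j').
  have := @tangent_mod_sum p M _ (index_enum _) (fun (k : 'I_s.+1) j' => d 0 k *:
     (monomial_vec (bj k).1 (bj k).2 j' - \sum_y c k y *: small_vec y j'))
     (fun k => tangent_modZ (d 0 k) (hc k)).
  apply: tangent_mod_le => // j' a _; congr (mcoeff a _).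
  rewrite -[RHS]subr0; under eq_bigr => k _ do rewrite scalerBr.
  rewrite sumrB; congr (_ - _).
  under eq_bigr => k _ do rewrite scaler_sumr.
  rewrite exchange_big big1 // => y _ /=.
  under eq_bigr => k _ do rewrite scalerA.
  rewrite -scaler_suml; have /rowP/(_ (enum_rank y)) := dA; rewrite !mxE.
  by under eq_bigr => k _ do rewrite mxE enum_rankK; move=> ->; rewrite scale0r.
have := tangent_modZ (d 0 k0)^-1 tM.
apply: tangent_mod_le; first by have := ltn_ord k0; lia.
move=> j a ak; rewrite mcoeffZ raddf_sum (bigD1 k0) //= big1 ?addr0.
  by rewrite mcoeffZ mulrA mulVf // mul1r.
move=> k kk0; rewrite mcoeffZ; have [->|dk] := eqVneq (d 0 k) 0; first by rewrite mul0r.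
rewrite mcoeff_monomial_vec; case: eqP => [aE|_]; last by rewrite mulr0.
have [kdeg _] := hbj k; have := k0min k dk.
rewrite leq_eqVlt => /orP[/eqP/val_inj E|lt]; first by rewrite E eqxx in kk0.
by move: ak; rewrite aE kdeg ltnS ltnNge lt.
Qed.

End Macaulay.

(** * A lower bound for codimensions *)

Section GradedDeterminant.
Variables (A : comNzRingType) (D : nat).

(** The degrees along a permutation have a fixed sum: a product of entries other
    than the diagonal one has a factor that does not increase degrees. *)
Lemma det_graded (B : 'M[A]_D) (deg : 'I_D -> nat) :
  (forall x y, x != y -> (deg y <= deg x)%N -> B x y = 0) ->
  \det B = \prod_x B x x.
Proof.
move=> h; rewrite /determinant (bigD1 (1%g : {perm 'I_D})) //= odd_perm1 expr0 mul1r.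
rewrite [X in _ + X]big1 ?addr0; first by apply: eq_bigr => x _; rewrite perm1.
move=> s s1.
have [/existsP[x hx]|/existsPn hs] := boolP [exists x, B x (s x) == 0].
  by rewrite (bigD1 x) //= (eqP hx) mul0r mulr0.
case/negP: s1; apply/eqP/permP => x; rewrite perm1; apply/eqP; apply/negPn/negP => sx.
have le y : (deg y <= deg (s y))%N.
  have [->//|ys] := eqVneq (s y) y; rewrite leqNgt; apply/negP => /ltnW lt.
  by have := hs y; rewrite h ?eqxx // eq_sym.
have lt : (deg x < deg (s x))%N.
  rewrite ltnNge; apply/negP => lt; have := hs x; rewrite h ?eqxx //.
  by rewrite eq_sym.
have : (\sum_y deg y < \sum_y deg (s y))%N.
  rewrite (bigD1 x) //= [ltnRHS](bigD1 x) //= -addSn leq_add //.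
  by apply: leq_sum => y _.
by rewrite [X in (X < _)%N](reindex_inj (@perm_inj _ s)) ltnn.
Qed.

End GradedDeterminant.

Section Pencil.
Variables (K : fieldType) (n D : nat) (A : 'I_n -> 'M[K]_D).

Definition pencil : 'M[mpoly n K]_D :=
  \matrix_(x, y) \sum_i A i x y *: mpolyX K (mnm1 i).

Lemma meval_pencil v : meval v (\det pencil) = \det (\sum_i v i *: A i).
Proof.
rewrite -det_map_mx; congr (\det _); apply/matrixP => x y.
rewrite !mxE summxE raddf_sum; apply: eq_bigr => i _.
by rewrite /= mevalZ mevalXU mxE mulrC.
Qed.

Definition hom_deg k (q : mpoly n K) := forall m, mdeg m != k -> mcoeff m q = 0.

Lemma hom_deg_sum k (I : Type) (s : seq I) (P : pred I) (F : I -> mpoly n K) :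
  (forall i, P i -> hom_deg k (F i)) -> hom_deg k (\sum_(i <- s | P i) F i).
Proof.
move=> h m mk; rewrite raddf_sum big1 // => i Pi; exact: h.
Qed.

Lemma hom_degZ k c q : hom_deg k q -> hom_deg k (c *: q).
Proof. by move=> h m mk; rewrite mcoeffZ h // mulr0. Qed.

Lemma hom_degX a : hom_deg (mdeg a) (mpolyX K a).
Proof. by move=> m ma; rewrite mcoeffX; case: eqP => // am; rewrite -am eqxx in ma. Qed.

Lemma hom_degM k l p q : hom_deg k p -> hom_deg l q -> hom_deg (k + l) (p * q).
Proof.
move=> hp hq m mkl; apply: memN_msupp_eq0; apply/negP => /msuppM_le.
case/allpairsP => [[a b] /= [ap bq mE]]; move: mkl; rewrite mE mdegD.
have -> : mdeg a = k.
  by apply/eqP/negPn/negP => ak; move: ap; rewrite mcoeff_msupp hp ?eqxx.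
have -> : mdeg b = l.
  by apply/eqP/negPn/negP => bl; move: bq; rewrite mcoeff_msupp hq ?eqxx.
by rewrite eqxx.
Qed.

Lemma pencil_hom_deg : hom_deg D (\det pencil).
Proof.
apply: hom_deg_sum => s _; rewrite mulr_sign.
have h : hom_deg D (\prod_i pencil i (s i)).
  have : hom_deg (\sum_(i < D) 1)%N (\prod_i pencil i (s i)).
    elim/big_ind2: _ => [|p q u v|i _]; first by have := @hom_degX (@mnm0 n); rewrite mdeg0 mpolyX0.
      exact: hom_degM.
    rewrite mxE; apply: hom_deg_sum => j _; apply: hom_degZ.
    by have := @hom_degX (mnm1 j); rewrite mdeg1.
  by rewrite sum1_card card_ord.
by case: (odd_perm s) => // m /h hm; rewrite mcoeffN hm oppr0.
Qed.

Variables (i0 : 'I_n) (early : {pred 'I_n}) (deg : 'I_D -> nat).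
Hypothesis A1 : A i0 = 1%:M.
Hypothesis i0_late : i0 \notin early.
Hypothesis Alate : forall i, i \notin early -> i != i0 -> forall x y,
  (deg y <= deg x)%N -> A i x y = 0.

(** When the early variables are set to zero, the pencil becomes the variable
    [i0] times the identity, plus entries that increase degrees. *)
Lemma pencil_leading (m : multinom n) : (forall i, i \in early -> m i = 0%N) ->
  mcoeff m (\det pencil) = (m == mnm_muln (mnm1 i0) D)%:R.
Proof.
move=> hm.
pose t := [tuple (if i \in early then 0 else mpolyX K (mnm1 i)) | i < n].
have coef q : mcoeff m (comp_mpoly t q) = mcoeff m q.
  rewrite [in LHS](mpolyE q) [in RHS](mpolyE q).
  rewrite [comp_mpoly t _]raddf_sum !raddf_sum.
  apply: eq_bigr => a _ /=; rewrite comp_mpolyZ !mcoeffZ; congr (_ * _).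
  rewrite comp_mpolyX mcoeffX.
  have [/existsP[i /andP[ie ai]]|/existsPn ha] := boolP [exists i, (i \in early) && (a i != 0%N)].
    rewrite (bigD1 i) //= tnth_mktuple ie expr0n (negbTE ai) mul0r mcoeff0.
    by case: eqP => // am; move: ai; rewrite am hm.
  rewrite (eq_bigr (fun i => mpolyX K (mnm1 i) ^+ a i)).
    by rewrite -mpolyXE_id mcoeffX.
  move=> i _; rewrite tnth_mktuple; case: ifP => // ie.
  by have := ha i; rewrite ie /= negbK => /eqP ->; rewrite !expr0.
rewrite -coef -det_map_mx (det_graded (deg := deg)).
  have -> : \prod_x map_mx (comp_mpoly t) pencil x x = mpolyX K (mnm_muln (mnm1 i0) D).
    rewrite -mpolyXn -[D in RHS]card_ord -prodr_const; apply: eq_bigr => x _.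
    rewrite !mxE raddf_sum (bigD1 i0) //= big1 ?addr0.
      by rewrite comp_mpolyZ A1 mxE eqxx scale1r comp_mpolyXU -tnth_nth tnth_mktuple (negbTE i0_late).
    move=> i ii0; rewrite comp_mpolyZ comp_mpolyXU -tnth_nth tnth_mktuple.
    by case: ifP => ie; [rewrite scaler0|rewrite Alate ?ie // scale0r].
  by rewrite mcoeffX eq_sym.
move=> x y xy dxy; rewrite !mxE raddf_sum big1 // => i _.
rewrite /= comp_mpolyZ comp_mpolyXU -tnth_nth tnth_mktuple.
case: ifP => ie; first by rewrite scaler0.
have [->|ii0] := eqVneq i i0; first by rewrite A1 mxE (negbTE xy) scale0r.
by rewrite Alate ?ie // scale0r.
Qed.

End Pencil.

Section Codimension.
Variables (R : realType) (I : finType).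
Local Notation C := (Cplx R).
Local Notation pt := {ffun I -> C}.
Implicit Types (Z V : set pt).

(** The same set in the coordinates of multivariate polynomials. *)
Definition locus Z : ('I_#|I| -> C) -> Prop :=
  fun v => Z [ffun i => v (enum_rank i)].

Lemma meval_peval v (p : mpoly #|I| C) :
  meval v p = peval p [ffun i => v (enum_rank i)].
Proof. by apply: meval_eq => k; rewrite ffunE enum_valK. Qed.

Lemma locus_enum (z : pt) : [ffun i => (fun k => z (enum_val k)) (enum_rank i)] = z.
Proof. by apply/ffunP => i; rewrite ffunE enum_rankK. Qed.

Lemma vanishes_on_locus Z p : vanishes_on (locus Z) p <-> forall z, Z z -> peval p z = 0.
Proof.
split=> [h z Zz|h v Zv]; last by rewrite meval_peval; apply: h.
have := h (fun k => z (enum_val k)); rewrite meval_peval /locus locus_enum.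
by apply.
Qed.

Lemma irreducible_prime Z : irreducible_set Z -> prime_locus (locus Z).
Proof.
move=> [[S ZE] _ irr] p q pq.
pose Zp := [set z | Z z /\ peval p z = 0]; pose Zq := [set z | Z z /\ peval q z = 0].
have alg f : algebraic_set [set z | Z z /\ peval f z = 0].
  exists (S `|` [set f]); apply/seteqP; split=> z /=.
    rewrite {1}ZE => -[h1 h2] r [Sr|->//]; exact: h1.
  by move=> h; rewrite ZE; split; [move=> r Sr; apply: h; left|apply: h; right].
have [|||E|E] := irr Zp Zq.
- exact: alg.
- exact: alg.
- apply/seteqP; split=> z; last by case=> -[].
  move=> Zz; have /eqP := (vanishes_on_locus Z (p * q)).1 pq z Zz.
  by rewrite /peval mevalM mulf_eq0 => /orP[/eqP|/eqP] h; [left|right].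
- by left; apply/vanishes_on_locus => z; rewrite E => -[].
- by right; apply/vanishes_on_locus => z; rewrite E => -[].
Qed.

Lemma algebraic_separated Z Z' : algebraic_set Z -> Z `<` Z' ->
  exists2 p, vanishes_on (locus Z) p & ~ vanishes_on (locus Z') p.
Proof.
move=> [S ZE] [_ nsub].
have [p [Sp hp]] : exists p, S p /\ ~ vanishes_on (locus Z') p.
  apply: contrapT => /forallNP h; apply: nsub => z Z'z; rewrite ZE /= => p Sp.
  have := h p; rewrite not_andP => -[//|/contrapT/vanishes_on_locus]; exact.
by exists p => //; apply/vanishes_on_locus => z; rewrite ZE; apply.
Qed.

Variables (V : set pt) (k : nat) (g : 'I_k -> pt) (piv : 'I_k -> I).
Variables (D : 'I_k -> nat) (A : forall l, pt -> 'M[C]_(D l))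
  (deg : forall l, 'I_(D l) -> nat).
Hypothesis piv_neq0 : forall l, g l (piv l) != 0.
Hypothesis piv_eq0 : forall l l', l != l' -> g l (piv l') = 0.
Hypothesis A_linear : forall l n (c : 'I_n -> C) (z : 'I_n -> pt),
  A l [ffun i => \sum_q c q * z q i] = \sum_q c q *: A l (z q).
Hypothesis A_diag : forall l, A l (g l) = 1%:M.
Hypothesis A_graded : forall l l' : 'I_k, (l < l')%N -> forall x y : 'I_(D l),
  (deg y <= deg x)%N -> A l (g l') x y = 0.
Hypothesis V_det : forall z, V z -> forall l, \det (A l z) = 0.

(** Linear coordinates in which the [g l] are coordinate vectors. *)
Definition basis_vec (q : 'I_#|I|) : pt :=
  if [pick l | piv l == enum_val q] is Some l then g l
  else [ffun i => (i == enum_val q)%:R].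

Definition linear_chart (v : 'I_#|I| -> C) : pt :=
  [ffun i => \sum_q v q * basis_vec q i].

Lemma piv_inj : injective piv.
Proof.
move=> l l' E; apply/eqP/negPn/negP => ll'.
by have := piv_neq0 l; rewrite E piv_eq0 ?eqxx.
Qed.

Lemma basis_vec_piv l : basis_vec (enum_rank (piv l)) = g l.
Proof.
rewrite /basis_vec enum_rankK; case: pickP => [l' /eqP/piv_inj -> //|/(_ l)].
by rewrite eqxx.
Qed.

Lemma linear_chart_onto z : exists v, linear_chart v = z.
Proof.
pose cf l := z (piv l) / g l (piv l).
pose v (q : 'I_#|I|) := if [pick l | piv l == enum_val q] is Some l then cf l
  else z (enum_val q) - \sum_l cf l * g l (enum_val q).
exists v; apply/ffunP => i; rewrite ffunE.
rewrite (reindex (@enum_rank I)) /=; last first.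
  by exists enum_val => j _; rewrite ?enum_rankK ?enum_valK.
rewrite (bigID (mem [set piv l | l : 'I_k]%SET)) /= big_imset /=; last first.
  by move=> l l' _ _; exact: piv_inj.
have -> : \sum_(l in predT) v (enum_rank (piv l)) * basis_vec (enum_rank (piv l)) i =
    \sum_l cf l * g l i.
  apply: eq_bigr => l _; rewrite basis_vec_piv /v enum_rankK.
  by case: pickP => [l' /eqP/piv_inj -> //|/(_ l)]; rewrite eqxx.
have npiv j : j \notin [set piv l | l : 'I_k]%SET -> [pick l | piv l == j] = None.
  move=> hj; case: pickP => // l /eqP lj.
  by case/negP: hj; apply/imsetP; exists l.
have -> : \sum_(j | j \notin [set piv l | l : 'I_k]%SET)
     v (enum_rank j) * basis_vec (enum_rank j) i =
   \sum_(j | j \notin [set piv l | l : 'I_k]%SET)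
     (z j - \sum_l cf l * g l j) * (i == j)%:R.
  apply: eq_bigr => j hj; rewrite /v /basis_vec !enum_rankK npiv //.
  by rewrite ffunE.
have [/imsetP[l0 _ iE]|hi] := boolP (i \in [set piv l | l : 'I_k]%SET).
  rewrite [X in _ + X]big1 ?addr0; last first.
    move=> j hj; case: eqP => [ij|_]; last by rewrite mulr0.
    by case/negP: hj; apply/imsetP; exists l0; rewrite -?ij.
  rewrite iE (bigD1 l0) //= big1 ?addr0.
    by rewrite /cf divfK.
  by move=> l ll0; rewrite piv_eq0 ?mulr0.
rewrite (bigD1 i) //= eqxx mulr1 [X in _ + (_ + X)]big1 ?addr0.
  by rewrite addrC subrK.
by move=> j /andP[_ /negbTE ji]; rewrite eq_sym ji mulr0.
Qed.

Lemma eval_chart l v : \sum_q v q *: A l (basis_vec q) = A l (linear_chart v).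
Proof. by rewrite -A_linear. Qed.

Definition chart_locus (v : 'I_#|I| -> C) := V (linear_chart v).

Let pivots : {pred 'I_#|I|} := [pred q | [exists l, enum_rank (piv l) == q]].
Let bound : nat := \max_l D l.
Let weight (q : 'I_#|I|) : nat :=
  if [pick l | enum_rank (piv l) == q] is Some l then (bound.+1 ^ (k - l.+1))%N
  else (bound.+1 ^ k)%N.

Let weight_piv l : weight (enum_rank (piv l)) = (bound.+1 ^ (k - l.+1))%N.
Proof.
rewrite /weight; case: pickP => [l' /eqP/enum_rank_inj/piv_inj -> //|/(_ l)].
by rewrite eqxx.
Qed.

Let card_pivots : #|pivots| = k.
Proof.
rewrite -[RHS]card_ord -(card_imset _ (inj_comp enum_rank_inj piv_inj)).
apply: eq_card => q; rewrite !inE; apply/existsP/imsetP => [[l /eqP <-]|[l _ ->]].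
  by exists l.
by exists l.
Qed.

(** The determinants of the [A l] vanish on [V], and each is a power of a pivot
    coordinate plus monomials that involve an earlier coordinate; the weights
    decrease so fast along the pivots that these monomials are heavier. *)
Let chart_rewriting : has_rewriting chart_locus pivots bound weight.
Proof.
move=> q /existsP[l /eqP <-].
pose early : {pred 'I_#|I|} := [pred q | ~~ [exists l' : 'I_k, (l <= l')%N && (enum_rank (piv l') == q)]].
pose B q := A l (basis_vec q).
have late : enum_rank (piv l) \notin early.
  by rewrite inE negbK; apply/existsP; exists l; rewrite leqnn eqxx.
have B1 : B (enum_rank (piv l)) = 1%:M by rewrite /B basis_vec_piv A_diag.
have Blate q' : q' \notin early -> q' != enum_rank (piv l) -> forall x y : 'I_(D l),
    (deg y <= deg x)%N -> B q' x y = 0.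
  rewrite inE negbK => /existsP[l' /andP[ll' /eqP <-]] ne x y xy.
  rewrite /B basis_vec_piv; apply: A_graded xy.
  rewrite ltn_neqAle ll' andbT; apply: contraNneq ne => /val_inj ->.
  by rewrite eqxx.
exists (\det (pencil B)), (D l); split.
- exact: (leq_bigmax l).
- by move=> v Vv; rewrite meval_pencil eval_chart; exact: V_det.
- rewrite (pencil_leading B1 late Blate) ?eqxx //; move=> q' q'e.
  rewrite mulmnE mnm1E; case: eqP => // E.
  by move: late; rewrite E q'e.
move=> m; rewrite mcoeff_msupp => hm ne.
have dm : mdeg m = D l.
  by apply/eqP/negPn/negP => /(pencil_hom_deg B) h; rewrite h eqxx in hm.
split=> //.
have [q' q'e mq'] : exists2 q', q' \in early & m q' != 0%N.
  apply: contrapT => h; case/negP: hm; rewrite (pencil_leading B1 late Blate).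
    by rewrite (negbTE ne).
  by move=> q' q'e; apply/eqP/negPn/negP => mq'; apply: h; exists q'.
apply: (@leq_trans (weight q')); last first.
  rewrite /mweight_of (bigD1 q') //=; apply: leq_trans (leq_addr _ _).
  by rewrite leq_pmull // lt0n.
rewrite weight_piv; apply: (@leq_trans (bound.+1 ^ (k - l))%N).
  have -> : (k - l = (k - l.+1).+1)%N by have := ltn_ord l; lia.
  rewrite expnS ltn_pmul2r ?expn_gt0 // ltnS.
  exact: (leq_bigmax l).
rewrite /weight; case: pickP => [l' /eqP E|_]; last by apply: leq_pexp2l; rewrite ?leq_subr.
apply: leq_pexp2l => //; move: q'e; rewrite inE => /existsPn /(_ l').
rewrite E eqxx andbT -ltnNge => h; by have := ltn_ord l; lia.
Qed.

(** A chain of length [d] gives [d] algebraically independent functions on [V],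
    whereas the equations [\det (A l z) = 0] make the coordinates along the [g l]
    integral over the others, one after the other. *)
Theorem chain_length_bound d : irreducible_chain V d -> (d + k <= #|I|)%N.
Proof.
move=> [Z [Zirr Zlt]]; rewrite leqNgt; apply/negP => ltI.
have [|||f hf] := @chain_algebraic_independence C #|I| d (fun i => locus (Z i)).
- have [[_ [z Zz] _] _] := Zirr 0%N (leq0n _).
  by exists (fun k => z (enum_val k)); rewrite /locus locus_enum.
- by move=> i id; apply: irreducible_prime; have [] := Zirr i id.
- move=> i id; have [sub nsub] := Zlt i id; split; first by move=> v; exact: sub.
  apply: algebraic_separated; last by split.
  by have [[]] := Zirr i (ltnW id).
pose lin (r : 'I_#|I|) : mpoly #|I| C :=
  \sum_q basis_vec q (enum_val r) *: mpolyX C (mnm1 q).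
have linE v r : meval v (lin r) = linear_chart v (enum_val r).
  rewrite ffunE raddf_sum; apply: eq_bigr => q _.
  by rewrite /= mevalZ mevalXU mulrC.
have [|P P0 hP] := @algebraic_dependence C #|I| chart_locus pivots bound weight
  chart_rewriting d (fun i => comp_mpoly [tuple lin r | r < #|I|] (f i)).
  by rewrite card_pivots.
case/eqP: P0; apply: hf => v Zv.
have [_ ZV] := Zirr d (leqnn d).
have [u uE] := linear_chart_onto [ffun i => v (enum_rank i)].
rewrite -[RHS](hP u); last by rewrite /chart_locus uE; apply: ZV.
apply: meval_eq => i; rewrite comp_mpoly_meval; apply: meval_eq => r.
by rewrite tnth_mktuple linE uE ffunE enum_valK.
Qed.

End Codimension.

(** * A Nullstellensatz for modules *)

(** Otherwise [C] would be a countable union of finite sets, and the unit interval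
    would have measure zero. *)
Lemma uncountable_fibre (R : realType) (F : Cplx R -> nat) :
  exists d, forall s : seq (Cplx R), exists2 a, a \notin s & F a = d.
Proof.
apply: contrapT => h.
have /choice[s hs] d : exists s : seq (Cplx R), forall a, F a = d -> a \in s.
  have /forallNP/(_ d) /existsNP[s hs] := h; exists s => a Fa.
  by apply: contrapT => /negP as_; apply: hs; exists a.
have cR : countable (\bigcup_(d in [set: nat]) [set r : R | ofR r \in s d]).
  apply: bigcup_countable => // d _.
  apply: (@sub_countable _ _ _ [set` [seq complex.Re a | a <- s d]]).
    apply: subset_card_le => r /= rs; apply/mapP; exists (ofR r) => //.
  exact: finite_set_countable.
have [m1 m2] : @lebesgue_measure R `[0, 1]%classic = 0%E /\
    @lebesgue_measure R `[0, 1]%classic = 1%E.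
  split; last by rewrite lebesgue_measure_itv /= lte_fin ltr01 oppr0 adde0.
  apply: countable_lebesgue_measure0; apply: sub_countable cR.
  apply: subset_card_le => r _; exists (F (ofR r)) => //=; exact: hs.
by move: m2; rewrite m1 => -[] /eqP; rewrite eq_sym oner_eq0.
Qed.

Lemma Cplx_closed (R : realType) (p : {poly Cplx R}) :
  exists r : seq (Cplx R), p = lead_coef p *: \prod_(a <- r) ('X - a%:P).
Proof. by have [r rE] := closed_field_poly_normal (p : {poly R[i]}); exists r. Qed.

Section Nullstellensatz.
Variables (K : fieldType) (n : nat).
Local Notation P := (mpoly n K).

Hypothesis K_closed : forall p : {poly K}, exists r : seq K,
  p = lead_coef p *: \prod_(a <- r) ('X - a%:P).

(** A form of uncountability: every map to [nat] has an infinite fibre. *)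
Hypothesis K_uncountable : forall F : K -> nat,
  exists d, forall s : seq K, exists2 a, a \notin s & F a = d.

Definition is_ideal (I : P -> Prop) :=
  [/\ I 0, forall p q, I p -> I q -> I (p + q) & forall p q, I q -> I (p * q)].

Lemma ideal_sum I (T : Type) (s : seq T) (Q : pred T) (F : T -> P) : is_ideal I ->
  (forall i, I (F i)) -> I (\sum_(i <- s | Q i) F i).
Proof. by move=> [h0 hD _] h; elim/big_rec: _ => // i x _; exact: hD. Qed.

Lemma idealB I p q : is_ideal I -> I p -> I q -> I (p - q).
Proof. by move=> [h0 hD hM] hp hq; rewrite -mulN1r; apply: hD => //; exact: hM. Qed.

Definition adjoin (I : P -> Prop) (g : P) : P -> Prop :=
  fun f => exists q, I (f - q * g).

Lemma adjoin_ideal I g : is_ideal I -> is_ideal (adjoin I g).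
Proof.
move=> [h0 hD hM]; split.
- by exists 0; rewrite mul0r subrr.
- move=> p q [a ha] [b hb]; exists (a + b).
  by rewrite mulrDl opprD addrACA; exact: hD.
- move=> p q [a ha]; exists (p * a).
  by rewrite -mulrA -mulrBr; exact: hM.
Qed.

Lemma adjoin_sub I g f : is_ideal I -> I f -> adjoin I g f.
Proof. by move=> _ If; exists 0; rewrite ?mul0r ?subr0. Qed.

Lemma adjoin_mem I g : is_ideal I -> adjoin I g g.
Proof. by move=> [h0 _ _]; exists 1; rewrite mul1r subrr. Qed.

Lemma ideal_trans I f g h : is_ideal I -> I (f - g) -> I (g - h) -> I (f - h).
Proof. by move=> [_ hD _] h1 h2; rewrite -(subrKA g); exact: hD. Qed.

Local Notation Xv i := (mpolyX K (mnm1 i)).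

(** If all the [Xv i - a] were invertible modulo [I], uncountably many inverses
    would exist with the same degree bound; a linear relation among them gives a
    nonzero univariate polynomial in [Xv i] belonging to [I], a product of
    invertible factors. *)
Lemma adjoin_root I i : is_ideal I -> ~ I 1 ->
  exists a : K, ~ adjoin I (Xv i - mpolyC n a) 1.
Proof.
move=> idI I1; have [h0 hD hM] := idI; apply: contrapT => /forallNP h.
have /choice[q hq] (a : K) : exists q, I (1 - q * (Xv i - mpolyC n a)).
  by have /contrapT[q hq] := h a; exists q.
have [d hd] := K_uncountable (fun a => msize (q a)).
pose D := #|{: bmultinom n d}|.
have [s [us sz sd]] : exists s : seq K,
    [/\ uniq s, size s = D.+1 & forall a, a \in s -> msize (q a) = d].
  elim: D.+1 => [|k [s [us sk sd]]]; first by exists [::].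
  have [a as_ qa] := hd s; exists (a :: s); split; rewrite /= ?as_ ?us ?sk //.
  by move=> b; rewrite in_cons => /orP[/eqP ->|/sd].
pose A := \matrix_(k < D.+1, j < D) mcoeff (bmnm (enum_val j)) (q (nth 0 s k)).
have : \rank (kermx A) != 0%N.
  by rewrite mxrank_ker subn_eq0 -ltnNge ltnS rank_leq_col.
rewrite mxrank_eq0 => /rowV0Pn[c /sub_kermxP cA c0].
have [k0 k0P] : exists k : 'I_D.+1, c 0 k != 0.
  apply/existsP; move: c0; apply: contraNT => /existsPn hc.
  by apply/eqP/rowP => k; rewrite mxE; apply/eqP; rewrite -[_ == _]negbK hc.
have rel : \sum_k c 0 k *: q (nth 0 s k) = 0.
  apply/mpolyP => m; rewrite mcoeff0 raddf_sum /=.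
  have [md|md] := ltnP (mdeg m) d; last first.
    apply: big1 => k _; rewrite mcoeffZ memN_msupp_eq0 ?mulr0 //.
    by apply: msize_mdeg_ge; rewrite sd // mem_nth // sz.
  have /rowP/(_ (enum_rank (BMultinom md))) := cA; rewrite !mxE => E.
  by rewrite -[RHS]E; apply: eq_bigr => k _; rewrite mxE enum_rankK mcoeffZ.
pose Y k := Xv i - mpolyC n (nth 0 s k).
pose hX := \sum_(k < D.+1) c 0 k *: \prod_(l < D.+1 | l != k) Y l.
have IhX : I hX.
  have : I (hX - (\prod_(l < D.+1) Y l) * \sum_(k < D.+1) c 0 k *: q (nth 0 s k)).
    rewrite /hX mulr_sumr -sumrB; apply: ideal_sum => // k.
    rewrite [\prod_(l < D.+1) Y l](bigD1 k) //=.
    have -> : c 0 k *: \prod_(l < D.+1 | l != k) Y l -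
        Y k * (\prod_(l < D.+1 | l != k) Y l) * (c 0 k *: q (nth 0 s k)) =
      (c 0 k *: \prod_(l < D.+1 | l != k) Y l) * (1 - q (nth 0 s k) * Y k).
      rewrite -!mul_mpolyC; ring.
    by apply: hM; exact: hq.
  by rewrite rel mulr0 subr0.
pose hx : {poly K} := \sum_(k < D.+1) (c 0 k)%:P * \prod_(l < D.+1 | l != k) ('X - (nth 0 s l)%:P).
have hx0 : hx != 0.
  apply/eqP => E; have := congr1 (fun u : {poly K} => u.[nth 0 s k0]) E.
  rewrite horner0 horner_sum (bigD1 k0) //= [X in _ + X = _]big1 ?addr0.
    rewrite hornerCM horner_prod => /eqP; rewrite mulf_eq0 (negbTE k0P) /=.
    rewrite prodf_seq_eq0 => /hasP[l _ /andP[lk]].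
    rewrite hornerXsubC subr_eq0 nth_uniq ?sz // => /eqP/val_inj E'.
    by rewrite E' eqxx in lk.
  move=> k kk0; rewrite hornerCM horner_prod (bigD1 k0) ?[k0 == k]eq_sym //=.
  by rewrite hornerXsubC subrr mul0r mulr0.
have [r rE] := K_closed hx.
have lead0 : lead_coef hx != 0 by rewrite lead_coef_eq0.
pose ev (u : {poly K}) : P := (map_poly (@mpolyC n K) u).[Xv i].
have evM u1 u2 : ev (u1 * u2) = ev u1 * ev u2 by rewrite /ev rmorphM hornerM.
have evX (a : K) : ev ('X - a%:P) = Xv i - mpolyC n a.
  by rewrite /ev rmorphB /= map_polyX map_polyC hornerD hornerN hornerX hornerC.
have ev1 : ev 1 = 1 by rewrite /ev rmorph1 hornerC.
have evC (a : K) : ev a%:P = mpolyC n a by rewrite /ev map_polyC hornerC.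
have evE : ev hx = hX.
  rewrite /hx /hX /ev rmorph_sum horner_sum; apply: eq_bigr => k _.
  rewrite -/(ev _) evM evC mul_mpolyC; congr (_ *: _).
  rewrite (big_morph ev evM ev1); apply: eq_bigr => l _; exact: evX.
have inv (z : seq K) : exists Q, I (1 - Q * ev (\prod_(a <- z) ('X - a%:P))).
  elim: z => [|a z [Q hQ]]; first by exists 1; rewrite big_nil ev1 mul1r subrr.
  exists (Q * q a); rewrite big_cons evM evX.
  set e := ev _ in hQ *; apply: (@ideal_trans I _ (Q * e)) => //.
  have -> : Q * e - Q * q a * ((Xv i - mpolyC n a) * e) =
     (Q * e) * (1 - q a * (Xv i - mpolyC n a)) by ring.
  exact: hM.
have [Q hQ] := inv r.
apply: I1; rewrite -(subrK (Q * ev (\prod_(a <- r) ('X - a%:P))) 1).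
apply: (hD) => //; apply: (hM).
have e1 : ev hx = mpolyC n (lead_coef hx) * ev (\prod_(a <- r) ('X - a%:P)).
  by rewrite -evC -evM mul_polyC {1}rE.
have -> : ev (\prod_(a <- r) ('X - a%:P)) = mpolyC n (lead_coef hx)^-1 * hX.
  by rewrite -evE e1 mulrA -mpolyCM mulVf // mpolyC1 mul1r.
exact: hM.
Qed.

(** Adjoin to the ideal some [Xv i - a i], for one variable after the other. *)
Lemma weak_nullstellensatz I : is_ideal I -> ~ I 1 ->
  exists v : 'I_n -> K, forall f, I f -> meval v f = 0.
Proof.
move=> idI I1.
have [I' [idI' I'1 sub /choice[v hv]]] : exists I', [/\ is_ideal I', ~ I' 1,
    forall f, I f -> I' f &
    forall i, exists a : K, I' (Xv i - mpolyC n a)].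
  suff [I' [h1 h2 h3 h4]] : exists I', [/\ is_ideal I', ~ I' 1, forall f, I f -> I' f &
      forall i, i \in enum 'I_n -> exists a : K, I' (Xv i - mpolyC n a)].
    by exists I'; split => // i; apply: h4; rewrite mem_enum.
  elim: (enum 'I_n) => [|i s [I' [h1 h2 h3 h4]]]; first by exists I.
  have [a ha] := adjoin_root i h1 h2.
  exists (adjoin I' (Xv i - mpolyC n a)); split=> //.
  - exact: adjoin_ideal.
  - by move=> f /h3; exact: adjoin_sub.
  - move=> j; rewrite in_cons => /orP[/eqP ->|/h4[b hb]].
      by exists a; exact: adjoin_mem.
    by exists b; exact: adjoin_sub.
have [h0 hD hM] := idI'.
have val f : I' (f - mpolyC n (meval v f)).
  have valM f1 f2 : I' (f1 - mpolyC n (meval v f1)) -> I' (f2 - mpolyC n (meval v f2)) ->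
      I' (f1 * f2 - mpolyC n (meval v (f1 * f2))).
    move=> e1 e2; rewrite mevalM mpolyCM.
    set c1 := mpolyC n _ in e1 *; set c2 := mpolyC n _ in e2 *.
    have -> : f1 * f2 - c1 * c2 = f2 * (f1 - c1) + c1 * (f2 - c2) by ring.
    by apply: (hD); exact: hM.
  elim/mpolyind: f => [|c m f _ _ IH]; first by rewrite meval0 mpolyC0 subrr.
  rewrite mevalD mpolyCD opprD addrACA; apply: (hD) => //.
  rewrite -mul_mpolyC; apply: (valM); first by rewrite mevalC subrr.
  rewrite mpolyXE_id.
  apply: (big_ind (fun g => I' (g - mpolyC n (meval v g)))) => [||i _].
  - by rewrite meval1 mpolyC1 subrr.
  - exact: valM.
  elim: (m i) => [|k IHk]; first by rewrite expr0 meval1 mpolyC1 subrr.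
  by rewrite exprS; apply: (valM) => //; rewrite mevalXU; exact: hv.
exists v => f If; apply/eqP/negPn/negP => fv; apply: I'1.
have : I' (mpolyC n (meval v f)).
  by have := idealB idI' (sub f If) (val f); rewrite opprB addrC subrK.
by move=> /(hM (mpolyC n (meval v f)^-1)); rewrite -mpolyCM mulVf // mpolyC1.
Qed.

Section Modules.
Variables (L J : finType) (t : L -> J -> P).

(** The ideal of the polynomials that multiply every vector into the submodule
    spanned by the [t l]. *)
Definition annihilates (f : P) := forall j0, exists v : L -> P,
  forall j, \sum_l v l * t l j = (j0 == j)%:R * f.

Lemma annihilates_ideal : is_ideal annihilates.
Proof.
split.
- by move=> j0; exists (fun _ => 0) => j; rewrite mulr0 big1 // => l _; rewrite mul0r.
- move=> p q hp hq j0; have [v hv] := hp j0; have [w hw] := hq j0.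
  exists (fun l => v l + w l) => j; rewrite mulrDr -hv -hw -big_split.
  by apply: eq_bigr => l _; rewrite mulrDl.
- move=> p q hq j0; have [v hv] := hq j0; exists (fun l => p * v l) => j.
  rewrite mulrCA -hv mulr_sumr; apply: eq_bigr => l _.
  by rewrite mulrA.
Qed.

(** Cramer's rule: a minor not vanishing at [v] annihilates the quotient. *)
Lemma annihilates_minor (v : 'I_n -> K) :
  (forall N : J -> K, (forall l, \sum_j N j * meval v (t l j) = 0) -> forall j, N j = 0) ->
  exists2 f, annihilates f & meval v f != 0.
Proof.
move=> surj.
pose M : 'M[K]_(#|L|, #|J|) := \matrix_(l, j) meval v (t (enum_val l) (enum_val j)).
have Mfull : row_full M.
  rewrite /row_full -mxrank_tr -[_ == _]/(row_free M^T) -kermx_eq0.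
  apply/rowV0P => u /sub_kermxP uM.
  apply/rowP => k; rewrite mxE.
  have := surj (fun j => u 0 (enum_rank j)).
  have -> : u 0 k = u 0 (enum_rank (enum_val k)) by rewrite enum_valK.
  apply=> l; have /rowP/(_ (enum_rank l)) := uM; rewrite !mxE => E.
  rewrite -[RHS]E.
  rewrite (reindex (@enum_val J predT)) /=; last first.
    by exists enum_rank => j _; rewrite ?enum_valK ?enum_rankK.
  by apply: eq_bigr => j _; rewrite !mxE enum_rankK enum_valK.
pose s := fullrankfun Mfull.
pose T : 'M[P]_#|J| := \matrix_(i, j) t (enum_val (s i)) (enum_val j).
exists (\det T).
  move=> j0; exists (fun l => \sum_(i | enum_val (s i) == l) (\adj T) (enum_rank j0) i) => j.
  have := mul_adj_mx T => /matrixP /(_ (enum_rank j0) (enum_rank j)).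
  rewrite !mxE (inj_eq enum_rank_inj) => E; rewrite mulr_natl -E.
  under eq_bigr => l _ do rewrite mulr_suml.
  rewrite [RHS](partition_big (fun i => enum_val (s i)) predT) //=.
  apply: eq_bigr => l _; apply: eq_bigr => i /eqP <-.
  by congr (_ * _); rewrite mxE enum_rankK.
rewrite -det_map_mx -unitfE -unitmxE.
have -> : map_mx (meval v) T = rowsub s M.
  by apply/matrixP => i j; rewrite !mxE.
exact: fullrowsub_unit.
Qed.

(** At each zero of [Xv i - 1] some annihilator does not vanish, so that the
    annihilators and [Xv i - 1] generate the unit ideal. *)
Lemma annihilates_mod (i : 'I_n) :
  (forall v : 'I_n -> K, v i = 1 ->
    forall N : J -> K, (forall l, \sum_j N j * meval v (t l j) = 0) -> forall j, N j = 0) ->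
  exists f q, annihilates f /\ f = 1 + (Xv i - 1) * q.
Proof.
move=> surj; have idA := annihilates_ideal.
have [[q hq]|] := pselect (adjoin annihilates (Xv i - 1) 1).
  exists (1 - q * (Xv i - 1)), (- q); split=> //; ring.
move=> /(weak_nullstellensatz (adjoin_ideal _ idA)) [v hv].
have vi : v i = 1.
  have := hv _ (adjoin_mem (Xv i - 1) idA); rewrite mevalB mevalXU meval1.
  by move/eqP; rewrite subr_eq0 => /eqP.
have [f fA] := annihilates_minor (surj v vi).
by rewrite hv ?eqxx //; exact: adjoin_sub.
Qed.

(** ** Homogeneous generators *)

Variables (dg : L -> nat).
Hypothesis t_hom : forall l j, hom_deg (dg l) (t l j).

Definition hom_part k (p : P) : P := pihomog mdeg k p.

Lemma mcoeff_hom_part k p m : mcoeff m (hom_part k p) = if mdeg m == k then mcoeff m p else 0.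
Proof.
rewrite /hom_part pihomogE raddf_sum big_mkcond /=.
have -> : mcoeff m p = \sum_(a <- msupp p) mcoeff m (mcoeff a p *: mpolyX K a).
  by rewrite [in LHS](mpolyE p) raddf_sum.
case: ifP => mk; last first.
  rewrite big1 // => a _; case: ifP => // ak; rewrite mcoeffZ mcoeffX.
  by case: (a =P m) => [am|_]; [rewrite -am ak in mk|rewrite mulr0].
apply: eq_bigr => a _; case: ifP => // ak; rewrite mcoeffZ mcoeffX.
by case: (a =P m) => [am|_]; [rewrite am mk in ak|rewrite mulr0].
Qed.

Lemma hom_part_hom k p : hom_deg k (hom_part k p).
Proof. by move=> m /negbTE mk; rewrite mcoeff_hom_part mk. Qed.

Lemma hom_part_id k p : hom_deg k p -> hom_part k p = p.
Proof.
move=> hp; apply/mpolyP => m; rewrite mcoeff_hom_part.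
by case: ifP => // /negbT /hp ->.
Qed.

Lemma hom_part_other k e p : hom_deg e p -> e != k -> hom_part k p = 0.
Proof.
move=> hp ek; apply/mpolyP => m; rewrite mcoeff_hom_part mcoeff0.
by case: ifP => // /eqP mk; apply: hp; rewrite mk eq_sym.
Qed.

Lemma hom_partD k p q : hom_part k (p + q) = hom_part k p + hom_part k q.
Proof. exact: raddfD. Qed.

Lemma hom_partZ k c p : hom_part k (c *: p) = c *: hom_part k p.
Proof. exact: linearZ. Qed.

Lemma hom_part_sum k (I : Type) (s : seq I) (F : I -> P) :
  hom_part k (\sum_(i <- s) F i) = \sum_(i <- s) hom_part k (F i).
Proof. exact: raddf_sum. Qed.

Lemma hom_partM k e p q : hom_deg e q ->
  hom_part k (p * q) = (if (e <= k)%N then hom_part (k - e) p else 0) * q.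
Proof.
move=> hq; elim/mpolyind: p => [|c m p _ _ IH].
  by case: ifP => _; rewrite ?mul0r /hom_part !raddf0 ?mul0r.
rewrite mulrDl hom_partD IH -scalerAl hom_partZ.
have -> : (if (e <= k)%N then hom_part (k - e) (c *: mpolyX K m + p) else 0) =
  c *: (if (e <= k)%N then hom_part (k - e) (mpolyX K m) else 0) +
  (if (e <= k)%N then hom_part (k - e) p else 0).
  by case: ifP => _; rewrite ?hom_partD ?hom_partZ // scaler0 addr0.
rewrite mulrDl -scalerAl; congr (_ *: _ + _).
have hmq := hom_degM (@hom_degX K n m) hq.
have [mk|mk] := eqVneq (mdeg m + e)%N k.
  rewrite hom_part_id; last by rewrite -mk.
  by rewrite -mk leq_addl addnK hom_part_id //; exact: hom_degX.
rewrite (hom_part_other hmq mk); case: ifP => ek; last by rewrite mul0r.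
rewrite (hom_part_other (@hom_degX K n m)) ?mul0r //.
by apply: contra mk => /eqP ->; rewrite subnK.
Qed.

(** Taking homogeneous parts of the coefficients. *)
Lemma hom_combination k (w : J -> P) (v : L -> P) :
  (forall j, \sum_l v l * t l j = w j) ->
  forall j, \sum_l (if (dg l <= k)%N then hom_part (k - dg l) (v l) else 0) * t l j =
     hom_part k (w j).
Proof.
move=> h j; rewrite -h hom_part_sum; apply: eq_bigr => l _.
by rewrite (hom_partM _ _ (@t_hom l j)).
Qed.

Lemma annihilates_hom_part k f : annihilates f -> annihilates (hom_part k f).
Proof.
move=> hf j0; have [v hv] := hf j0.
exists (fun l => if (dg l <= k)%N then hom_part (k - dg l) (v l) else 0) => j.
rewrite (hom_combination k hv); case: (j0 == j); rewrite ?mul1r ?mul0r //.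
exact: raddf0.
Qed.

(** Homogenisation with respect to the variable [i]: it kills the multiples of
    [X i - 1], hence turns [1 + (X i - 1) * q] into a power of [X i]. *)
Lemma annihilates_power (i : 'I_n) f q : annihilates f -> f = 1 + (Xv i - 1) * q ->
  exists d0, forall d, (d0 <= d)%N -> annihilates (Xv i ^+ d).
Proof.
move=> hf fE; exists (msize q).+1 => d dq.
pose H (p : P) := \sum_(k < d.+1) Xv i ^+ (d - k) * hom_part k p.
have HD p1 p2 : H (p1 + p2) = H p1 + H p2.
  by rewrite /H -big_split; apply: eq_bigr => k _; rewrite hom_partD mulrDr.
have HZ c p : H (c *: p) = c *: H p.
  by rewrite /H scaler_sumr; apply: eq_bigr => k _; rewrite hom_partZ scalerAr.
have HX m : (mdeg m <= d)%N -> H (mpolyX K m) = Xv i ^+ (d - mdeg m) * mpolyX K m.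
  move=> md; rewrite /H (bigD1 (Ordinal (md : (mdeg m < d.+1)%N))) //=.
  rewrite hom_part_id; last exact: hom_degX.
  rewrite big1 ?addr0 // => k; rewrite -val_eqE /= => km.
  by rewrite (hom_part_other (@hom_degX K n m)) ?mulr0 // eq_sym.
have idA := annihilates_ideal; have [h0 hD hM] := idA.
have -> : Xv i ^+ d = H f.
  have -> : H f = H 1 + H ((Xv i - 1) * q) by rewrite fE HD.
  have -> : H 1 = Xv i ^+ d.
    by rewrite -mpolyX0 HX ?mdeg0 // subn0 mpolyX0 mulr1.
  suff -> : H ((Xv i - 1) * q) = 0 by rewrite addr0.
  rewrite (mpolyE q) mulr_sumr.
  have Hsum (s : seq (multinom n)) (F : multinom n -> P) :
      H (\sum_(a <- s) F a) = \sum_(a <- s) H (F a).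
    elim: s => [|a s IH]; last by rewrite !big_cons HD IH.
    rewrite !big_nil /H big1 // => k _.
    by rewrite [hom_part _ _]raddf0 mulr0.
  rewrite Hsum big_seq big1 // => a aq.
  have ad : (mdeg a < d)%N.
    by apply: leq_trans dq; apply: leqW; exact: msize_mdeg_lt.
  rewrite -scalerAr HZ mulrBl mul1r -mpolyXD -scaleN1r HD HZ !HX ?(ltnW ad) //; last first.
    by rewrite mdegD mdeg1 add1n.
  rewrite mdegD mdeg1 add1n mpolyXD mulrA -exprSr scaleN1r.
  have -> : (d - (mdeg a).+1).+1 = (d - mdeg a)%N by lia.
  by rewrite subrr scaler0.
apply: ideal_sum => // k; apply: hM.
exact: annihilates_hom_part.
Qed.

End Modules.
End Nullstellensatz.

(** * Generic linear spaces of matrices *)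

Section GenericPencil.
Variables (R : realType) (N m n : nat).
Local Notation C := (Cplx R).
Local Notation I := ('I_N * ('I_m * 'I_n))%type.

(** A bounded polynomial has small coefficients, by the Cauchy estimates. *)
Lemma nonvanishing_point d (p : mpoly d C) : p != 0 -> exists v, meval v p != 0.
Proof.
move=> p0; apply: contrapT => /forallNP h; case/eqP: p0; apply/mpolyP => a.
rewrite mcoeff0; apply: cabs_eq0; apply/eqP; rewrite eq_le cabs_ge0 andbT.
have := @cauchy_estimate R d p 1 0 a ltr01; rewrite expr1n mulr1; apply => x _.
by have /negP/negPn/eqP -> := h x; rewrite cabs0.
Qed.

(** For [M = \sum_i y i *: Lam i], the matrices [U] with [U M = 0] and [M U = 0]
    form the annihilator, for the trace form, of the tangent space at [M] of the
    matrices of the same rank: at each of its points, the span of the [Lam i]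
    with [y i != 0] is transversal to the matrices of fixed rank. *)
Definition transversal (Lam : 'I_N -> 'M[C]_(m, n)) :=
  forall (y : 'I_N -> C) (U : 'M[C]_(n, m)), (exists i, y i != 0) ->
    U *m (\sum_i y i *: Lam i) = 0 -> (\sum_i y i *: Lam i) *m U = 0 ->
    (forall i, y i != 0 -> \tr (U *m Lam i) = 0) -> U = 0.

(** A matrix of rank [k] is determined by an invertible [k x k] block [c] and
    by two matrices [X] and [Y] that extend identity blocks. *)
Lemma rank_factorization (U : 'M[C]_(n, m)) : U != 0 ->
  exists k (f : 'I_k -> 'I_n) (g : 'I_k -> 'I_m) (X : 'M[C]_(n, k)) (c : 'M[C]_k)
    (Y : 'M[C]_(k, m)),
  [/\ (k <= n)%N /\ (0 < k)%N, injective f /\ injective g, U = X *m c *m Y,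
      rowsub f X = 1%:M /\ colsub g Y = 1%:M & c \in unitmx].
Proof.
move=> U0; pose k := \rank U; pose f := maxrankfun U.
pose F := rowsub f U.
have Ffree : row_free F := maxrowsub_free U.
have /submxP[X XE] : (U <= F)%MS by rewrite eq_maxrowsub.
have fX : rowsub f X = 1%:M.
  by apply: (row_free_inj Ffree); rewrite mul1mx mul_rowsub_mx -XE.
have Gfull : row_full F^T by rewrite /row_full mxrank_tr; exact: Ffree.
pose g := fullrankfun Gfull.
pose c := colsub g F.
have cu : c \in unitmx.
  rewrite -unitmx_tr (_ : c^T = rowsub g F^T) ?fullrowsub_unit //.
  by apply/matrixP => i j; rewrite !mxE.
exists k, f, g, X, c, (invmx c *m F); split=> //.
- by rewrite /k rank_leq_row lt0n mxrank_eq0.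
- by split; [exact: maxrankfun_inj|exact: fullrankfun_inj].
- by rewrite -mulmxA mulKVmx.
- by split=> //; rewrite -mulmx_colsub mulVmx.
Qed.

Section Parametrization.
Variables (S : {set 'I_N}) (i0 : 'I_N) (k : nat) (f : 'I_k -> 'I_n) (g : 'I_k -> 'I_m)
  (a b : 'I_k).
Implicit Types w : I -> C.

Definition unused_coord : I := (i0, (g b, f a)).

Definition parX w : 'M[C]_(n, k) := \matrix_(q, l)
  if q \in codom f then (q == f l)%:R else w (i0, (g l, q)).
Definition parY w : 'M[C]_(k, m) := \matrix_(l, p)
  if p \in codom g then (p == g l)%:R else w (i0, (p, f l)).
Definition parc w : 'M[C]_k := \matrix_(l, l')
  if (l == a) && (l' == b) then 1 else w (i0, (g l', f l)).
Definition par0 w : 'M[C]_(m, n) := \matrix_(p, q)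
  if (p \in codom g) || (q \in codom f) then 0 else w (i0, (p, q)).
Definition parU w : 'M[C]_(n, m) := parX w *m parc w *m parY w.

(** The matrices [M] with [M X = 0] and [Y M = 0], parametrized by their entries
    outside the pivot rows and columns. *)
Definition parM w : 'M[C]_(m, n) :=
  (1%:M - colsub g 1%:M *m parY w) *m par0 w *m (1%:M - parX w *m rowsub f 1%:M).

Definition parL w (i : 'I_N) (p : 'I_m) (q : 'I_n) : C :=
  if (p == g b) && (q == f a)
  then - \sum_(e : 'I_m * 'I_n | e != (g b, f a)) parU w e.2 e.1 * w (i, e)
  else w (i, (p, q)).

(** The families that violate transversality with [y] of support [S] and [U] of
    given pivots, normalized by [y i0 = 1] and [c a b = 1].  For [i != i0] in [S],
    the condition on the trace determines the entry of [Lam i] at [(g b, f a)],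
    and the parameter [y i] takes its place; the equation
    [\sum_i y i *: Lam i = M] determines [Lam i0], and [X], [Y], [c] and [M] take
    its place.  As [c a b] is fixed, one place is left, so that bad families are
    parametrized by fewer coordinates than there are families. *)
Definition bad_family w (e : I) : C :=
  let: (i, (p, q)) := e in
  if i == i0 then parM w p q -
    \sum_(i' in S :\ i0) w (i', (g b, f a)) * parL w i' p q
  else if i \in S then parL w i p q else w e.

Definition poly_fun (h : (I -> C) -> C) := exists p : mpoly #|{: I}| C, forall w, h w = pev p w.

Lemma poly_fun_const c : poly_fun (fun _ => c).
Proof. by exists (mpolyC _ c) => w; rewrite pev_const. Qed.

Lemma poly_fun_coord e : poly_fun (fun w => w e).
Proof. by exists (mpolyX C (mnm1 (enum_rank e))) => w; rewrite pev_coord. Qed.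

Lemma poly_funD h1 h2 : poly_fun h1 -> poly_fun h2 -> poly_fun (fun w => h1 w + h2 w).
Proof. by move=> [p hp] [q hq]; exists (p + q) => w; rewrite hp hq /pev mevalD. Qed.

Lemma poly_funM h1 h2 : poly_fun h1 -> poly_fun h2 -> poly_fun (fun w => h1 w * h2 w).
Proof. by move=> [p hp] [q hq]; exists (p * q) => w; rewrite hp hq /pev mevalM. Qed.

Lemma poly_funN h : poly_fun h -> poly_fun (fun w => - h w).
Proof. by move=> [p hp]; exists (- p) => w; rewrite hp /pev mevalN. Qed.

Lemma poly_fun_sum (T : Type) (s : seq T) (Q : pred T) (h : T -> (I -> C) -> C) :
  (forall t, poly_fun (h t)) -> poly_fun (fun w => \sum_(t <- s | Q t) h t w).
Proof.
move=> hh; have /choice[p hp] := hh; exists (\sum_(t <- s | Q t) p t) => w.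
rewrite /pev raddf_sum; apply: eq_bigr => t _; exact: hp.
Qed.

Definition poly_mx k1 k2 (A : (I -> C) -> 'M[C]_(k1, k2)) := forall x y, poly_fun (fun w => A w x y).

Lemma poly_mxM k1 k2 k3 (A : (I -> C) -> 'M[C]_(k1, k2)) (B : (I -> C) -> 'M[C]_(k2, k3)) :
  poly_mx A -> poly_mx B -> poly_mx (fun w => A w *m B w).
Proof.
move=> hA hB x y.
rewrite (_ : (fun w => _) = fun w => \sum_z A w x z * B w z y).
  by apply: poly_fun_sum => z; exact: poly_funM.
by apply: funext => w; rewrite mxE.
Qed.

Lemma poly_mx_const k1 k2 (A : 'M[C]_(k1, k2)) : poly_mx (fun _ => A).
Proof. by move=> x y; exact: poly_fun_const. Qed.

Lemma poly_mxB k1 k2 (A B : (I -> C) -> 'M[C]_(k1, k2)) :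
  poly_mx A -> poly_mx B -> poly_mx (fun w => A w - B w).
Proof.
move=> hA hB x y.
rewrite (_ : (fun w => _) = fun w => A w x y + - B w x y).
  by apply: poly_funD => //; exact: poly_funN.
by apply: funext => w; rewrite !mxE.
Qed.

Lemma poly_mx_fun k1 k2 (A : 'I_k1 -> 'I_k2 -> (I -> C) -> C) :
  (forall x y, poly_fun (A x y)) -> poly_mx (fun w => \matrix_(x, y) A x y w).
Proof.
move=> h x y; rewrite (_ : (fun w => _) = A x y) //.
by apply: funext => w; rewrite mxE.
Qed.

Lemma poly_fun_if (cnd : bool) h1 h2 : poly_fun h1 -> poly_fun h2 ->
  poly_fun (fun w => if cnd then h1 w else h2 w).
Proof. by case: cnd. Qed.

Lemma poly_bad_family e : poly_fun (fun w => bad_family w e).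
Proof.
have pX : poly_mx parX.
  apply: poly_mx_fun => q l; apply: poly_fun_if; first exact: poly_fun_const.
  exact: poly_fun_coord.
have pY : poly_mx parY.
  apply: poly_mx_fun => q l; apply: poly_fun_if; first exact: poly_fun_const.
  exact: poly_fun_coord.
have pc : poly_mx parc.
  apply: poly_mx_fun => q l; apply: poly_fun_if; first exact: poly_fun_const.
  exact: poly_fun_coord.
have p0 : poly_mx par0.
  apply: poly_mx_fun => q l; apply: poly_fun_if; first exact: poly_fun_const.
  exact: poly_fun_coord.
have pU : poly_mx parU by apply: poly_mxM => //; exact: poly_mxM.
have pM : poly_mx parM.
  apply: poly_mxM; first apply: poly_mxM => //.
    apply: poly_mxB; first exact: poly_mx_const.
    by apply: poly_mxM => //; exact: poly_mx_const.
  apply: poly_mxB; first exact: poly_mx_const.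
  by apply: poly_mxM => //; exact: poly_mx_const.
have pL i p q : poly_fun (fun w => parL w i p q).
  apply: poly_fun_if; last exact: poly_fun_coord.
  apply: poly_funN; apply: poly_fun_sum => e'; apply: poly_funM => //.
  exact: poly_fun_coord.
case: e => i [p q]; rewrite /bad_family.
apply: poly_fun_if; last first.
  by apply: poly_fun_if => //; exact: poly_fun_coord.
apply: poly_funD => //; apply: poly_funN; apply: poly_fun_sum => i'.
by apply: poly_funM => //; exact: poly_fun_coord.
Qed.

(** The parametrization does not use one coordinate, hence its image lies in a
    hypersurface. *)
Lemma bad_family_equation : exists2 P : mpoly #|{: I}| C, P != 0 &
  forall w, w unused_coord = 0 -> pev P (bad_family w) = 0.
Proof.
have /choice[F hF] := poly_bad_family.
pose r := enum_rank unused_coord.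
pose V (v : 'I_#|{: I}| -> C) := v r = 0.
have rw : has_rewriting V (pred1 r) 1 (fun _ => 0%N).
  move=> q /eqP ->; exists (mpolyX C (mnm1 r)), 1%N; split=> //.
  - by move=> v Vv; rewrite mevalXU.
  - by rewrite mcoeffX eqxx.
  - by move=> a'; rewrite msuppX inE => /eqP ->; rewrite eqxx.
have [|P P0 hP] := algebraic_dependence rw (fun q : 'I_#|{: I}| => F (enum_val q)).
  by rewrite card1 addn1.
exists P => // w w0; rewrite -[RHS](hP (fun q => w (enum_val q))).
  by apply: meval_eq => q; rewrite hF.
by rewrite /V /r enum_rankK.
Qed.

End Parametrization.
Lemma colsub1_mul_tr k l (g : 'I_k -> 'I_l) : injective g ->
  1%:M - colsub g 1%:M *m (colsub g 1%:M)^T =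
  diag_mx (\row_p (p \notin codom g)%:R) :> 'M[C]_l.
Proof.
move=> ginj; apply/matrixP => p p'; rewrite !mxE.
have [/codomP[l0 ->]|pg] := boolP (p \in codom g); last first.
  rewrite big1 ?subr0 ?mulr1n // => l1 _; rewrite !mxE.
  by case: eqP pg => [->|_ _]; rewrite ?codom_f ?mul0r.
rewrite mul0rn (bigD1 l0) //= big1 => [|l1 ll0]; rewrite !mxE; last first.
  by rewrite (inj_eq ginj) eq_sym (negbTE ll0) mul0r.
by rewrite eqxx mul1r addr0 eq_sym subrr.
Qed.

(** Any violation of transversality can be normalized by scaling [y] and [U]. *)
Lemma parametrize_nontransversal (Lam : 'I_N -> 'M[C]_(m, n)) : ~ transversal Lam ->
  exists (S : {set 'I_N}) i0 k (f : 'I_k -> 'I_n) (g : 'I_k -> 'I_m) a b w,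
    [/\ (k <= n)%N, w (unused_coord i0 f g a b) = 0 &
      bad_family S i0 f g a b w = fun e => Lam e.1 e.2.1 e.2.2].
Proof.
move=> /existsNP[y] /existsNP[U0] /not_implyP[[i0 yi0]] /not_implyP[UM0].
move=> /not_implyP[MU0] /not_implyP[tr0 /eqP U00].
have [k [f [g [X [c [Y [[kn kpos] [finj ginj] UE [fX gY] cu]]]]]]] := rank_factorization U00.
have [a [b cab]] : exists a b, c a b != 0.
  apply: contrapT => /forallNP h; suff c0 : c = 0.
    by case/eqP: U00; rewrite UE c0 mulmx0 mul0mx.
  apply/matrixP => a b; rewrite mxE; apply/eqP/negP => /negP cab.
  by apply: (h a); exists b.
pose S := [set i | y i != 0]%SET.
pose y' i := y i / y i0; pose c' := (c a b)^-1 *: c.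
pose U := X *m c' *m Y.
have UE' : U = (c a b)^-1 *: U0 by rewrite /U /c' -scalemxAr -scalemxAl -UE.
pose M := \sum_i y' i *: Lam i.
have ME : M = (y i0)^-1 *: (\sum_i y i *: Lam i).
  by rewrite scaler_sumr; apply: eq_bigr => i _; rewrite scalerA mulrC.
have MX : M *m X = 0.
  rewrite ME -scalemxAl; apply/eqP; rewrite scaler_eq0; apply/orP; right.
  have : colsub g ((\sum_i y i *: Lam i) *m U0) = 0 by rewrite MU0; apply/matrixP => ? ?; rewrite !mxE.
  rewrite UE !mulmxA -mulmx_colsub gY mulmx1 => h.
  by rewrite -[_ *m X](mulmxK cu) h mul0mx.
have YM : Y *m M = 0.
  rewrite ME -scalemxAr; apply/eqP; rewrite scaler_eq0; apply/orP; right.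
  have : rowsub f (U0 *m (\sum_i y i *: Lam i)) = 0 by rewrite UM0; apply/matrixP => ? ?; rewrite !mxE.
  rewrite UE -!mulmxA -mul_rowsub_mx fX mul1mx => h.
  by rewrite -[Y *m _](mulKmx cu) h mulmx0.
have [fi fiK] : exists fi, cancel f fi.
  exists (fun q => odflt a [pick l | f l == q]) => l.
  by case: pickP => [l' /eqP/finj //|/(_ l)]; rewrite eqxx.
have [gi giK] : exists gi, cancel g gi.
  exists (fun q => odflt a [pick l | g l == q]) => l.
  by case: pickP => [l' /eqP/ginj //|/(_ l)]; rewrite eqxx.
(* The coordinates at [i0] store [c'], [X], [Y] and [M]; those at another [i]
   store [Lam i], with [y' i] in the place of the entry that is determined. *)
pose w (e : I) : C := let: (i, (p, q)) := e in
  if i == i0 then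
    if (p, q) == (g b, f a) then 0 else
    if p \in codom g then if q \in codom f then c' (fi q) (gi p) else X q (gi p)
    else if q \in codom f then Y (fi q) p else M p q
  else if (i \in S) && ((p, q) == (g b, f a)) then y' i else Lam i p q.
have XE : parX i0 f g w = X.
  apply/matrixP => q l; rewrite mxE /w /= eqxx codom_f giK.
  case: ifP => [/codomP[l0 ->]|qf].
    by move: fX => /matrixP/(_ l0 l); rewrite !mxE => ->; rewrite (inj_eq finj).
  by rewrite xpair_eqE qf; case: (q =P f a) qf => [->|_]; rewrite ?codom_f ?andbF.
have YE : parY i0 f g w = Y.
  apply/matrixP => l p; rewrite mxE /w /= eqxx codom_f fiK.
  case: ifP => [/codomP[l0 ->]|pg].
    by move: gY => /matrixP/(_ l l0); rewrite !mxE => ->; rewrite (inj_eq ginj) eq_sym.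
  by rewrite xpair_eqE pg; case: (p =P g b) pg => [->|_]; rewrite ?codom_f.
have cE : parc i0 f g a b w = c'.
  apply/matrixP => l l'; rewrite mxE /w /= eqxx !codom_f fiK giK xpair_eqE.
  rewrite (inj_eq finj) (inj_eq ginj) [X in if X then 0 else _]andbC.
  by case: ifP => [/andP[/eqP -> /eqP ->]|->]; rewrite ?mxE ?mulVf.
have UEw : parU i0 f g a b w = U by rewrite /parU XE YE cE.
have ME0 : parM i0 f g w = M.
  have -> : parM i0 f g w = (1%:M - colsub g 1%:M *m Y) *m
      (diag_mx (\row_p (p \notin codom g)%:R) *m M *m
       diag_mx (\row_p (p \notin codom f)%:R)) *m (1%:M - X *m rowsub f 1%:M).
    rewrite /parM XE YE; congr (_ *m _ *m _); apply/matrixP => p q.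
    rewrite mul_diag_mx mul_mx_diag !mxE /w /= eqxx xpair_eqE.
    case: ifP => [/orP[->|->]|/norP[pg qf]]; rewrite ?mul0r ?mulr0 //.
    rewrite (negbTE pg) (negbTE qf) mul1r mulr1.
    by case: (p =P g b) pg => [->|]; rewrite ?codom_f.
  rewrite -(colsub1_mul_tr ginj) -(colsub1_mul_tr finj).
  have -> : rowsub f 1%:M = (colsub f 1%:M)^T :> 'M[C]_(k, n).
    by apply/matrixP => l q; rewrite !mxE eq_sym.
  set Pg := colsub g 1%:M; set Pf := colsub f 1%:M.
  have YPg : Y *m Pg = 1%:M by rewrite mulmx_colsub mulmx1.
  have PfX : Pf^T *m X = 1%:M.
    rewrite -fX -[in RHS](mul1mx X) -mul_rowsub_mx; congr (_ *m _).
    by apply/matrixP => l q; rewrite !mxE eq_sym.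
  have h1 : (1%:M - Pg *m Y) *m (1%:M - Pg *m Pg^T) *m M = M.
    rewrite [_ *m (1%:M - _)]mulmxBr mulmx1 mulmxA [(_ - _) *m Pg]mulmxBl mul1mx.
    rewrite -(mulmxA Pg Y) YPg mulmx1 subrr mul0mx subr0.
    by rewrite mulmxBl mul1mx -mulmxA YM mulmx0 subr0.
  have h2 : M *m ((1%:M - Pf *m Pf^T) *m (1%:M - X *m Pf^T)) = M.
    rewrite [_ *m (1%:M - _)]mulmxBl mul1mx -mulmxA [Pf^T *m _]mulmxBr mulmx1.
    rewrite mulmxA PfX mul1mx subrr mulmx0 subr0.
    by rewrite mulmxBr mulmx1 mulmxA MX mul0mx subr0.
  by rewrite !mulmxA h1 -mulmxA h2.
have LE i p q : i \in S -> i != i0 -> parL i0 f g a b w i p q = Lam i p q.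
  move=> iS ii0; rewrite /parL /w /= (negbTE ii0) iS /=.
  case: ifP => [/andP[/eqP -> /eqP ->]|]; last by rewrite xpair_eqE => ->.
  have : \tr (U *m Lam i) = 0.
    by rewrite UE' -scalemxAl linearZ /= tr0 ?mulr0 //; move: iS; rewrite inE.
  have -> : \tr (U *m Lam i) = \sum_e U e.2 e.1 * Lam i e.1 e.2.
    rewrite /mxtrace (eq_bigr (fun q => \sum_p U q p * Lam i p q)).
      by rewrite exchange_big pair_big.
    by move=> q' _; rewrite mxE.
  rewrite (bigD1 (g b, f a)) //= => /eqP; rewrite addrC addr_eq0 => /eqP h.
  have Uab : U (f a) (g b) = 1.
    have -> : U (f a) (g b) = (rowsub f X *m c' *m colsub g Y) a b.
      by rewrite mul_rowsub_mx mul_rowsub_mx mulmx_colsub !mxE.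
    by rewrite fX gY mul1mx mulmx1 mxE mulVf.
  rewrite Uab mul1r in h; rewrite -[RHS]opprK -h; congr (- _).
  apply: eq_bigr => -[p' q'] /negbTE pq; rewrite UEw /=.
  by rewrite pq.
exists S, i0, k, f, g, a, b, w; split=> //.
  by rewrite /unused_coord /w !eqxx.
apply: funext => -[i [p q]]; rewrite /bad_family ME0 /=.
case: eqP => [->|/eqP ii0]; last first.
  by case: ifP => [iS|iS]; [exact: LE|rewrite /w /= ?(negbTE ii0) iS].
rewrite {1}/M summxE (bigD1 i0) //= /y' divff // mxE mul1r -addrA.
rewrite -[RHS]addr0; congr (_ + _); apply/eqP; rewrite subr_eq0; apply/eqP.
rewrite (bigID (mem S)) /= [X in _ + X]big1 ?addr0.
  apply: eq_big => [i'|i' /andP[i'i0 i'S]]; first by rewrite !inE andbC.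
  by rewrite mxE LE // /w /= (negbTE i'i0) i'S eqxx.
by move=> i' /andP[_]; rewrite inE negbK => /eqP ->; rewrite mul0r scale0r mxE.
Qed.

(** Take a point outside of finitely many hypersurfaces. *)
Lemma transversal_exists : exists Lam, transversal Lam.
Proof.
pose D := ({set 'I_N} * 'I_N *
  {k : 'I_n.+1 & ({ffun 'I_k -> 'I_n} * {ffun 'I_k -> 'I_m} * 'I_k * 'I_k)%type})%type.
have /choice[P hP'] (t : D) : exists P : mpoly #|{: I}| C,
    let: (Y, i0, existT k (f, g, a, b)) := t in
    P != 0 /\ forall w, w (unused_coord i0 f g a b) = 0 ->
      pev P (bad_family Y i0 f g a b w) = 0.
  move: t => [[Y i0] [k [[[f g] a] b]]].
  by have [P P0 hP] := bad_family_equation Y i0 f g a b; exists P.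
have [v vP] : exists v, meval v (\prod_(t : D) P t) != 0.
  apply: nonvanishing_point; apply/prodf_neq0 => t _; have := hP' t.
  by move: t => [[Y i0] [k [[[f g] a] b]]] [].
pose Lam i : 'M[C]_(m, n) := \matrix_(p, q) v (enum_rank (i, (p, q)) : 'I_#|{: I}|).
exists Lam; apply: contrapT => /parametrize_nontransversal.
move=> [S [i0 [k [f [g [a [b [w [kn w0 bE]]]]]]]]].
pose t : D := (S, i0, existT _ (Ordinal (kn : (k < n.+1)%N)) ([ffun l => f l], [ffun l => g l], a, b)).
have [_ /(_ w)] := hP' t; rewrite /t /=.
have -> : [ffun l => f l] = f :> (_ -> _) by apply: funext => l; rewrite ffunE.
have -> : [ffun l => g l] = g :> (_ -> _) by apply: funext => l; rewrite ffunE.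
rewrite bE => /(_ w0) Pt; move/eqP: vP; apply; rewrite rmorph_prod (bigD1 t) //=.
rewrite [X in X * _](_ : _ = 0) ?mul0r // -[RHS]Pt; apply: meval_eq => x.
by rewrite mxE -!surjective_pairing enum_valK.
Qed.

End GenericPencil.

(** * Matrices of Fermat type *)

Section Fermat.
Variables (R : realType) (N m n : nat).
Local Notation C := (Cplx R).
Local Notation J := ('I_m * 'I_n)%type.
Local Notation L := (gen_index N m n).

Definition gen_degree d (l : L) : nat := if l is inl _ then d.-1 else d.

Lemma poly_gen_hom (p : J -> mpoly N C) d : (0 < d)%N -> (forall j, hom_deg d (p j)) ->
  forall l j, hom_deg (gen_degree d l) (poly_gen p l j).
Proof.
move=> d0 hp [i|[cd|cd]] j a ad /=.
- rewrite mcoeff_deriv hp ?mul0rn // mdegD mdeg1 addn1.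
  by apply: contra ad => /eqP <-.
- by rewrite mulr_natl mcoeffMn hp ?mul0rn.
- by rewrite mulr_natr mcoeffMn hp ?mul0rn.
Qed.

Lemma poly_gen_sum (T : finType) (c : T -> C) (p : T -> J -> mpoly N C) l j :
  poly_gen (fun j' => \sum_t c t *: p t j') l j = \sum_t c t *: poly_gen (p t) l j.
Proof.
case: l => [i|[cd|cd]] /=.
- by rewrite raddf_sum; apply: eq_bigr => t _; exact: mderivZ.
- by rewrite mulr_sumr; apply: eq_bigr => t _; rewrite scalerAr.
- by rewrite mulr_suml; apply: eq_bigr => t _; rewrite scalerAl.
Qed.

Lemma macaulay_sum e M Gam (T : finType) (c : T -> C) (p : T -> J -> mpoly N C) :
  macaulay e M Gam (fun j => \sum_t c t *: p t j) = \sum_t c t *: macaulay e M Gam (p t).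
Proof.
apply/matrixP => x y; rewrite summxE !mxE.
under [RHS]eq_bigr => t _ do rewrite !mxE -mcoeffZ.
rewrite -raddf_sum; congr (mcoeff _ _); rewrite /macaulay_row.
under [RHS]eq_bigr => t _ do rewrite scalerAr.
rewrite -mulr_sumr; congr (_ * _).
under [RHS]eq_bigr => t _ do rewrite scaler_sumr.
rewrite exchange_big; apply: eq_bigr => l _ /=; rewrite poly_gen_sum mulr_sumr.
by apply: eq_bigr => t _; rewrite scalerAr.
Qed.

Section Homogeneous.
Variables (d e M : nat) (Gam : 'I_N -> J -> L -> mpoly N C).
Hypothesis d0 : (0 < d)%N.
Hypothesis de : (d < e)%N.
Hypothesis Gam_hom : forall i j l, hom_deg (e - gen_degree d l)%N (Gam i j l).

Lemma pivot_lem (b : big_monomial N e M) :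
  lem (mnm_muln (mnm1 (pivot_var b)) e) (bmnm (val b)).
Proof.
apply/mnm_lepP => i; rewrite mulmnE mnm1E; case: eqP => [<-|_]; rewrite ?mul0n //.
by rewrite mul1n; exact: (xchooseP (big_exponentP b)).
Qed.

Lemma mdeg_pivot (b : big_monomial N e M) :
  mdeg (mnm_sub (bmnm (val b)) (mnm_muln (mnm1 (pivot_var b)) e)) = (mdeg (bmnm (val b)) - e)%N.
Proof. by rewrite -[X in (mdeg X - e)%N](submK (pivot_lem b)) mdegD mdegMn mdeg1 mul1n addnK. Qed.

Lemma macaulay_hom p d' x y : (0 < d')%N -> (forall j, hom_deg d' (p j)) ->
  (mdeg (bmnm (val (enum_val y).1)) != mdeg (bmnm (val (enum_val x).1)) + d' - d)%N ->
  macaulay e M Gam p x y = 0.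
Proof.
move=> d'0 hp; rewrite mxE /macaulay_row mulr_sumr raddf_sum => yx /=.
apply: big1 => l _.
have := hom_degM (@hom_degX C N (mnm_sub (bmnm (val (enum_val x).1))
   (mnm_muln (mnm1 (pivot_var (enum_val x).1)) e)))
  (hom_degM (@Gam_hom (pivot_var (enum_val x).1) (enum_val x).2 l)
     (@poly_gen_hom _ _ d'0 hp l (enum_val y).2)).
apply; rewrite mdeg_pivot; apply: contra yx => /eqP ->; apply/eqP.
have : (e <= mdeg (bmnm (val (enum_val x).1)))%N.
  have [i hi] := big_exponentP (enum_val x).1; apply: leq_trans hi _.
  by rewrite mdegE (bigD1 i) //= leq_addr.
by case: l => _ /=; lia.
Qed.

Lemma macaulay_identity p :
  (forall i j j', \sum_l Gam i j l * poly_gen p l j' = (j == j')%:R * mpolyX C (mnm1 i) ^+ e) ->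
  macaulay e M Gam p = 1%:M.
Proof.
move=> hG; apply/matrixP => x y; rewrite !mxE /macaulay_row hG.
rewrite mulrCA mpolyXn -mpolyXD submK ?pivot_lem // mulr_natl mcoeffMn mcoeffX.
rewrite -mulrnA mulnb -[x == y](inj_eq enum_val_inj).
by case: (enum_val x) (enum_val y) => [b1 j1] [b2 j2]; rewrite xpair_eqE.
Qed.

End Homogeneous.

Variable Lam : 'I_N -> 'M[C]_(m, n).

Definition fermat d (j : J) : mpoly N C :=
  \sum_i Lam i j.1 j.2 *: mpolyX C (mnm_muln (mnm1 i) d).

Lemma fermat_hom d j : hom_deg d (fermat d j).
Proof.
apply: hom_deg_sum => i _; apply: hom_degZ.
have := @hom_degX C N (mnm_muln (mnm1 i) d).
by rewrite mdegMn mdeg1 mul1n.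
Qed.

Hypothesis Lam_transversal : transversal Lam.

(** At a point other than the origin, the tangent space to the orbit of the
    matrix [fermat d] spans all matrices: a linear form that vanishes on it is
    given by a matrix [U] as in [transversal]. *)
Lemma fermat_submersive d i (v : 'I_N -> C) : (0 < d)%N -> v i = 1 ->
  forall u : J -> C, (forall l, \sum_j u j * meval v (poly_gen (fermat d) l j) = 0) ->
  forall j, u j = 0.
Proof.
move=> d0 vi u hu; pose U : 'M[C]_(n, m) := \matrix_(q, p) u (p, q).
pose M := \sum_i v i ^+ d *: Lam i.
have fM j : meval v (fermat d j) = M j.1 j.2.
  rewrite summxE raddf_sum; apply: eq_bigr => k _ /=.
  by rewrite mevalZ -mpolyXn rmorphXn /= mevalXU mxE mulrC.
have sumJ (F : J -> C) : \sum_j F j = \sum_p \sum_q F (p, q).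
  by rewrite pair_bigA; apply: eq_bigr => -[].
have U0 : U = 0.
  apply: (Lam_transversal (y := fun i => v i ^+ d)).
  - by exists i; rewrite vi expr1n oner_eq0.
  - apply/matrixP => q p; rewrite !mxE -[RHS](hu (inr (inr (p, q)))).
    rewrite sumJ /=.
    apply: eq_bigr => p' _; rewrite (bigD1 q) //= [X in _ + X]big1 => [|q' /negbTE q'q]; last first.
      by rewrite q'q mulr0 meval0 mulr0.
    by rewrite addr0 eqxx mulr1 fM !mxE.
  - apply/matrixP => p' p; rewrite !mxE -[RHS](hu (inr (inl (p, p')))).
    rewrite sumJ /=.
    rewrite (bigD1 p) //= [X in _ + X]big1 => [|p2 /negbTE p2p]; last first.
      by apply: big1 => q' _; rewrite p2p mul0r meval0 mulr0.
    rewrite addr0; apply: eq_bigr => q' _.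
    by rewrite eqxx mul1r fM !mxE mulrC.
  - move=> k vk0; have vk : v k != 0.
      by apply: contra vk0 => /eqP ->; rewrite expr0n; case: (d) d0.
    have := hu (inl k).
    have dE j : meval v (poly_gen (fermat d) (inl k) j) = (d%:R * v k ^+ d.-1) * Lam k j.1 j.2.
      rewrite -[poly_gen _ _ _]/(mderiv k (fermat d j)) /fermat.
      rewrite [mderiv k _](raddf_sum (mderiv k)) [meval v _](raddf_sum (meval v)).
      rewrite (eq_bigr (fun i' => if i' == k then d%:R * v k ^+ d.-1 * Lam k j.1 j.2 else 0)).
        by rewrite -big_mkcond big_pred1_eq.
      move=> i' _; transitivity (meval v (mderiv k (Lam i' j.1 j.2 *: mpolyX C (mnm_muln (mnm1 i') d)))).
        by [].
      rewrite mderivZ mderivX mulmnE mnm1E.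
      case: eqP => [->|_]; last by rewrite mul0n scale0r scaler0 meval0.
      rewrite mul1n !mevalZ mulrC; congr (_ * _ * _).
      rewrite -[d in mnm_muln _ d](prednK d0) mulmS -[X in mnm_sub X _]addmC addmK.
      by rewrite -mpolyXn rmorphXn /= mevalXU.
    rewrite (eq_bigr (fun j => (d%:R * v k ^+ d.-1) * (u j * Lam k j.1 j.2))); last first.
      by move=> j _; rewrite dE mulrCA.
    rewrite -mulr_sumr => /eqP; rewrite !mulf_eq0 pnatr_eq0 eqn0Ngt d0 expf_eq0 (negbTE vk).
    rewrite andbF /= => /eqP E; rewrite -[RHS]E /mxtrace.
    rewrite sumJ exchange_big /=.
    apply: eq_bigr => q _; rewrite mxE.
    by apply: eq_bigr => p _; rewrite mxE.
by move=> [p q]; have /matrixP/(_ q p) := U0; rewrite !mxE.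
Qed.

(** The Nullstellensatz on the hyperplane [v i = 1], where the generators span all
    matrices, followed by homogenization. *)
Lemma fermat_combinations d : (0 < d)%N -> exists e (Gam : 'I_N -> J -> L -> mpoly N C),
  [/\ (d < e)%N, forall i j l, hom_deg (e - gen_degree d l)%N (Gam i j l) &
    forall i j j', \sum_l Gam i j l * poly_gen (fermat d) l j' =
      (j == j')%:R * mpolyX C (mnm1 i) ^+ e].
Proof.
move=> d0; have ghom := @poly_gen_hom (fermat d) d d0 (@fermat_hom d).
have /choice[e0 he0] i : exists e0, forall e, (e0 <= e)%N ->
    annihilates (poly_gen (fermat d)) (mpolyX C (mnm1 i) ^+ e).
  have [|f [q [hf fE]]] := @annihilates_mod _ N (@Cplx_closed R) (@uncountable_fibre R)
      _ _ (poly_gen (fermat d)) i.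
    by move=> v vi u; exact: (fermat_submersive d0 vi).
  exact: (annihilates_power (t := poly_gen (fermat d)) ghom hf fE).
pose e := (d.+1 + \max_i e0 i)%N.
have eP i : (e0 i <= e)%N by apply: leq_trans (leq_addl _ _); exact: leq_bigmax.
have /choice[v hv] (ij : 'I_N * J) := he0 ij.1 e (eP ij.1) ij.2.
have de (l : L) : (gen_degree d l <= e)%N by case: l => [?|?] /=; rewrite /e; lia.
exists e, (fun i j l => hom_part (e - gen_degree d l) (v (i, j) l)); split.
- by rewrite /e; lia.
- by move=> i j l; exact: hom_part_hom.
- move=> i j j'; have := hom_combination (t := poly_gen (fermat d)) ghom e (hv (i, j)) j'.
  rewrite hom_part_id /= => [<-|a ae]; first by apply: eq_bigr => l _; rewrite de.
  rewrite mulr_natl mcoeffMn mpolyXn mcoeffX.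
  case: eqP => [am|_]; last by rewrite mul0rn.
  by move: ae; rewrite -am mdegMn mdeg1 mul1n eqxx.
Qed.

(** The rows for [fermat d] are the monomial vectors themselves, and those for
    [fermat d'] are homogeneous of degrees larger by [d' - d]. *)
Lemma fermat_macaulay d : (0 < d)%N -> exists e (Gam : 'I_N -> J -> L -> mpoly N C),
  forall M, macaulay e M Gam (fermat d) = 1%:M /\ forall d' x y, (d < d')%N ->
   (mdeg (bmnm (val (enum_val y).1)) <= mdeg (bmnm (val (enum_val x).1)))%N ->
   macaulay e M Gam (fermat d') x y = 0.
Proof.
move=> d0; have [e [Gam [de Gh hG]]] := fermat_combinations d0.
exists e, Gam => M; split; first exact: macaulay_identity.
move=> d' x y dd yx; apply: (macaulay_hom d0 de Gh) (@fermat_hom d') _; first by lia.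
by apply/eqP; lia.
Qed.

End Fermat.

(** * Jets of germs that are not finitely determined *)

Section Jets.
Variables (R : realType) (N m n : nat).
Local Notation C := (Cplx R).
Local Notation J := ('I_m * 'I_n)%type.
Local Notation jets r := (jet_space R N m n r).

Definition jet_poly r (z : jets r) : J -> mpoly N C :=
  fun j => \sum_(a : bmultinom N r.+1) z (j, a) *: mpolyX C (bmnm a).

Definition poly_jet r (p : J -> mpoly N C) : jets r :=
  [ffun i => mcoeff (bmnm i.2) (p i.1)].

Lemma mcoeff_jet_poly r (z : jets r) j (a : bmultinom N r.+1) :
  mcoeff (bmnm a) (jet_poly z j) = z (j, a).
Proof.
rewrite /jet_poly raddf_sum (bigD1 a) //= big1 ?addr0 => [|b ba].
  by rewrite mcoeffZ mcoeffX eqxx mulr1.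
by rewrite mcoeffZ mcoeffX [_ == _](negbTE ba) mulr0.
Qed.

Lemma jet_poly_large r (z : jets r) j a : (r < mdeg a)%N -> mcoeff a (jet_poly z j) = 0.
Proof.
move=> ra; rewrite /jet_poly raddf_sum big1 // => b _ /=.
rewrite mcoeffZ mcoeffX; case: eqP => [E|_]; last by rewrite mulr0.
by have := bmdeg b; rewrite E ltnS leqNgt ra.
Qed.

Lemma poly_jetK r d p : (forall j, hom_deg d (p j)) -> (d <= r)%N ->
  jet_poly (poly_jet r p) = p.
Proof.
move=> hp dr; apply: funext => j; apply/mpolyP => a.
have [ar|ra] := leqP (mdeg a) r.
  by rewrite -[a]/(bmnm (BMultinom (ar : (mdeg a < r.+1)%N))) mcoeff_jet_poly ffunE.
by rewrite jet_poly_large // hp //; lia.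
Qed.

Lemma jet_poly_sum r (T : finType) (c : T -> C) (z : T -> jets r) :
  jet_poly [ffun i => \sum_t c t * z t i] = fun j => \sum_t c t *: jet_poly (z t) j.
Proof.
apply: funext => j; rewrite /jet_poly.
under [RHS]eq_bigr => t _ do rewrite scaler_sumr.
rewrite exchange_big; apply: eq_bigr => a _; rewrite ffunE scaler_suml.
by apply: eq_bigr => t _; rewrite scalerA.
Qed.

Definition zariski_closure (I : finType) (V : set {ffun I -> C}) : set {ffun I -> C} :=
  [set x | forall p, (forall y, V y -> peval p y = 0) -> peval p x = 0].

Lemma zariski_closure_algebraic I V : algebraic_set (@zariski_closure I V).
Proof. by exists [set p | forall y, V y -> peval p y = 0]. Qed.

Definition undetermined_jets r : set (jets r) :=
  [set jet r F | F in [set F | analytic_mx F /\ ~ finitely_G_determined F]].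

(** The projection of jets is polynomial and maps the jet of a germ to a jet of
    the same germ. *)
Lemma undetermined_proalgebraic :
  proalgebraic (fun r => zariski_closure (@undetermined_jets r)).
Proof.
split=> [r|r x hx p hp]; first exact: zariski_closure_algebraic.
pose t := [tuple mpolyX C (mnm1 (enum_rank ((enum_val k).1, widen_bmultinom (enum_val k).2)))
  | k < #|jet_index N m n r|] : #|jet_index N m n r|.-tuple (mpoly #|jet_index N m n r.+1| C).
have tE y : peval (comp_mpoly t p) y = peval p (jet_proj y).
  rewrite /peval comp_mpoly_meval; apply: meval_eq => k.
  by rewrite tnth_mktuple mevalXU enum_rankK ffunE.
rewrite -tE; apply: hx => _ [F [anF nF] <-]; rewrite tE; apply: hp.
by exists F => //; apply/ffunP => k; rewrite !ffunE.
Qed.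

(** A nonzero determinant forces finite determinacy, by [macaulay_criterion] and
    [determinacy_criterion]. *)
Lemma macaulay_det_undetermined e M Gam r (z : jets r) :
  (#|{: {ffun 'I_N -> 'I_e} * J}| + 2 <= M)%N -> (M <= r)%N ->
  undetermined_jets z -> \det (macaulay e M Gam (jet_poly z)) = 0.
Proof.
move=> sM Mr [F [anF nF] <-]; apply/eqP/negPn/negP => d0; apply: nF.
have [|K [K0 KM hK]] := @macaulay_criterion _ N m n e M Gam (jet_poly (jet r F)) _ sM.
  by rewrite unitmxE unitfE.
exists (2 * K)%N; apply: (determinacy_criterion (r := r) (p := jet_poly (jet r F)) anF K0).
- exact: leq_trans KM Mr.
- move=> j a ar; rewrite -[a]/(bmnm (BMultinom (ar : (mdeg a < r.+1)%N))).
  by rewrite mcoeff_jet_poly ffunE.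
- move=> b j bK; have [v hv] := hK b j bK; exists v => j' a aK.
  by rewrite hv // mcoeff_monomial_vec.
Qed.

(** The determinant is a polynomial in the jet. *)
Lemma macaulay_det_closure e M Gam r (z : jets r) :
  (#|{: {ffun 'I_N -> 'I_e} * J}| + 2 <= M)%N -> (M <= r)%N ->
  zariski_closure (@undetermined_jets r) z -> \det (macaulay e M Gam (jet_poly z)) = 0.
Proof.
move=> sM Mr hz.
pose delta (q : 'I_#|jet_index N m n r|) : jets r := [ffun i => (i == enum_val q)%:R].
pose P := \det (pencil (fun q => macaulay e M Gam (jet_poly (delta q)))).
have PE y : peval P y = \det (macaulay e M Gam (jet_poly y)).
  rewrite /peval meval_pencil -macaulay_sum -jet_poly_sum; congr (\det (macaulay _ _ _ (jet_poly _))).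
  apply/ffunP => i; rewrite ffunE (bigD1 (enum_rank i)) //= big1 ?addr0.
    by rewrite ffunE enum_rankK eqxx mulr1.
  move=> q qi; rewrite ffunE; case: eqP => [E|_]; last by rewrite mulr0.
  by rewrite E enum_valK eqxx in qi.
by rewrite -PE; apply: hz => y hy; rewrite PE macaulay_det_undetermined.
Qed.

Hypotheses (hN : (0 < N)%N) (hm : (0 < m)%N) (hn : (0 < n)%N).

Lemma transversal_neq0 (Lam : 'I_N -> 'M[C]_(m, n)) : transversal Lam ->
  exists i (j : J), Lam i j.1 j.2 != 0.
Proof.
move=> tL; apply: contrapT => /forallNP h.
have L0 i : Lam i = 0.
  apply/matrixP => p q; rewrite mxE; apply/eqP/negP => /negP pq.
  by apply: (h i); exists (p, q).
have := tL (fun _ => 1) (const_mx 1); rewrite big1 => [|i _]; last by rewrite L0 scaler0.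
rewrite mulmx0 mul0mx => /(_ _ erefl erefl) H.
have /matrixP/(_ (Ordinal hn) (Ordinal hm)) : const_mx 1 = 0 :> 'M[C]_(n, m).
  apply: H; first by exists (Ordinal hN); exact: oner_neq0.
  by move=> i _; rewrite L0 mulmx0 mxtrace0.
by rewrite !mxE => /eqP; rewrite oner_eq0.
Qed.

(** The jets of the matrices [fermat Lam d], [d = 1, ..., k], serve as the
    directions [g] of [chain_length_bound]. *)
Lemma undetermined_chain_bound k : exists r0, forall r, (r0 <= r)%N -> forall d,
  irreducible_chain (zariski_closure (@undetermined_jets r)) d ->
  (d + k <= #|jet_index N m n r|)%N.
Proof.
have [Lam tL] := transversal_exists R N m n.
have [i0 [j0 L0]] := transversal_neq0 tL.
have /choice[e /choice[Gam hA]] (l : 'I_k) := fermat_macaulay tL (ltn0Sn l).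
pose M l := (#|{: {ffun 'I_N -> 'I_(e l)} * J}| + 2)%N.
exists (k + \max_l M l)%N => r kr d.
have lr (l : 'I_k) : (l < r)%N by have := ltn_ord l; lia.
have Mr l : (M l <= r)%N.
  by apply: leq_trans kr; apply: leq_trans (leq_addl _ _); exact: (leq_bigmax l).
have pd (l : 'I_k) : (mdeg (mnm_muln (@mnm1 N i0) l.+1) < r.+1)%N.
  by rewrite mdegMn mdeg1 mul1n ltnS.
have gE (l : 'I_k) : jet_poly (poly_jet r (fermat Lam l.+1)) = fermat Lam l.+1.
  by apply: poly_jetK (lr l); exact: fermat_hom.
apply: (chain_length_bound (g := fun l : 'I_k => poly_jet r (fermat Lam l.+1))
  (piv := fun l => (j0, BMultinom (pd l)))
  (A := fun l z => macaulay (e l) (M l) (Gam l) (jet_poly z))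
  (deg := fun l x => mdeg (bmnm (val (enum_val x).1)))).
- move=> l; rewrite ffunE /= raddf_sum (bigD1 i0) //= big1 ?addr0.
    by rewrite mcoeffZ mcoeffX eqxx mulr1.
  move=> i ii0; rewrite mcoeffZ mcoeffX; case: eqP => [/mnmP/(_ i0)|_]; last by rewrite mulr0.
  by rewrite !mulmnE !mnm1E (negbTE ii0) eqxx mul0n mul1n.
- move=> l l' ll'; rewrite ffunE /= fermat_hom // mdegMn mdeg1 mul1n eqSS.
  by rewrite eq_sym.
- by move=> l s c z; rewrite jet_poly_sum macaulay_sum.
- by move=> l; rewrite gE; have [] := hA l (M l).
- move=> l l' ll' x y yx; rewrite gE; have [_ ->//] := hA l (M l).
- by move=> z hz l; apply: macaulay_det_closure hz.
Qed.

Lemma undetermined_infinite_codim :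
  infinite_codim (fun r => zariski_closure (@undetermined_jets r)).
Proof.
apply/cvgeyPge => B; have [r0 hr0] := undetermined_chain_bound (Num.bound `|B|).
near=> r; have rr : (r0 <= r)%N by near: r; exact: nbhs_infty_ge.
set c := Num.bound `|B|; apply: (@le_trans _ _ (c%:R)%:E).
  by rewrite lee_fin (le_trans (ler_norm B)) // ltW // archi_boundP.
have dimle : (dim_alg (zariski_closure (@undetermined_jets r)) <=
    (#|jet_index N m n r|%:R - c%:R)%:E)%E.
  apply: ge_ereal_sup => _ [d hd <-]; rewrite lee_fin lerBrDr -natrD ler_nat.
  exact: hr0.
have := leeB (lexx (#|jet_index N m n r|%:R)%:E) dimle.
by rewrite -EFinB opprB addrC subrK.
Unshelve. all: by end_near.
Qed.

End Jets.

Theorem theorem3p4 (R : realType) (N m n : nat)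
    (hN : (0 < N)%N) (hm : (0 < m)%N) (hn : (0 < n)%N) :
  holds_in_general (@finitely_G_determined R N m n).
Proof.
exists (fun r => zariski_closure (@undetermined_jets R N m n r)); split.
- exact: undetermined_proalgebraic.
- exact: undetermined_infinite_codim.
- move=> F anF nF; apply: contrapT => h; apply: nF; split=> // r p hp.
  by apply: hp; exists F.
Qed.
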